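(* Let $m=\begin{pmatrix}0&1\\0&0\end{pmatrix}$ and let $V_{m,1}$ be the corresponding representation of $G_\epsilon$ attached to the trivial character of $Z_G(m)$. Let $f_0\in V_{m,1}^{K_\epsilon}$ be the unique element satisfying $f_0(1)=1$ and $f_0(t_{\varpi^r})=0$ for all $r\in\mathbb{Z}\smallsetminus\{0\}$, and normalize the unitary structure on $V_{m,1}$ by requiring $f_0$ to have norm $1$. Then there exists a unique isomorphism $\Phi$ of Hilbert spaces from the completion of $V_{m,1}^{K_\epsilon}$ onto $$L^2\left([-2q^{1/2},2q^{1/2}],\ (2\pi q)^{-1}\sqrt{4q-x^2}\,dx\right)$$ satisfying the following two properties: (1) $\Phi(T_0f)=\mathrm{id}\cdot\Phi(f)$ for all $f\in V_{m,1}^{K_\epsilon}$, where $\mathrm{id}$ is the function $x\mapsto x$ on $[-2q^{1/2},2q^{1/2}]$; (2) $\Phi(f_0)=1$.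
   Context: $F$ is a non-Archimedean local field of characteristic different from $2$, $\mathcal{O}$ its ring of integers, $\varpi$ a generator of the maximal ideal, $\kappa=\mathcal{O}/\varpi\mathcal{O}$, $q=|\kappa|$. For a ring $A$, $A_\epsilon:=A[\epsilon]/(\epsilon^2)$. Put $G=\mathrm{PGL}_2(F)$, $G_\epsilon=\mathrm{PGL}_2(F_\epsilon)$, $K_\epsilon=\mathrm{PGL}_2(\mathcal{O}_\epsilon)$, $\mathfrak{g}=\mathfrak{sl}_2(F)$. Elements of $\mathrm{PGL}_2$ are written as matrices in $\mathrm{GL}_2$; $t_x:=\begin{pmatrix}x&0\\0&1\end{pmatrix}$. One has $G_\epsilon=(1+\epsilon\mathfrak{g})\rtimes G$. $T_0:=q^{-1}\,\mathrm{ch}_{K_\epsilon t_\varpi K_\epsilon}$ in the Hecke algebra of $(G_\epsilon,K_\epsilon)$ (Haar measure with $\mathrm{vol}(K_\epsilon)=1$); on the $K_\epsilon$-invariants $V^{K_\epsilon}$ of a smooth representation $V$ of $G_\epsilon$ it acts by $T_0v=q^{-1}\sum_{gK_\epsilon\subset K_\epsilon t_\varpi K_\epsilon}gv$. Fix an additive character $\psi_0:F\to\mathrm{U}(1)$ with $\{x\in F:\psi_0|_{x\mathcal{O}}=1\}=\mathcal{O}$, and for $m\in\mathfrak{g}$ let $\psi_m(m')=\psi_0(\mathrm{tr}(mm'))$. For $m=\begin{pmatrix}0&1\\0&0\end{pmatrix}$ the centralizer $Z_G(m)$ is the group $U$ of unipotent upper triangular matrices. $V_{m,1}$ is the space of smooth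 functions $f:G_\epsilon\to\mathbb{C}$ such that $f((1+\epsilon m')g)=\psi_m(m')f(g)$ for $m'\in\mathfrak{g}$, $g\in G$; $f(ug)=f(g)$ for $u\in U$, $g\in G$; and the support of $f|_G$ is compact modulo left translation by $U$. $G_\epsilon$ acts by right translation. It carries a $G_\epsilon$-invariant inner product, unique up to a positive scalar, namely $\langle f,f'\rangle=\int_{U\backslash G}f(g)\overline{f'(g)}\,dg$. *)

(* Defs.v *)
From HB Require Import structures.
From mathcomp Require Import all_boot all_order all_algebra.
From mathcomp Require Import sesquilinear complex finmap.
From mathcomp Require Import all_classical all_reals all_analysis.
From mathcomp Require Import measurable_realfun ring.

Set Implicit Arguments.
Unset Strict Implicit.
Unset Printing Implicit Defensive.

Import Order.TTheory GRing.Theory Num.Theory.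

Local Open Scope classical_set_scope.
Local Open Scope ring_scope.
Local Open Scope complex_scope.

(* No compatibility between the topology and the ring operations is recorded
   here; for the two instances of interest, F and F_epsilon,
   it does hold. *)
#[short(type="topComUnitRingType")]
HB.structure Definition TopComUnitRing := {A of GRing.ComUnitRing A & Topological A}.

(* A field that is complete, with finite residue field, for the topology of a
   normalized discrete valuation [lf_val].  The valuation of 0 should be
   +oo; [lf_val 0] is a junk value that no axiom refers to. *)
HB.mixin Record isNonArchLocalField F of GRing.Field F & Uniform F := {
  lf_val : F -> int;
  lf_valM : forall x y : F, x != 0 -> y != 0 ->
    lf_val (x * y) = lf_val x + lf_val y;
  lf_valD : forall x y : F, x != 0 -> y != 0 -> x + y != 0 ->
    Num.min (lf_val x) (lf_val y) <= lf_val (x + y);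
  lf_val_normalized : exists2 x : F, x != 0 & lf_val x = 1;
  lf_entourageE : (entourage : set_system (F * F)) =
    filter_from [set: int]
      (fun n => [set xy | xy.1 = xy.2 \/ n <= lf_val (xy.1 - xy.2)]);
  lf_complete : forall G : set_system F, ProperFilter G -> cauchy G ->
    exists l : F, G --> l;
  lf_residue_finite : exists s : seq F, forall x : F, x = 0 \/ 0 <= lf_val x ->
    exists2 a, a \in s & x = a \/ 0 < lf_val (x - a)
}.

#[short(type="nonArchLocalFieldType")]
HB.structure Definition NonArchLocalField :=
  {F of GRing.Field F & Uniform F & isNonArchLocalField F}.

Section LocalField.
Variable F : nonArchLocalFieldType.

Definition ring_of_integers : set F := [set x | x = 0 \/ 0 <= lf_val x].

Definition max_ideal : set F := [set x | x = 0 \/ 0 < lf_val x].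

Definition generates_max_ideal (w : F) : Prop :=
  max_ideal = [set w * x | x in ring_of_integers].

Definition residue_field : set (set F) :=
  [set [set y | max_ideal (y - x)] | x in ring_of_integers].

Definition residue_card : nat := #|` fset_set residue_field|.

End LocalField.

(* [(a, b) : dual A] is a + b epsilon in A[epsilon]/(epsilon^2). *)
Definition dual (A : Type) : Type := (A * A)%type.

HB.instance Definition _ (A : zmodType) := GRing.Zmodule.copy (dual A) (A * A)%type.

Section DualRing.
Variable A : comNzRingType.
Implicit Types x y z : dual A.

Definition dual_one : dual A := (1, 0).
Definition dual_mul x y : dual A := (x.1 * y.1, x.1 * y.2 + x.2 * y.1).

Fact dual_mulA : associative dual_mul.
Proof. by case=> a b [c d] [e f]; congr pair => /=; ring. Qed.
Fact dual_mulC : commutative dual_mul.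
Proof. by case=> a b [c d]; congr pair => /=; ring. Qed.
Fact dual_mul1 : left_id dual_one dual_mul.
Proof. by case=> a b; congr pair => /=; ring. Qed.
Fact dual_mulD : left_distributive dual_mul +%R.
Proof. by case=> a b [c d] [e f]; congr pair => /=; ring. Qed.
Fact dual_one_neq0 : dual_one != 0.
Proof. by rewrite xpair_eqE oner_eq0. Qed.

HB.instance Definition _ := GRing.Zmodule_isComNzRing.Build (dual A)
  dual_mulA dual_mulC dual_mul1 dual_mulD dual_one_neq0.

End DualRing.

Section DualUnitRing.
Variable A : comUnitRingType.
Implicit Types x y : dual A.

Definition dual_unit : {pred dual A} := [pred x | x.1 \is a GRing.unit].
Definition dual_inv x : dual A :=
  if x \in dual_unit then (x.1^-1, - (x.2 * x.1^-1 ^+ 2)) else x.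

Fact dual_mulVx : {in dual_unit, left_inverse 1 dual_inv *%R}.
Proof.
move=> [a b] ua; rewrite /dual_inv ua /=; move: ua => /= ua.
congr pair => /=; first by rewrite mulVr.
by rewrite expr2 mulNr mulrA divrK // [b * _]mulrC subrr.
Qed.
Fact dual_unitPl x y : y * x = 1 -> dual_unit x.
Proof.
by move=> [/= yx _]; apply/unitrPr; exists y.1; rewrite mulrC.
Qed.
Fact dual_inv_out : {in [predC dual_unit], dual_inv =1 id}.
Proof. by move=> x; rewrite /dual_inv inE => /negbTE ->. Qed.

HB.instance Definition _ := GRing.ComNzRing_hasMulInverse.Build (dual A)
  dual_mulVx dual_unitPl dual_inv_out.

End DualUnitRing.

Definition mx2 (A : Type) (a b c d : A) : 'M[A]_2 :=
  \matrix_(i, j) if i == 0 then (if j == 0 then a else b)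
                 else (if j == 0 then c else d).

Section GL2.
Variable A : comUnitRingType.

Record GL2 := MkGL2 { GL2_mx :> 'M[A]_2; GL2_unitmx : GL2_mx \in unitmx }.

HB.instance Definition _ := [isSub for GL2_mx].
HB.instance Definition _ := [Choice of GL2 by <:].

Implicit Types g h : GL2.

Definition GL2_one : GL2 := MkGL2 (unitmx1 A 2).
Fact GL2_mul_subproof g h : GL2_mx g *m GL2_mx h \in unitmx.
Proof. by rewrite unitmx_mul !GL2_unitmx. Qed.
Definition GL2_mul g h : GL2 := MkGL2 (GL2_mul_subproof g h).
Fact GL2_inv_subproof g : invmx (GL2_mx g) \in unitmx.
Proof. by rewrite unitmx_inv GL2_unitmx. Qed.
Definition GL2_inv g : GL2 := MkGL2 (GL2_inv_subproof g).

Fact GL2_mulA : associative GL2_mul.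
Proof. by move=> g h k; apply: val_inj; exact: mulmxA. Qed.
Fact GL2_mul1g : left_id GL2_one GL2_mul.
Proof. by move=> g; apply: val_inj; exact: mul1mx. Qed.
Fact GL2_mulg1 : right_id GL2_one GL2_mul.
Proof. by move=> g; apply: val_inj; exact: mulmx1. Qed.
Fact GL2_mulVg : left_inverse GL2_one GL2_inv GL2_mul.
Proof. by move=> g; apply: val_inj; apply: mulVmx; exact: GL2_unitmx. Qed.
Fact GL2_mulgV : right_inverse GL2_one GL2_inv GL2_mul.
Proof. by move=> g; apply: val_inj; apply: mulmxV; exact: GL2_unitmx. Qed.

HB.instance Definition _ := isGroup.Build GL2
  GL2_mulA GL2_mul1g GL2_mulg1 GL2_mulVg GL2_mulgV.

Definition homothetic g h : bool :=
  `[< exists2 z : A, z \is a GRing.unit & GL2_mx g = z *: GL2_mx h >].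

Fact homothetic_refl : reflexive homothetic.
Proof. by move=> g; apply/asboolP; exists 1; rewrite ?unitr1 ?scale1r. Qed.
Fact homothetic_sym : symmetric homothetic.
Proof.
suff H g h : homothetic g h -> homothetic h g by move=> g h; apply/idP/idP; exact: H.
move=> /asboolP[z uz gh]; apply/asboolP; exists z^-1; first by rewrite unitrV.
by rewrite gh scalerA mulVr // scale1r.
Qed.
Fact homothetic_trans : transitive homothetic.
Proof.
move=> h g k /asboolP[z uz gh] /asboolP[y uy hk]; apply/asboolP.
by exists (z * y); rewrite ?unitrM ?uz ?uy // gh hk scalerA.
Qed.

Canonical homothetic_equivRel :=
  EquivRel homothetic homothetic_refl homothetic_sym homothetic_trans.

(* The quotient of GL_2(A) by the unit scalars; this is the group of A-points
   of the group scheme PGL_2 when A is local, as in all the cases used here. *)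
Definition PGL2 := {eq_quot homothetic}%qT.

HB.instance Definition _ := Choice.on PGL2.
HB.instance Definition _ := EqQuotient.on PGL2.

Local Open Scope quotient_scope.

Definition PGL2_one : PGL2 := \pi_PGL2 1%g.
Definition PGL2_mul (x y : PGL2) : PGL2 := \pi_PGL2 (repr x * repr y)%g.
Definition PGL2_inv (x : PGL2) : PGL2 := \pi_PGL2 (repr x)^-1%g.

Fact PGL2_eqP g h : (\pi_PGL2 g = \pi_PGL2 h) <->
  (exists2 z : A, z \is a GRing.unit & GL2_mx g = z *: GL2_mx h).
Proof.
by split=> [/eqquotP/asboolP|gh]; [|apply/eqquotP/asboolP].
Qed.

Fact PGL2_repr g : exists2 z : A, z \is a GRing.unit &
  GL2_mx (repr (\pi_PGL2 g)) = z *: GL2_mx g.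
Proof. by apply/PGL2_eqP; rewrite reprK. Qed.

Lemma PGL2_mulE g h : PGL2_mul (\pi_PGL2 g) (\pi_PGL2 h) = \pi_PGL2 (g * h)%g.
Proof.
apply/PGL2_eqP; have [z uz zg] := PGL2_repr g; have [y uy yh] := PGL2_repr h.
exists (z * y); first by rewrite unitrM uz uy.
by rewrite /= zg yh -scalemxAl -scalemxAr scalerA.
Qed.

Lemma PGL2_invE g : PGL2_inv (\pi_PGL2 g) = \pi_PGL2 g^-1%g.
Proof.
apply/PGL2_eqP; have [z uz zg] := PGL2_repr g.
exists z^-1; rewrite ?unitrV //= zg invmxZ //.
by rewrite -zg GL2_unitmx.
Qed.

Fact PGL2_mulA : associative PGL2_mul.
Proof.
elim/quotW=> g; elim/quotW=> h; elim/quotW=> k.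
by rewrite (PGL2_mulE h k) (PGL2_mulE g h) !(PGL2_mulE _ k) PGL2_mulE mulgA.
Qed.
Fact PGL2_mul1g : left_id PGL2_one PGL2_mul.
Proof. by elim/quotW=> g; rewrite (PGL2_mulE 1%g g) mul1g. Qed.
Fact PGL2_mulg1 : right_id PGL2_one PGL2_mul.
Proof. by elim/quotW=> g; rewrite (PGL2_mulE g 1%g) mulg1. Qed.
Fact PGL2_mulVg : left_inverse PGL2_one PGL2_inv PGL2_mul.
Proof. by elim/quotW=> g; rewrite PGL2_invE (PGL2_mulE _ g) mulVg. Qed.
Fact PGL2_mulgV : right_inverse PGL2_one PGL2_inv PGL2_mul.
Proof. by elim/quotW=> g; rewrite PGL2_invE (PGL2_mulE g) mulgV. Qed.

HB.instance Definition _ := isGroup.Build PGL2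
  PGL2_mulA PGL2_mul1g PGL2_mulg1 PGL2_mulVg PGL2_mulgV.

(* The class of an invertible matrix; junk value 1 on singular matrices. *)
Definition pgl (M : 'M[A]_2) : PGL2 := \pi_PGL2 (insubd (1%g : GL2) M).

(* The image in PGL_2(A) of GL_2(S), for a subring S of A. *)
Definition PGL2_over (S : set A) : set PGL2 :=
  [set \pi_PGL2 g | g in
    [set g : GL2 | forall i j, S (GL2_mx g i j) /\ S (GL2_mx g^-1%g i j)]].

End GL2.

HB.instance Definition _ (T : topologicalType) := Topological.copy (dual T) (T * T)%type.
HB.instance Definition _ (A : topComUnitRingType) := Topological.on (dual A).

(* GL_2(A) carries the topology induced from the matrices, and PGL_2(A) the
   quotient topology. *)
HB.instance Definition _ (A : topComUnitRingType) :=
  Topological.copy (GL2 A) (initial_topology (@GL2_mx A)).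

Section PGL2Topology.
Variable A : topComUnitRingType.
Local Open Scope quotient_scope.

Definition PGL2_open (U : set (PGL2 A)) : Prop := open (\pi_(PGL2 A) @^-1` U).

Fact PGL2_openT : PGL2_open setT.
Proof. by rewrite /PGL2_open preimage_setT; exact: openT. Qed.
Fact PGL2_openI : setI_closed PGL2_open.
Proof. by move=> U V oU oV; exact: openI. Qed.
Fact PGL2_open_bigU (I : Type) (f : I -> set (PGL2 A)) :
  (forall i, PGL2_open (f i)) -> PGL2_open (\bigcup_i f i).
Proof. by move=> of_; apply: bigcup_open => i _; exact: of_. Qed.

HB.instance Definition _ := isOpenTopological.Build (PGL2 A)
  PGL2_openT PGL2_openI PGL2_open_bigU.

End PGL2Topology.

Section Groups.
Variable F : nonArchLocalFieldType.
Local Notation G := (PGL2 F).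
Local Notation Geps := (PGL2 (dual F)).

Definition inG (g : G) : Geps := pgl (map_mx (fun a : F => (a, 0) : dual F) (repr g)).

Definition one_eps (m : 'M[F]_2) : Geps :=
  pgl (\matrix_(i, j) (((1%:M : 'M[F]_2) i j, m i j) : dual F)).

Definition tmx (x : F) : G := pgl (mx2 x 0 0 1).

Definition unip : set G := [set pgl (mx2 1 x 0 1) | x in [set: F]].

Definition dual_integers : set (dual F) :=
  [set x | ring_of_integers x.1 /\ ring_of_integers x.2].

Definition Keps : set Geps := PGL2_over dual_integers.

End Groups.

Section Representation.
Variables (R : realType) (F : nonArchLocalFieldType).
Local Notation C := R[i].
Local Notation G := (PGL2 F).
Local Notation Geps := (PGL2 (dual F)).
Implicit Types (f : Geps -> C) (g : Geps).

Record additive_character (psi : F -> C) : Prop := {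
  additive_characterD : forall x y, psi (x + y) = psi x * psi y;
  additive_character_norm : forall x, `|psi x| = 1;
  additive_character_continuous :
    forall x, forall e : R, 0 < e -> \forall y \near x, `|psi y - psi x| < e%:C }.

Definition conductor_integers (psi : F -> C) : Prop :=
  [set x | forall y, ring_of_integers y -> psi (x * y) = 1] =
  ring_of_integers (F := F).

Definition psi_m (psi0 : F -> C) (m m' : 'M[F]_2) : C := psi0 (\tr (m *m m')).

Definition m0 : 'M[F]_2 := mx2 0 1 0 0.

(* The centralizer of [m0] in G is [unip].  A set that is closed and invariant
   under left translation by U, such as the support of f on G, is compact
   modulo U iff it lies in U D for some compact D. *)
Record V_m1 (psi0 : F -> C) f : Prop := {
  V_smooth : forall g, \forall h \near g, f h = f g;
  V_eps : forall (m' : 'M[F]_2) (g : G), \tr m' = 0 ->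
    f (one_eps m' * inG g)%g = psi_m psi0 m0 m' * f (inG g);
  V_unip : forall u g : G, unip u -> f (inG (u * g)%g) = f (inG g);
  V_compact_support : exists2 D : set G, compact D &
    [set g : G | f (inG g) != 0] `<=` [set (u * d)%g | u in @unip F & d in D] }.

Definition act g f : Geps -> C := fun x => f (x * g)%g.

Definition V_m1_Keps (psi0 : F -> C) : set (Geps -> C) :=
  [set f | V_m1 psi0 f /\ forall k, Keps k -> act k f = f].

Definition lcoset_set (K : set Geps) g : set Geps := [set (g * k)%g | k in K].

(* The left K_epsilon-cosets contained in the double coset K_epsilon t_w K_epsilon;
   there are finitely many of them, so that the finitely supported sum below
   is the ordinary one. *)
Definition hecke_cosets (w : F) : set (set Geps) :=
  [set lcoset_set (@Keps F) g |
     g in [set (k * inG (tmx w) * k')%g | k in @Keps F & k' in @Keps F]].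

Definition T0 (w : F) f : Geps -> C := fun x =>
  (residue_card F)%:R^-1 * \sum_(X \in hecke_cosets w) act (xget 1%g X) f x.

(* On V_{m,1} such inner products form a single ray, spanned by the integral of
   f1 * conj f2 over U \ G against the invariant measure. *)
Record unitary_structure (V : set (Geps -> C))
    (ip : (Geps -> C) -> (Geps -> C) -> C) : Prop := {
  ip_linear : forall (a : C) f1 f2 f, V f1 -> V f2 -> V f ->
    ip (fun x => a * f1 x + f2 x) f = a * ip f1 f + ip f2 f;
  ip_hermitian : forall f1 f2, V f1 -> V f2 -> ip f2 f1 = (ip f1 f2)^*;
  ip_pos : forall f, V f -> f <> (fun=> 0) -> 0 < ip f f;
  ip_invariant : forall g f1 f2, V f1 -> V f2 ->
    ip (act g f1) (act g f2) = ip f1 f2 }.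

Record spherical_f0 (psi0 : F -> C) (w : F) f : Prop := {
  f0_inv : V_m1_Keps psi0 f;
  f0_one : f 1%g = 1;
  f0_tmx : forall r : int, r != 0 -> f (inG (tmx (w ^ r))) = 0 }.

End Representation.

Section Hilbert.
Variable R : realType.
Local Notation C := R[i].

Definition complete_dot (H : lmodType C) (dot : {dot H for @conjc R}) : Prop :=
  forall u : nat -> H,
    (forall e : R, 0 < e -> exists N, forall m n, (N <= m)%N -> (N <= n)%N ->
       dot (u m - u n) (u m - u n) < e%:C) ->
    exists l : H, forall e : R, 0 < e -> exists N, forall n, (N <= n)%N ->
       dot (u n - l) (u n - l) < e%:C.

(* [H], with [iota], is a Hilbert space completion of the space [W] of
   functions endowed with the inner product [ip]; [iota] is only relevant on
   [W]. *)
Record hilbert_completion (X : Type) (W : set (X -> C))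
    (ip : (X -> C) -> (X -> C) -> C) (H : lmodType C)
    (dot : {dot H for @conjc R}) (iota : (X -> C) -> H) : Prop := {
  completion_complete : complete_dot dot;
  completion_linear : forall (a : C) f1 f2, W f1 -> W f2 ->
    iota (fun x => a * f1 x + f2 x) = a *: iota f1 + iota f2;
  completion_isometry : forall f1 f2, W f1 -> W f2 ->
    dot (iota f1) (iota f2) = ip f1 f2;
  completion_dense : forall (h : H) (e : R), 0 < e ->
    exists2 f, W f & dot (h - iota f) (h - iota f) < e%:C }.

(* The complex Hilbert space L^2(D, mu) is handled through square-integrable
   functions, with equality replaced by equality mu-almost everywhere on D. *)
Section L2.
Context d (T : measurableType d) (mu : {measure set T -> \bar R}) (D : set T).
Implicit Types f g : T -> C.

Record L2 f : Prop := {
  L2_measurable_Re : measurable_fun D (fun x => complex.Re (f x));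
  L2_measurable_Im : measurable_fun D (fun x => complex.Im (f x));
  L2_integrable : (\int[mu]_(x in D) ((complex.Re `|f x|) ^+ 2)%:E < +oo)%E }.

Definition L2_dot f g : C :=
  (\int[mu]_(x in D) complex.Re (f x * (g x)^*)) +i*
  (\int[mu]_(x in D) complex.Im (f x * (g x)^*)).

Record hilbert_iso_L2 (H : lmodType C) (dot : {dot H for @conjc R})
    (Phi : H -> T -> C) : Prop := {
  iso_L2 : forall h, L2 (Phi h);
  iso_linear : forall (a : C) h1 h2,
    ae_eq mu D (Phi (a *: h1 + h2)) (fun x => a * Phi h1 x + Phi h2 x);
  iso_isometry : forall h1 h2, L2_dot (Phi h1) (Phi h2) = dot h1 h2;
  iso_surjective : forall f, L2 f -> exists h, ae_eq mu D (Phi h) f }.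

End L2.

End Hilbert.

Section Semicircle.
Variables (R : realType) (q : nat).

(* [Num.sqrt] vanishes on negative numbers, hence the density vanishes outside
   [semicircle_itv]. *)
Definition semicircle_density (x : R) : R :=
  (2 * pi * q%:R)^-1 * Num.sqrt (4 * q%:R - x ^+ 2).

Definition semicircle_itv : set R :=
  `[- (2 * Num.sqrt q%:R), 2 * Num.sqrt q%:R]%classic.

Definition semicircle_measure : set (measurableTypeR R) -> \bar R :=
  fun A => (\int[lebesgue_measure]_(x in A) (semicircle_density x)%:E)%E.

Fact semicircle_density_ge0 x : 0 <= semicircle_density x.
Proof. by rewrite mulr_ge0 ?sqrtr_ge0 // invr_ge0 !mulr_ge0 ?pi_ge0. Qed.

Fact semicircle_density_measurable : measurable_fun setT semicircle_density.
Proof.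
apply: measurable_funM => //.
apply: (measurableT_comp (continuous_measurable_fun (@sqrt_continuous R))).
by apply: measurable_funB => //; exact: measurable_funX.
Qed.

Let semicircle0 : semicircle_measure set0 = 0%E.
Proof. by rewrite /semicircle_measure integral_set0. Qed.

Let semicircle_ge0 A : (0 <= semicircle_measure A)%E.
Proof. by apply: integral_ge0 => x _; rewrite lee_fin semicircle_density_ge0. Qed.

Let semicircle_sigma_additive : semi_sigma_additive semicircle_measure.
Proof.
move=> /= A mA tA mUA; rewrite /semicircle_measure ge0_integral_bigcup //=.
- apply: is_cvg_ereal_nneg_natsum_cond => n _ _.
  by apply: integral_ge0 => /= x _; rewrite lee_fin semicircle_density_ge0.
- apply/measurable_EFinP; apply: measurable_funTS.
  exact: semicircle_density_measurable.
- by move=> x _; rewrite lee_fin semicircle_density_ge0.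
Qed.

HB.instance Definition _ := isMeasure.Build _ _ _
  semicircle_measure semicircle0 semicircle_ge0 semicircle_sigma_additive.

End Semicircle.

(* Main.v *)
(* An element f of V_{m,1}^{K_epsilon} is determined by the finitely supported
   sequence a_n = f(t_{w^-n}), n >= 0: if g = A + epsilon B has bottom row of A
   (c, d), then f(g) = psi0((B A^-1)_{1,0}) a_N with N = 2 min(v(c), v(d)) - v(det A).
   Let e_n be the element with a_m = delta_{nm}, so that f0 = e_0.  Summing over
   explicit coset representatives of K_epsilon t_w K_epsilon gives
   T0 e_n = q e_(n+1) + e_(n-1).  Translating by suitable 1 + epsilon m' multiplies
   the e_n by different characters, hence they are orthogonal; since T0 is
   self-adjoint, <e_n, e_n> = q^-n.  The polynomials Q_n with
   x Q_n = q Q_(n+1) + Q_(n-1) and Q_0 = 1 are rescaled Chebyshev polynomials of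
   the second kind, orthogonal for the semicircle measure with the same norms.
   They are total in L^2, because polynomials approximate indicator functions of
   half-lines, so that e_n |-> Q_n extends to the isomorphism Phi.  It is the
   only one, as (1) and (2) force Phi(e_n) = Q_n by induction on n. *)

Require Import Defs.
From HB Require Import structures.
From mathcomp Require Import all_boot all_order all_algebra.
From mathcomp Require Import sesquilinear complex finmap.
From mathcomp Require Import all_classical all_reals all_analysis.
From mathcomp Require Import measurable_realfun ring lra zify.

Set Implicit Arguments.
Unset Strict Implicit.
Unset Printing Implicit Defensive.

Import Order.TTheory GRing.Theory Num.Theory.
Import numFieldNormedType.Exports.

Local Open Scope classical_set_scope.
Local Open Scope ring_scope.
Local Open Scope complex_scope.
Local Open Scope quotient_scope.

(** * Valuations and residue representatives *)

(** The inner product on [V_m1] is known only through its axioms, so the norms of the e_n have to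
    come from invariance alone. Translates of a spherical vector leave V^K, hence membership in
    [V_m1] is proved for all translates. For j < n, the elements 1 + epsilon m' with off-diagonal
    entries in w^-(j+1) O fix e_n, while the translates of e_j by representatives of them add up to
    0, being sums of a nontrivial character. T0 is self-adjoint because all cosets contribute
    equally to <T0 f1, f2> and t_w^-1 lies in K t_w K. On the analytic side, H is an abstract
    completion and elements of L^2 are functions up to null sets; both are treated as complete
    semidefinite spaces with total orthogonal systems of the same norms q^-n, and Riesz-Fischer and
    Parseval then give the isomorphism. A function orthogonal to all Q_n has, after multiplication
    by the density, vanishing moments; its primitive therefore vanishes, and Lebesgue
    differentiation shows that it is zero almost everywhere. *)

Section Valuation.
Variable F : nonArchLocalFieldType.
Implicit Types (x y : F) (n m : int).

(** Gives 0 the valuation +infinity, since [lf_val 0] is arbitrary. *)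
Definition vge n x := (x == 0) || (n <= lf_val x).

Lemma lf_val1 : lf_val (1 : F) = 0.
Proof. by have := lf_valM 1 1 (oner_neq0 F) (oner_neq0 F); rewrite mulr1; lia. Qed.

Lemma lf_valN x : lf_val (- x) = lf_val x.
Proof.
have [->|x0] := eqVneq x 0; first by rewrite oppr0.
have m1 : (-1 : F) != 0 by rewrite oppr_eq0 oner_neq0.
have vm1 : lf_val (-1 : F) = 0.
  by have := lf_valM _ _ m1 m1; rewrite mulrNN mulr1 lf_val1; lia.
by rewrite -mulN1r lf_valM // vm1 add0r.
Qed.

Lemma lf_valV x : x != 0 -> lf_val (x^-1) = - lf_val x.
Proof.
move=> x0; have := lf_valM _ _ x0 (invr_neq0 x0).
by rewrite divff // lf_val1; lia.
Qed.

Lemma lf_val_div x y : x != 0 -> y != 0 -> lf_val (x / y) = lf_val x - lf_val y.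
Proof. by move=> x0 y0; rewrite lf_valM ?invr_neq0 // lf_valV. Qed.

Lemma vge0 n : vge n 0. Proof. by rewrite /vge eqxx. Qed.

Lemma vgeE n x : x != 0 -> vge n x = (n <= lf_val x).
Proof. by rewrite /vge => /negbTE ->. Qed.

Lemma vgeN n x : vge n (- x) = vge n x.
Proof. by rewrite /vge oppr_eq0 lf_valN. Qed.

Lemma vgeD n x y : vge n x -> vge n y -> vge n (x + y).
Proof.
have [->|x0] := eqVneq x 0; first by rewrite add0r.
have [->|y0] := eqVneq y 0; first by rewrite addr0.
rewrite (vgeE n x0) (vgeE n y0) /vge; have [//|xy0] := eqVneq (x + y) 0.
move=> nx ny; apply: le_trans (lf_valD _ _ x0 y0 xy0).
by rewrite le_min nx.
Qed.

Lemma vgeB n x y : vge n x -> vge n y -> vge n (x - y).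
Proof. by move=> nx ny; apply: vgeD; rewrite ?vgeN. Qed.

Lemma vgeM n m x y : vge n x -> vge m y -> vge (n + m) (x * y).
Proof.
have [->|x0] := eqVneq x 0; first by rewrite mul0r !vge0.
have [->|y0] := eqVneq y 0; first by rewrite mulr0 !vge0.
rewrite (vgeE _ x0) (vgeE _ y0) vgeE ?mulf_neq0 // lf_valM // => h1 h2.
exact: lerD.
Qed.

Lemma vgeW n m x : (n <= m)%R -> vge m x -> vge n x.
Proof.
move=> nm; rewrite /vge; case: eqP => //= _; exact: (le_trans nm).
Qed.

Lemma vge0M x y : vge 0 x -> vge 0 y -> vge 0 (x * y).
Proof. by move=> h1 h2; have := vgeM h1 h2; rewrite addr0. Qed.

Lemma vge0M_l n x y : vge 0 x -> vge n y -> vge n (x * y).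
Proof. by move=> x0 ny; have := vgeM x0 ny; rewrite add0r. Qed.

Lemma vge0M_r n x y : vge n x -> vge 0 y -> vge n (x * y).
Proof. by move=> nx y0; have := vgeM nx y0; rewrite addr0. Qed.

Lemma vge1 : vge 0 1. Proof. by rewrite vgeE ?oner_neq0 // lf_val1. Qed.

Lemma ring_of_integersE x : ring_of_integers x <-> vge 0 x.
Proof.
rewrite /ring_of_integers /vge /=; split.
  by case=> [->|->]; rewrite ?eqxx ?orbT.
by case/orP => [/eqP ->|]; [left|right].
Qed.

Lemma max_idealE x : max_ideal x <-> vge 1 x.
Proof.
rewrite /max_ideal /vge /=; split.
  by case=> [->|h]; rewrite ?eqxx // orbC; have -> : 1 <= lf_val x by lia.
by case/orP => [/eqP ->|h]; [left|right; lia].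
Qed.

Lemma vge_unit x : vge 0 x -> vge 0 (x^-1) -> x != 0 -> lf_val x = 0.
Proof. by move=> + + x0; rewrite !vgeE ?invr_neq0 // lf_valV //; lia. Qed.

(** A perturbation of strictly larger valuation cannot change the valuation. This makes units and
    determinants of fixed valuation stable under small changes. *)
Lemma lf_val_near x y n : x != 0 -> lf_val x < n -> vge n (y - x) ->
  y != 0 /\ lf_val y = lf_val x.
Proof.
move=> x0 xn nyx.
have y0 : y != 0.
  apply/eqP => y0; move: nyx; rewrite y0 sub0r vgeN vgeE //; lia.
split => //.
have h1 : vge (lf_val x) y.
  rewrite -(subrK x y) addrC; apply: vgeD; first by rewrite vgeE.
  by apply: vgeW nyx; lia.
apply/eqP; rewrite eq_le -(vgeE _ y0) h1 andbT leNgt; apply/negP => h.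
have : vge (lf_val x + 1) x.
  rewrite -[in X in vge _ X](subKr y x); apply: vgeB; first by rewrite vgeE //; lia.
  by apply: vgeW nyx; lia.
by rewrite vgeE //; lia.
Qed.

Variable w : F.
Hypothesis w_gen : generates_max_ideal w.

(** Membership of w in the maximal ideal gives v(w) >= 1; some element of valuation 1 is an integral
    multiple of w, which gives v(w) <= 1. *)
Lemma uniformizer : w != 0 /\ lf_val w = 1.
Proof.
have mw : vge 1 w.
  apply/max_idealE; rewrite w_gen; exists 1; last by rewrite mulr1.
  by apply/ring_of_integersE; exact: vge1.
have [x x0 vx] := @lf_val_normalized F.
have : max_ideal x by right; rewrite vx.
rewrite w_gen => -[y /ring_of_integersE vy xE].
have w0 : w != 0 by apply: contra_neq x0 => w0; rewrite -xE w0 mul0r.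
have y0 : y != 0 by apply: contra_neq x0 => y0; rewrite -xE y0 mulr0.
split => //; move: mw vy; rewrite !vgeE // => mw vy.
by move: vx; rewrite -xE lf_valM //; lia.
Qed.

Lemma uniformizer_neq0 : w != 0. Proof. by case: uniformizer. Qed.
Lemma lf_val_uniformizer : lf_val w = 1. Proof. by case: uniformizer. Qed.
Lemma uniformizer_exp_neq0 n : w ^ n != 0.
Proof. by rewrite expfz_neq0 // uniformizer_neq0. Qed.

Lemma lf_val_exp n : lf_val (w ^ n) = n.
Proof.
have h (k : nat) : lf_val (w ^+ k) = k%:Z.
  elim: k => [|k ih]; first by rewrite expr0 lf_val1.
  rewrite exprS lf_valM ?expf_neq0 ?uniformizer_neq0 // ih lf_val_uniformizer; lia.
case: n => k; first exact: h.
by rewrite NegzE -exprnN lf_valV ?expf_neq0 ?uniformizer_neq0 // h.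
Qed.

Lemma vge_exp n m : vge n (w ^ m) = (n <= m).
Proof. by rewrite vgeE ?uniformizer_exp_neq0 // lf_val_exp. Qed.

Lemma vge_shift n m x : vge n (w ^ m * x) = vge (n - m) x.
Proof.
have [->|x0] := eqVneq x 0; first by rewrite mulr0 !vge0.
rewrite !vgeE ?mulf_neq0 ?uniformizer_exp_neq0 //.
by rewrite lf_valM ?uniformizer_exp_neq0 // lf_val_exp; lia.
Qed.

End Valuation.

Section Residue.
Variable F : nonArchLocalFieldType.
Implicit Types x y : F.

Lemma residue_class_eq x y : vge 1 (y - x) ->
  [set z : F | max_ideal (z - x)] = [set z | max_ideal (z - y)].
Proof.
move=> h; apply/seteqP; split=> z /= /max_idealE hz; apply/max_idealE.
  by rewrite (_ : z - y = (z - x) - (y - x)); [exact: vgeB|ring].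
by rewrite (_ : z - x = (z - y) + (y - x)); [exact: vgeD|ring].
Qed.

Lemma residue_field_finite : finite_set (@residue_field F).
Proof.
have [s sP] := @lf_residue_finite F.
apply: (sub_finite_set _ (finite_seq [seq [set y | max_ideal (y - a)] | a <- s])).
move=> _ [x /sP [a as_ xa] <-] /=; apply/mapP; exists a => //.
by apply/esym/residue_class_eq; apply/max_idealE; case: xa => [->|]; [rewrite subrr; left|right].
Qed.

(** One point is chosen in each residue class, which turns sums over O/wO into sums over a list. *)
Definition residue_reps : seq F :=
  [seq xget 0 X | X <- fset_set (@residue_field F)].

Lemma size_residue_reps : size residue_reps = residue_card F.
Proof. by rewrite size_map. Qed.

Lemma residue_field_xget X : @residue_field F X ->
  vge 0 (xget 0 X) /\ X = [set y | max_ideal (y - xget 0 X)].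
Proof.
move=> [x /ring_of_integersE vx <-].
have : [set y | max_ideal (y - x)] (xget 0 [set y | max_ideal (y - x)]).
  by apply: (@xgetPex _ 0); exists x; rewrite /= subrr; left.
move=> /= /max_idealE; set z := xget _ _ => vz; split; last exact: residue_class_eq.
by rewrite -(subrK x z); apply: vgeD => //; exact: vgeW vz.
Qed.

Lemma residue_reps_int x : x \in residue_reps -> vge 0 x.
Proof.
move=> /mapP[X]; rewrite in_fset_set ?inE; last exact: residue_field_finite.
by move=> /residue_field_xget[+ _] => + ->.
Qed.

Lemma residue_reps_surj x : vge 0 x -> exists2 a, a \in residue_reps & vge 1 (x - a).
Proof.
move=> vx; have XP : @residue_field F [set y | max_ideal (y - x)].
  by exists x => //; exact/ring_of_integersE.
have [_ XE] := residue_field_xget XP.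
exists (xget 0 [set y | max_ideal (y - x)]).
  apply/mapP; exists [set y | max_ideal (y - x)] => //.
  by rewrite in_fset_set ?inE //; exact: residue_field_finite.
apply/max_idealE; have : [set y | max_ideal (y - x)] x by rewrite /= subrr; left.
by rewrite [X in X x]XE.
Qed.

Lemma residue_reps_inj x y : x \in residue_reps -> y \in residue_reps ->
  vge 1 (x - y) -> x = y.
Proof.
move=> /mapP[X]; rewrite in_fset_set ?inE; last exact: residue_field_finite.
move=> /residue_field_xget[_ XE] xE /mapP[Y].
rewrite in_fset_set ?inE; last exact: residue_field_finite.
move=> /residue_field_xget[_ YE] yE h; rewrite xE yE; congr xget.
by rewrite XE YE -xE -yE; apply/esym/residue_class_eq.
Qed.

Lemma uniq_residue_reps : uniq residue_reps.
Proof.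
rewrite map_inj_in_uniq ?fset_uniq // => X Y.
rewrite !in_fset_set ?inE; [|exact: residue_field_finite..].
move=> /residue_field_xget[_ XE] /residue_field_xget[_ YE] h.
by rewrite XE YE h.
Qed.

Lemma residue_card_gt0 : (0 < residue_card F)%N.
Proof.
rewrite -size_residue_reps.
by have [a] := residue_reps_surj (vge0 F 0); case: residue_reps.
Qed.

End Residue.

(** * Matrices over F and over the dual numbers *)

Section Matrix2.
Variable A : comUnitRingType.
Implicit Types (M N : 'M[A]_2) (g h : GL2 A).

Lemma ord2_ind (P : 'I_2 -> Prop) : P 0 -> P 1 -> forall i, P i.
Proof.
move=> P0 P1 [[|[|//]] hi]; first by rewrite (_ : Ordinal hi = 0) //; exact: val_inj.
by rewrite (_ : Ordinal hi = 1) //; exact: val_inj.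
Qed.

Lemma matrix2P M N : M 0 0 = N 0 0 -> M 0 1 = N 0 1 -> M 1 0 = N 1 0 ->
  M 1 1 = N 1 1 -> M = N.
Proof.
by move=> h1 h2 h3 h4; apply/matrixP; elim/ord2_ind; elim/ord2_ind.
Qed.

Lemma mulmx2E M N i j : (M *m N) i j = M i 0 * N 0 j + M i 1 * N 1 j.
Proof.
rewrite mxE big_ord_recl big_ord1; congr (_ + M i _ * N _ j); exact: val_inj.
Qed.

Lemma mx2_00 (a b c d : A) : mx2 a b c d 0 0 = a. Proof. by rewrite mxE. Qed.
Lemma mx2_01 (a b c d : A) : mx2 a b c d 0 1 = b. Proof. by rewrite mxE. Qed.
Lemma mx2_10 (a b c d : A) : mx2 a b c d 1 0 = c. Proof. by rewrite mxE. Qed.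
Lemma mx2_11 (a b c d : A) : mx2 a b c d 1 1 = d. Proof. by rewrite mxE. Qed.
Definition mx2E := (mx2_00, mx2_01, mx2_10, mx2_11).

Lemma det2 M : \det M = M 0 0 * M 1 1 - M 0 1 * M 1 0.
Proof.
rewrite (expand_det_row M 0) big_ord_recl big_ord1 /cofactor !det_mx11 !mxE /=.
rewrite expr0 mul1r expr1 mulN1r mulrN.
by congr (M _ _ * M _ _ - M _ _ * M _ _); apply: val_inj.
Qed.

Definition det2E := (det2, mx2E).

Definition GL2_of M (u : \det M \is a GRing.unit) : GL2 A := @MkGL2 A M u.

Lemma GL2_mulE g h : GL2_mx (g * h)%g = GL2_mx g *m GL2_mx h. Proof. by []. Qed.

Lemma GL2_det_unit g : \det (GL2_mx g) \is a GRing.unit.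
Proof. exact: (GL2_unitmx g). Qed.

Lemma GL2_invE g : GL2_mx g^-1%g =
  (\det (GL2_mx g))^-1 *: mx2 (GL2_mx g 1 1) (- GL2_mx g 0 1)
                              (- GL2_mx g 1 0) (GL2_mx g 0 0).
Proof.
have u := GL2_det_unit g.
have gu : GL2_mx g \in unitmx by exact: u.
set N := _ *: _.
have h : GL2_mx g *m N = 1%:M.
  have e : GL2_mx g *m mx2 (GL2_mx g 1 1) (- GL2_mx g 0 1)
      (- GL2_mx g 1 0) (GL2_mx g 0 0) = (\det (GL2_mx g))%:M.
    rewrite det2; apply: matrix2P; rewrite mulmx2E !mx2E !mxE /= ?mulr1n ?mulr0n; ring.
  by rewrite /N -scalemxAr e scale_scalar_mx mulVr.
by rewrite -[RHS](mulKmx gu) h mulmx1.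
Qed.

Local Open Scope quotient_scope.

Lemma pglE M (u : \det M \is a GRing.unit) : pgl M = \pi_(PGL2 A) (GL2_of u).
Proof.
rewrite /pgl; congr (\pi_(PGL2 A) _); apply: val_inj.
by rewrite val_insubd; case: ifP => // /negP [].
Qed.

Lemma PGL2_mul_pi g h :
  (\pi_(PGL2 A) g * \pi_(PGL2 A) h)%g = \pi_(PGL2 A) (g * h)%g.
Proof. exact: PGL2_mulE. Qed.

Lemma PGL2_inv_pi g : (\pi_(PGL2 A) g)^-1%g = \pi_(PGL2 A) g^-1%g.
Proof. exact: PGL2_invE. Qed.

Lemma PGL2_one_pi : 1%g = \pi_(PGL2 A) 1%g.
Proof. by []. Qed.

Lemma eq_PGL2 g h : GL2_mx g = GL2_mx h -> \pi_(PGL2 A) g = \pi_(PGL2 A) h.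
Proof. by move=> gh; congr (\pi_(PGL2 A) _); exact: val_inj. Qed.

(* Stated on products, so that no attempt is made to compare them by unfolding. *)
Lemma eq_mulmx2 M1 M2 N1 N2 :
  (forall i j, M1 i 0 * M2 0 j + M1 i 1 * M2 1 j = N1 i 0 * N2 0 j + N1 i 1 * N2 1 j) ->
  M1 *m M2 = N1 *m N2.
Proof. by move=> h; apply/matrixP => i j; rewrite !mulmx2E. Qed.

Lemma eq_PGL2_mul (a b c d : GL2 A) :
  (forall i j, GL2_mx a i 0 * GL2_mx b 0 j + GL2_mx a i 1 * GL2_mx b 1 j =
     GL2_mx c i 0 * GL2_mx d 0 j + GL2_mx c i 1 * GL2_mx d 1 j) ->
  \pi_(PGL2 A) (a * b)%g = \pi_(PGL2 A) (c * d)%g.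
Proof.
by move=> h; apply: eq_PGL2; apply/matrixP => i j; rewrite !GL2_mulE !mulmx2E.
Qed.

Lemma PGL2_ind (P : PGL2 A -> Prop) : (forall g, P (\pi_(PGL2 A) g)) -> forall x, P x.
Proof. by move=> h; elim/quotW. Qed.

Lemma PGL2_scaleP g h z : z \is a GRing.unit -> GL2_mx g = z *: GL2_mx h ->
  \pi_(PGL2 A) g = \pi_(PGL2 A) h.
Proof. by move=> uz gh; apply/PGL2_eqP; exists z. Qed.

End Matrix2.

Section DualMatrix.
Variable F : nonArchLocalFieldType.
Local Notation dF := (dual F).
Implicit Types (M : 'M[dF]_2) (x y : dF).

Lemma dual_eqP x y : x.1 = y.1 -> x.2 = y.2 -> x = y.
Proof. by case: x y => [a b] [c d] /= -> ->. Qed.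
Lemma dual_addE x y : x + y = (x.1 + y.1, x.2 + y.2). Proof. by []. Qed.
Lemma dual_oppE x : - x = (- x.1, - x.2). Proof. by []. Qed.
Lemma dual_mulE x y : x * y = (x.1 * y.1, x.1 * y.2 + x.2 * y.1). Proof. by []. Qed.
Lemma dual_oneE : 1 = (1, 0) :> dF. Proof. by []. Qed.
Lemma dual_zeroE : 0 = (0, 0) :> dF. Proof. by []. Qed.
Lemma dual_unitE x : (x \is a GRing.unit) = (x.1 != 0).
Proof. by rewrite -unitfE. Qed.
Lemma dual_invE x : x.1 != 0 -> x^-1 = (x.1^-1, - (x.2 * x.1^-1 ^+ 2)).
Proof.
by rewrite -dual_unitE => ux; rewrite {1}/GRing.inv /= /dual_inv [_ \in _]ux.
Qed.
Definition dualE := (dual_addE, dual_oppE, dual_mulE, dual_oneE, dual_zeroE).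

Lemma dual_det1 M :
  (\det M).1 = (M 0 0).1 * (M 1 1).1 - (M 0 1).1 * (M 1 0).1.
Proof. by rewrite det2 !dualE. Qed.

Lemma GL2_dual_det_neq0 (g : GL2 dF) : (\det (GL2_mx g)).1 != 0.
Proof. by rewrite -dual_unitE GL2_det_unit. Qed.

Lemma GL2_det_neq0 (g : GL2 F) : \det (GL2_mx g) != 0.
Proof. by rewrite -unitfE GL2_det_unit. Qed.

Definition dge n x := vge n x.1 && vge n x.2.

Lemma dual_integersE x : dual_integers x <-> dge 0 x.
Proof.
rewrite /dual_integers /dge /=; split; first by case=> /ring_of_integersE -> /ring_of_integersE ->.
by case/andP => *; split; apply/ring_of_integersE.
Qed.

Lemma dgeM n m x y : dge n x -> dge m y -> dge (n + m) (x * y).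
Proof.
move=> /andP[x1 x2] /andP[y1 y2]; rewrite /dge dual_mulE /= vgeM //=.
by apply: vgeD; exact: vgeM.
Qed.

Lemma dgeD n x y : dge n x -> dge n y -> dge n (x + y).
Proof. by move=> /andP[x1 x2] /andP[y1 y2]; rewrite /dge dual_addE /= !vgeD. Qed.

Lemma dgeN n x : dge n (- x) = dge n x.
Proof. by rewrite /dge dual_oppE /= !vgeN. Qed.

Lemma dgeW n m x : n <= m -> dge m x -> dge n x.
Proof. by move=> nm /andP[h1 h2]; rewrite /dge !(vgeW nm). Qed.

Lemma dge00 n : dge n 0. Proof. by rewrite /dge dual_zeroE /= !vge0. Qed.
Lemma dge1 : dge 0 1. Proof. by rewrite /dge dual_oneE /= vge1 vge0. Qed.
Lemma dge_pair n a b : dge n (a, b) = vge n a && vge n b. Proof. by []. Qed.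

Lemma dge_inv x : dge 0 x -> x.1 != 0 -> lf_val x.1 = 0 -> dge 0 x^-1.
Proof.
move=> /andP[x1 x2] x0 vx; have h : vge 0 x.1^-1.
  by rewrite vgeE ?invr_neq0 // lf_valV // vx.
by rewrite dual_invE // dge_pair h vgeN expr2 !vge0M.
Qed.

(** A condition on g alone that replaces the two-sided one of [PGL2_over]: an integral dual number
    is invertible among integral ones as soon as its first component is a unit of O. *)
Definition GL2_int (g : GL2 dF) := [/\ (forall i j, dge 0 (GL2_mx g i j)) &
  lf_val (\det (GL2_mx g)).1 = 0].

Lemma GL2_intP (g : GL2 dF) : GL2_int g <->
  forall i j, dual_integers (GL2_mx g i j) /\ dual_integers (GL2_mx g^-1%g i j).
Proof.
have d0 := GL2_dual_det_neq0 g.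
have dI (M : 'M[dF]_2) : (forall i j, dge 0 (M i j)) -> dge 0 (\det M).
  move=> h; rewrite det2; apply: dgeD; rewrite ?dgeN -[0%R]addr0; exact: dgeM.
split=> [[gI vg] i j|h].
  split; first by apply/dual_integersE.
  apply/dual_integersE; rewrite GL2_invE mxE -[0%R]addr0; apply: dgeM.
    by apply: dge_inv => //; exact: dI.
  by move: i j; elim/ord2_ind; elim/ord2_ind; rewrite mx2E ?dgeN.
have gI i j : dge 0 (GL2_mx g i j) by apply/dual_integersE; case: (h i j).
have gVI i j : dge 0 (GL2_mx g^-1%g i j) by apply/dual_integersE; case: (h i j).
split => //.
have := dI _ gI; have := dI _ gVI => /andP[+ _] /andP[+ _].
have e : (\det (GL2_mx g^-1%g)).1 = (\det (GL2_mx g)).1^-1.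
  by rewrite /= det_inv dual_invE.
by rewrite e => h1 h2; apply: vge_unit.
Qed.

Local Open Scope quotient_scope.

Lemma KepsP (x : PGL2 dF) : Keps x <-> exists2 g, GL2_int g & x = \pi_(PGL2 dF) g.
Proof.
split=> [[g gI <-]|[g gI ->]]; first by exists g => //; exact/GL2_intP.
by exists g => //; exact/GL2_intP.
Qed.

Lemma Keps_pi g : GL2_int g -> Keps (\pi_(PGL2 dF) g).
Proof. by move=> h; apply/KepsP; exists g. Qed.

Lemma GL2_int_inv g : GL2_int g -> GL2_int g^-1%g.
Proof. by move=> /GL2_intP h; apply/GL2_intP => i j; rewrite invgK; case: (h i j). Qed.

Lemma GL2_int_mul g h : GL2_int g -> GL2_int h -> GL2_int (g * h)%g.
Proof.
move=> [gI vg] [hI vh]; split.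
  move=> i j; rewrite GL2_mulE mulmx2E.
  by apply: dgeD; rewrite -[0%R]addr0; apply: dgeM.
have g0 := GL2_dual_det_neq0 g; have h0 := GL2_dual_det_neq0 h.
by rewrite GL2_mulE det_mulmx dual_mulE /= lf_valM // vg vh.
Qed.

Lemma Keps_mul (x y : PGL2 dF) : Keps x -> Keps y -> Keps (x * y)%g.
Proof.
move=> /KepsP[g gI ->] /KepsP[h hI ->]; rewrite PGL2_mul_pi.
exact/Keps_pi/GL2_int_mul.
Qed.

Lemma Keps_inv (x : PGL2 dF) : Keps x -> Keps x^-1%g.
Proof.
by move=> /KepsP[g gI ->]; rewrite PGL2_inv_pi; exact/Keps_pi/GL2_int_inv.
Qed.

Lemma Keps_one : Keps (1%g : PGL2 dF).
Proof.
apply: Keps_pi; split=> [i j|]; last by rewrite /= det1 dual_oneE lf_val1.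
rewrite /= mxE; case: (_ == _); [exact: dge1|exact: dge00].
Qed.

Definition lift_mx (M : 'M[F]_2) : 'M[dF]_2 := map_mx (fun a : F => (a, 0) : dF) M.

Lemma lift_mxE (M : 'M[F]_2) i j : lift_mx M i j = (M i j, 0). Proof. by rewrite mxE. Qed.

Lemma lift_mx_mul (M N : 'M[F]_2) : lift_mx (M *m N) = lift_mx M *m lift_mx N.
Proof.
apply/matrixP => i j; rewrite lift_mxE !mulmx2E !lift_mxE !dualE /=.
by congr pair; ring.
Qed.

Lemma det_lift_mx (M : 'M[F]_2) : \det (lift_mx M) = (\det M, 0).
Proof. by rewrite !det2 !lift_mxE !dualE /=; congr pair; ring. Qed.

Lemma lift_unit (g : GL2 F) : \det (lift_mx (GL2_mx g)) \is a GRing.unit.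
Proof. by rewrite det_lift_mx dual_unitE /= GL2_det_neq0. Qed.

Definition dual_lift (g : GL2 F) : GL2 dF := GL2_of (lift_unit g).

Lemma inG_pi (g : GL2 F) : inG (\pi_(PGL2 F) g) = \pi_(PGL2 dF) (dual_lift g).
Proof.
rewrite /inG (pglE (lift_unit _)); have [z uz zg] := PGL2_repr g.
apply: (@PGL2_scaleP dF _ _ ((z, 0) : dF)); first by rewrite dual_unitE /= -unitfE.
apply/matrixP => i j; rewrite [LHS]mxE zg [RHS]mxE [X in _ * X]mxE mxE dualE /=.
by congr pair; ring.
Qed.

Lemma inGM (x y : PGL2 F) : inG (x * y)%g = (inG x * inG y)%g.
Proof.
elim/PGL2_ind: x => g; elim/PGL2_ind: y => h.
rewrite PGL2_mul_pi !inG_pi PGL2_mul_pi; apply: eq_PGL2.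
by rewrite /= lift_mx_mul.
Qed.

Lemma inG1 : inG (1%g : PGL2 F) = 1%g.
Proof.
rewrite !PGL2_one_pi inG_pi; apply: eq_PGL2; apply/matrixP => i j.
by rewrite /= lift_mxE !mxE; case: (i == j).
Qed.

Lemma one_eps_unit (m : 'M[F]_2) :
  \det (\matrix_(i, j) (((1%:M : 'M[F]_2) i j, m i j) : dF)) \is a GRing.unit.
Proof.
rewrite dual_unitE dual_det1 !mxE /= ?eqxx /= !(mulr1n, mulr0n).
by rewrite mulr1 mulr0 subr0 oner_neq0.
Qed.

Definition one_eps_GL2 m : GL2 dF := GL2_of (one_eps_unit m).

Lemma one_epsE m : one_eps m = \pi_(PGL2 dF) (one_eps_GL2 m).
Proof. by rewrite /one_eps (pglE (one_eps_unit m)). Qed.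

Lemma one_eps_GL2_00 m : GL2_mx (one_eps_GL2 m) 0 0 = (1, m 0 0).
Proof. by rewrite /= !mxE. Qed.
Lemma one_eps_GL2_01 m : GL2_mx (one_eps_GL2 m) 0 1 = (0, m 0 1).
Proof. by rewrite /= !mxE. Qed.
Lemma one_eps_GL2_10 m : GL2_mx (one_eps_GL2 m) 1 0 = (0, m 1 0).
Proof. by rewrite /= !mxE. Qed.
Lemma one_eps_GL2_11 m : GL2_mx (one_eps_GL2 m) 1 1 = (1, m 1 1).
Proof. by rewrite /= !mxE. Qed.
Definition one_eps_GL2E :=
  (one_eps_GL2_00, one_eps_GL2_01, one_eps_GL2_10, one_eps_GL2_11).

End DualMatrix.

(** * Height and slope, the two invariants that determine a spherical function *)

Section Height.
Variable F : nonArchLocalFieldType.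
Local Notation dF := (dual F).
Implicit Types (c d : F) (M k : 'M[F]_2).

(** The minimum of v(c) and v(d) with v(0) = +infinity; it is junk when both entries vanish. *)
Definition row_val c d : int :=
  if c == 0 then lf_val d else if d == 0 then lf_val c
  else Num.min (lf_val c) (lf_val d).

Lemma row_valP c d n : (c != 0) || (d != 0) ->
  vge n c && vge n d = (n <= row_val c d).
Proof.
rewrite /row_val /vge; case: (eqVneq c 0) => [->|c0] /=; last first.
  by case: (eqVneq d 0) => //= _; rewrite ?andbT ?le_min.
by move=> /negbTE ->.
Qed.

Lemma row_neq0 M : \det M != 0 -> (M 1 0 != 0) || (M 1 1 != 0).
Proof.
move=> d0; rewrite -negb_and; apply: contra_neqN d0 => /andP[/eqP h1 /eqP h2].
by rewrite det2 h1 h2 !mulr0 subrr.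
Qed.

(* The N for which a matrix lies in U diag(w^(-N), 1) GL_2(O) F^*. *)
Definition bottom_val M := row_val (M 1 0) (M 1 1).
Definition height M : int := 2 * bottom_val M - lf_val (\det M).

(* [lia] does not abstract the subterms that mention matrices. *)
Ltac vlia := intros;
  repeat match goal with
  | H : is_true _ |- _ => revert H
  | H : @eq int _ _ |- _ => revert H
  end;
  repeat match goal with
  | |- context [lf_val ?x] => generalize (lf_val x); intro
  | |- context [bottom_val ?x] => generalize (bottom_val x); intro
  | |- context [height ?x] => generalize (height x); intro
  end; lia.

Lemma lf_val_detM M k : \det M != 0 -> \det k != 0 ->
  lf_val (\det (M *m k : 'M[F]_2)) = lf_val (\det M) + lf_val (\det k).
Proof. by move=> dM dk; rewrite det_mulmx lf_valM. Qed.

Lemma lf_val_detV k : \det k != 0 -> lf_val (\det (invmx k)) = - lf_val (\det k).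
Proof. by move=> dk; rewrite det_inv lf_valV. Qed.

(** Entries of k in w^e O raise the valuation of the bottom row by at least e. Applied to k and to
    its inverse, this one inequality yields all later comparisons of heights. *)
Lemma height_mul_ge (e : int) M k : \det M != 0 -> \det k != 0 ->
  (forall i j, vge e (k i j)) ->
  height M + 2 * e - lf_val (\det k) <= height (M *m k).
Proof.
move=> dM dk ke; have dMk : \det (M *m k : 'M[F]_2) != 0 by rewrite det_mulmx mulf_neq0.
rewrite /height lf_val_detM //.
suff : bottom_val M + e <= bottom_val (M *m k) by vlia.
set r := bottom_val M; have /andP[h0 h1] : vge r (M 1 0) && vge r (M 1 1).
  by rewrite row_valP ?row_neq0.
rewrite /bottom_val -row_valP ?row_neq0 // !mulmx2E.
by apply/andP; split; apply: vgeD; exact: vgeM.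
Qed.

(** Scaling is multiplication by a scalar matrix, whose determinant z^2 cancels the gain 2 v(z);
    z^-1 gives the opposite inequality. *)
Lemma heightZ z M : z != 0 -> \det M != 0 -> height (z *: M) = height M.
Proof.
move=> z0 dM.
have hz M' y : y != 0 -> \det M' != 0 -> height M' <= height (y *: M').
  move=> y0 dM'; have dy : \det (y%:M : 'M[F]_2) != 0.
    by rewrite det_scalar expf_neq0.
  have := @height_mul_ge (lf_val y) M' y%:M dM' dy.
  rewrite det_scalar expr2 lf_valM // mul_mx_scalar => h.
  rewrite (le_trans _ (h _)) //; first vlia.
  by move=> i j; rewrite mxE; case: (i == j); rewrite ?mulr1n ?mulr0n ?vge0 ?vgeE.
apply/eqP; rewrite eq_le hz // andbT.
rewrite -[X in _ <= height X](scalerK z0) hz ?invr_neq0 //.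
by rewrite detZ mulf_neq0 // expf_neq0.
Qed.

Lemma height_mulK M k : \det M != 0 -> \det k != 0 ->
  (forall i j, vge 0 (k i j)) -> lf_val (\det k) = 0 -> 
  (forall i j, vge 0 (invmx k i j)) -> height (M *m k) = height M.
Proof.
move=> dM dk kI vk kVI.
have uk : k \in unitmx by rewrite unitmxE unitfE.
apply/eqP; rewrite eq_le; apply/andP; split.
  have dMk : \det (M *m k : 'M[F]_2) != 0 by rewrite det_mulmx mulf_neq0.
  have dkV : \det (invmx k) != 0 by rewrite det_inv invr_neq0.
  have := height_mul_ge dMk dkV kVI.
  by rewrite mulmxK // det_inv lf_valV // vk; vlia.
by have := height_mul_ge dM dk kI; rewrite vk; vlia.
Qed.

(** Needed for translates of spherical vectors: their support still has bounded height, hence is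
    compact modulo U. *)
Lemma height_mul_bounded k : \det k != 0 -> exists C : nat, forall M, \det M != 0 ->
  (absz (height (M *m k) - height M)%R <= C)%N.
Proof.
move=> dk.
have ent (h : 'M[F]_2) : exists e, forall i j, vge e (h i j).
  exists (- (`|lf_val (h 0 0)| + `|lf_val (h 0 1)| + `|lf_val (h 1 0)| + `|lf_val (h 1 1)|)).
  by elim/ord2_ind; elim/ord2_ind; rewrite /vge; case: eqP => //= _; lia.
have uk : k \in unitmx by rewrite unitmxE unitfE.
have [e he] := ent k; have [e' he'] := ent (invmx k).
exists (absz (2 * e - lf_val (\det k))%R + absz (2 * e' + lf_val (\det k))%R)%N => M dM.
have dMk : \det (M *m k : 'M[F]_2) != 0 by rewrite det_mulmx mulf_neq0.
have dkV : \det (invmx k) != 0 by rewrite det_inv invr_neq0.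
have := height_mul_ge dMk dkV he'; have := height_mul_ge dM dk he.
rewrite mulmxK // lf_val_detV //; vlia.
Qed.

Definition red (M : 'M[dF]_2) : 'M[F]_2 := map_mx fst M.

Lemma redE (M : 'M[dF]_2) i j : red M i j = (M i j).1. Proof. by rewrite mxE. Qed.

Lemma det_red (M : 'M[dF]_2) : \det (red M) = (\det M).1.
Proof. by rewrite det2 dual_det1 !redE. Qed.

Lemma red_mul (M N : 'M[dF]_2) : red (M *m N) = red M *m red N.
Proof. by apply/matrixP => i j; rewrite redE !mulmx2E !redE. Qed.

Lemma red_lift (M : 'M[F]_2) : red (lift_mx M) = M.
Proof. by apply/matrixP => i j; rewrite redE lift_mxE. Qed.

Lemma red_neq0 (g : GL2 dF) : \det (red g) != 0.
Proof. by rewrite det_red GL2_dual_det_neq0. Qed.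

Lemma red_one_eps (m : 'M[F]_2) : red (one_eps_GL2 m) = 1%:M.
Proof. by apply/matrixP => i j; rewrite redE /= mxE. Qed.

(* The entry (B A^-1)_{1,0} of g = A + epsilon B, so that psi_m0 (B A^-1) = psi0 (slope g). *)
Definition slope (g : 'M[dF]_2) : F :=
  ((g 1 0).2 * (g 1 1).1 - (g 1 1).2 * (g 1 0).1) / (\det g).1.

Lemma slopeZ (z : dF) (g : GL2 dF) : z \is a GRing.unit ->
  slope (z *: GL2_mx g) = slope g.
Proof.
rewrite dual_unitE => z0; rewrite /slope detZ expr2 !mxE !dualE /=.
have := GL2_dual_det_neq0 g => d0; field; by rewrite z0 d0.
Qed.

Lemma slope_one_eps m (g : GL2 dF) : slope (one_eps_GL2 m * g)%g = m 1 0 + slope g.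
Proof.
have := GL2_dual_det_neq0 g.
rewrite /slope GL2_mulE det_mulmx !mulmx2E !one_eps_GL2E.
rewrite [\det (GL2_mx (one_eps_GL2 m))]det2 !one_eps_GL2E !dualE /= => d0.
rewrite !(mul0r, mulr0, mul1r, mulr1, add0r, addr0, subr0).
by move: d0; rewrite dual_det1 => d0; field.
Qed.

Lemma slope_lift (M : 'M[F]_2) : slope (lift_mx M) = 0.
Proof. by rewrite /slope !lift_mxE /= !mul0r subrr mul0r. Qed.

Lemma GL2_int_red (k : GL2 dF) : GL2_int k ->
  (forall i j, vge 0 (red k i j)) /\ lf_val (\det (red k)) = 0.
Proof.
by move=> [kI vk]; rewrite det_red; split=> // i j; rewrite redE; case/andP: (kI i j).
Qed.

Lemma red_inv (k : GL2 dF) : red k^-1%g = invmx (red k).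
Proof.
have uk : red k \in unitmx by rewrite unitmxE unitfE red_neq0.
have h : red k^-1%g *m red k = 1%:M.
  rewrite -red_mul -GL2_mulE mulVg; apply/matrixP => i j; rewrite redE !mxE.
  by case: (i == j).
by rewrite -[LHS](mulmxK uk) h mul1mx.
Qed.

Lemma height_mul_int (g k : GL2 dF) : GL2_int k ->
  height (red (g * k)%g) = height (red g).
Proof.
move=> kI; rewrite GL2_mulE red_mul.
have [h1 h2] := GL2_int_red kI; have [h3 h4] := GL2_int_red (GL2_int_inv kI).
apply: height_mulK => //; rewrite ?red_neq0 //.
by move=> i j; rewrite -red_inv.
Qed.

(** The difference of slopes is a 2 x 2 minor of vectors obtained from the bottom row (c, d) by
    integral matrices, divided by a determinant. Each entry has valuation at least min(v(c), v(d)),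
    so the quotient has valuation at least the height. *)
Lemma slope_mul_int (g k : GL2 dF) : GL2_int k -> 0 <= height (red g) ->
  vge 0 (slope (g * k)%g - slope g).
Proof.
move=> [kI vk] hg.
have dg := GL2_dual_det_neq0 g; have dk := GL2_dual_det_neq0 k.
set c := (GL2_mx g 1 0).1; set d := (GL2_mx g 1 1).1.
have kI1 i j : vge 0 (GL2_mx k i j).1 by case/andP: (kI i j).
have kI2 i j : vge 0 (GL2_mx k i j).2 by case/andP: (kI i j).
have -> : slope (g * k)%g - slope g =
  ((c * (GL2_mx k 0 0).2 + d * (GL2_mx k 1 0).2) *
   (c * (GL2_mx k 0 1).1 + d * (GL2_mx k 1 1).1) -
   (c * (GL2_mx k 0 1).2 + d * (GL2_mx k 1 1).2) *
   (c * (GL2_mx k 0 0).1 + d * (GL2_mx k 1 0).1))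
   / ((\det (GL2_mx g)).1 * (\det (GL2_mx k)).1).
  rewrite /slope GL2_mulE det_mulmx !mulmx2E !dualE /= -/c -/d.
  move: dg dk; rewrite !dual_det1 -/c -/d => dg dk; field.
  by rewrite dg dk.
set r := row_val c d.
have /andP[hc hd] : vge r c && vge r d.
  by rewrite /r /c /d -!redE row_valP // row_neq0 ?red_neq0.
set D := _.1 * (\det (GL2_mx k)).1; have D0 : D != 0 by rewrite mulf_neq0.
have vD : vge (- lf_val (\det (GL2_mx g)).1) D^-1.
  by rewrite vgeE ?invr_neq0 // lf_valV // lf_valM // vk addr0.
have hr : 0 <= 2 * r - lf_val (\det (GL2_mx g)).1.
  by move: hg; rewrite /height /bottom_val det_red !redE.
have lin a b : vge 0 a -> vge 0 b -> vge r (c * a + d * b).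
  by move=> a0 b0; apply: vgeD; exact: vge0M_r.
apply: (@vgeW _ _ (r + r + - lf_val (\det (GL2_mx g)).1)); first by move: hr; clearbody r; vlia.
by apply: vgeM => //; apply: vgeB; apply: vgeM; apply: lin.
Qed.

End Height.

(** * The factorizations of G_epsilon by 1 + epsilon g and of G by U, the torus and K *)

Section Factorization.
Variable F : nonArchLocalFieldType.
Local Notation dF := (dual F).
Variable w : F.
Hypothesis w_gen : generates_max_ideal w.

Lemma two_neq0 : 2%N \notin [pchar F] -> (2 : F) != 0.
Proof. move=> F_char; by apply: contraNN F_char => h; rewrite inE. Qed.

Lemma red_unit (g : GL2 dF) : \det (red g) \is a GRing.unit.
Proof. by rewrite unitfE red_neq0. Qed.

Definition red_GL2 (g : GL2 dF) : GL2 F := GL2_of (red_unit g).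

Lemma trace2 (m : 'M[F]_2) : \tr m = m 0 0 + m 1 1.
Proof.
by rewrite /mxtrace big_ord_recl big_ord1; congr (_ + m _ _); apply: val_inj.
Qed.

(** Write g = A + epsilon B = (1 + epsilon B A^-1) A and remove the trace of B A^-1 by a central
    factor 1 + epsilon t; this needs division by 2. *)
Lemma factor_eps (F_char : 2%N \notin [pchar F]) (g : GL2 dF) : exists2 m, \tr m = 0 /\ m 1 0 = slope g &
  \pi_(PGL2 dF) g = (one_eps m * inG (\pi_(PGL2 F) (red_GL2 g)))%g.
Proof.
pose B i j := (GL2_mx g i j).2; pose A i j := (GL2_mx g i j).1.
pose D := (\det (GL2_mx g)).1.
(* Half the trace of B A^-1. *)
pose t := ((B 0 0 * A 1 1 - B 0 1 * A 1 0) + (B 1 1 * A 0 0 - B 1 0 * A 0 1)) / D / 2.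
pose m : 'M[F]_2 := mx2 ((B 0 0 * A 1 1 - B 0 1 * A 1 0) / D - t)
   ((B 0 1 * A 0 0 - B 0 0 * A 0 1) / D) ((B 1 0 * A 1 1 - B 1 1 * A 1 0) / D)
   ((B 1 1 * A 0 0 - B 1 0 * A 0 1) / D - t).
have D0 : D != 0 by exact: GL2_dual_det_neq0.
have D0' : A 0 0 * A 1 1 - A 0 1 * A 1 0 != 0 by rewrite -dual_det1.
exists m.
  split; last by rewrite mx2E.
  by rewrite trace2 !mx2E /t; field; rewrite D0 (two_neq0 F_char).
rewrite one_epsE inG_pi PGL2_mul_pi.
apply: (@PGL2_scaleP dF _ _ ((1, t) : dF)).
  by rewrite dual_unitE oner_neq0.
by apply: matrix2P; rewrite mxE GL2_mulE mulmx2E !one_eps_GL2E /= !lift_mxE !redE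
  !mx2E /=; apply: dual_eqP; rewrite !dualE /= -!/(A _ _) -?/(B _ _) /t ?dual_det1;
  rewrite ?/D ?dual_det1 -?/(A _ _); field; rewrite ?(two_neq0 F_char).
Qed.

Lemma tmxE (x : F) (u : \det (mx2 x 0 0 1) \is a GRing.unit) :
  tmx x = \pi_(PGL2 F) (GL2_of u).
Proof. exact: pglE. Qed.

Lemma tmx_unit (x : F) : x != 0 -> \det (mx2 x 0 0 1 : 'M[F]_2) \is a GRing.unit.
Proof. by move=> x0; rewrite !det2E unitfE mulr1 mulr0 subr0. Qed.

Lemma unip_unit (x : F) : \det (mx2 1 x 0 1 : 'M[F]_2) \is a GRing.unit.
Proof. by rewrite !det2E unitfE mulr1 mulr0 subr0 oner_neq0. Qed.

(** Iwasawa decomposition, with the torus part made explicit by the height. *)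
Lemma factor_unip (g : GL2 F) : exists u, exists2 k : GL2 F, unip u /\ GL2_int (dual_lift k) &
  \pi_(PGL2 F) g = (u * tmx (w ^ (- height g))%R * \pi_(PGL2 F) k)%g.
Proof.
pose a := GL2_mx g 0 0; pose b := GL2_mx g 0 1.
pose c := GL2_mx g 1 0; pose d := GL2_mx g 1 1.
have D0 := GL2_det_neq0 g; set D := \det _ in D0.
have DE : D = a * d - b * c by rewrite /D det2.
pose n := height g.
have wn0 : w ^ n != 0 by exact: uniformizer_exp_neq0.
have wNn0 : w ^ (- n) != 0 by exact: uniformizer_exp_neq0.
have rn := row_neq0 D0.
have nE : n = 2 * bottom_val g - lf_val D by [].
rewrite -/n (tmxE (tmx_unit wNn0)).
have intk (k : GL2 F) : (forall i j, vge 0 (GL2_mx k i j)) -> lf_val (\det (GL2_mx k)) = 0 ->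
    GL2_int (dual_lift k).
  move=> kI vk; split; last by rewrite /= det_lift_mx.
  by move=> i j; rewrite /= lift_mxE dge_pair kI vge0.
(* The bottom entry of smaller valuation serves as pivot, so that the quotient of the two is
   integral. *)
have [[c0 vdc]|[d0 vcd]] : (c != 0 /\ vge (lf_val c) d /\ n = 2 * lf_val c - lf_val D) \/
    (d != 0 /\ vge (lf_val d) c /\ n = 2 * lf_val d - lf_val D).
  rewrite nE /bottom_val /row_val -/c -/d; move: rn; rewrite -/c -/d /vge.
  have [->|c0] := eqVneq c 0; first by move=> /= d0; right.
  have [->|d0] := eqVneq d 0; first by left.
  by move=> _; case: (leP (lf_val c) (lf_val d)) => h; [left|right]; rewrite ?(ltW h) ?orbT.
- case: vdc => vdc {}nE.
  (* Forced by comparing the upper right entries of g and c u t k; the value of the height makes it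
     a unit. *)
  pose eta := - D / c ^+ 2 * w ^ n.
  have vc2 : lf_val (c ^+ 2) = 2 * lf_val c by rewrite expr2 lf_valM //; lia.
  have c20 : c ^+ 2 != 0 by rewrite expf_neq0.
  have eta0 : eta != 0 by rewrite !mulf_neq0 ?oppr_eq0 ?invr_neq0.
  have veta : lf_val eta = 0.
    rewrite /eta lf_valM ?mulf_neq0 ?oppr_eq0 ?invr_neq0 // lf_val_div ?oppr_eq0 //.
    by rewrite lf_valN lf_val_exp // vc2 nE; lia.
  have ku : \det (mx2 0 eta 1 (d / c) : 'M[F]_2) \is a GRing.unit.
    by rewrite !det2E unitfE mul0r mulr1 sub0r oppr_eq0.
  exists (pgl (mx2 1 (a / c) 0 1)), (GL2_of ku).
    split; first by exists (a / c).
    apply: intk; last by rewrite /= !det2E mul0r mulr1 sub0r lf_valN.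
    elim/ord2_ind; elim/ord2_ind; rewrite /= mx2E ?vge0 ?vge1 //.
      by rewrite vgeE // veta.
    rewrite -(subrr (lf_val c)); apply: vgeM => //.
    by rewrite vgeE ?invr_neq0 // lf_valV.
  rewrite (pglE (unip_unit _)) !PGL2_mul_pi; apply: (@PGL2_scaleP F _ _ c).
    by rewrite unitfE.
  have ww : w ^ (- n) * eta = - D / c ^+ 2.
    by rewrite /eta mulrCA -expfzDr ?uniformizer_neq0 // addNr expr0z mulr1.
  apply: matrix2P; rewrite mxE !GL2_mulE !mulmx2E /= ?mulmx2E !mx2E
    ?(mul0r, mulr0, mul1r, mulr1, add0r, addr0) ?ww -/a -/b -/c -/d ?DE; by field.
- case: vcd => vcd {}nE.
  pose eta := D / d ^+ 2 * w ^ n.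
  have vd2 : lf_val (d ^+ 2) = 2 * lf_val d by rewrite expr2 lf_valM //; lia.
  have d20 : d ^+ 2 != 0 by rewrite expf_neq0.
  have eta0 : eta != 0 by rewrite !mulf_neq0 ?oppr_eq0 ?invr_neq0.
  have veta : lf_val eta = 0.
    rewrite /eta lf_valM ?mulf_neq0 ?oppr_eq0 ?invr_neq0 // lf_val_div //.
    by rewrite lf_val_exp // vd2 nE; lia.
  have ku : \det (mx2 eta 0 (c / d) 1 : 'M[F]_2) \is a GRing.unit.
    by rewrite !det2E unitfE mul0r mulr1 subr0.
  exists (pgl (mx2 1 (b / d) 0 1)), (GL2_of ku).
    split; first by exists (b / d).
    apply: intk; last by rewrite /= !det2E mul0r mulr1 subr0.
    elim/ord2_ind; elim/ord2_ind; rewrite /= mx2E ?vge0 ?vge1 //.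
      by rewrite vgeE // veta.
    rewrite -(subrr (lf_val d)); apply: vgeM => //.
    by rewrite vgeE ?invr_neq0 // lf_valV.
  rewrite (pglE (unip_unit _)) !PGL2_mul_pi; apply: (@PGL2_scaleP F _ _ d).
    by rewrite unitfE.
  have ww : w ^ (- n) * eta = D / d ^+ 2.
    by rewrite /eta mulrCA -expfzDr ?uniformizer_neq0 // addNr expr0z mulr1.
  apply: matrix2P; rewrite mxE !GL2_mulE !mulmx2E /= ?mulmx2E !mx2E
    ?(mul0r, mulr0, mul1r, mulr1, add0r, addr0) ?ww -/a -/b -/c -/d ?DE; by field.
Qed.

End Factorization.

(** * Spherical vectors as sequences *)

Section Radial.
Variables (R : realType) (F : nonArchLocalFieldType).
Local Notation C := R[i].
Local Notation dF := (dual F).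
Local Notation G := (PGL2 F).
Local Notation Geps := (PGL2 dF).
Hypothesis F_char : 2%N \notin [pchar F].
Variable w : F.
Hypothesis w_gen : generates_max_ideal w.
Variable psi0 : F -> C.
Hypothesis psi0_char : additive_character psi0.
Hypothesis psi0_cond : conductor_integers psi0.
Implicit Types (a b : int -> C) (f : Geps -> C).

Lemma psi0D x y : psi0 (x + y) = psi0 x * psi0 y.
Proof. exact: additive_characterD. Qed.

Lemma psi0_int y : vge 0 y -> psi0 y = 1.
Proof.
move=> vy; have : ring_of_integers (1 : F) by apply/ring_of_integersE; exact: vge1.
rewrite -psi0_cond => /(_ y); rewrite mul1r; apply; exact/ring_of_integersE.
Qed.

Lemma psi0_0 : psi0 0 = 1. Proof. by apply: psi0_int; exact: vge0. Qed.

Lemma psi0_nontrivial x : ~~ vge 0 x -> exists2 y, vge 0 y & psi0 (x * y) != 1.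
Proof.
move=> vx; apply: contrapT => h; move/negP: vx; apply.
apply/ring_of_integersE; rewrite -psi0_cond => y /ring_of_integersE vy.
by apply/eqP; apply: contrapT => /negP hy; apply: h; exists y.
Qed.

Lemma psi_m0E (m : 'M[F]_2) : psi_m psi0 (m0 F) m = psi0 (m 1 0).
Proof. by rewrite /psi_m /m0 trace2 !mulmx2E !mx2E !(mul0r, mul1r, add0r, addr0). Qed.

(** The candidate spherical function with value a_n at t_(w^-n). It is defined for every a, but only
    those vanishing at negative n give right K-invariant functions. *)
Definition radial a : Geps -> C := fun x =>
  psi0 (slope (GL2_mx (repr x))) * a (height (red (GL2_mx (repr x)))).

Lemma radialE a (g : GL2 dF) :
  radial a (\pi_(PGL2 dF) g) = psi0 (slope g) * a (height (red g)).
Proof.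
rewrite /radial; have [z uz ->] := PGL2_repr g.
rewrite slopeZ //; congr (_ * a _).
have -> : red (z *: GL2_mx g) = z.1 *: red g.
  by apply/matrixP => i j; rewrite redE !mxE dualE.
by rewrite heightZ ?red_neq0 // -dual_unitE.
Qed.

Lemma radial_one_eps a m x : radial a (one_eps m * x)%g = psi0 (m 1 0) * radial a x.
Proof.
elim/PGL2_ind: x => g; rewrite one_epsE PGL2_mul_pi !radialE.
by rewrite slope_one_eps psi0D mulrA GL2_mulE red_mul red_one_eps mul1mx.
Qed.

Lemma radial_unip a u x : unip u -> radial a (inG u * x)%g = radial a x.
Proof.
move=> [t _ <-]; elim/PGL2_ind: x => g.
rewrite (pglE (unip_unit _)) inG_pi PGL2_mul_pi !radialE; congr (psi0 _ * a _).
  rewrite /slope GL2_mulE det_mulmx /= det_lift_mx !mulmx2E !lift_mxE !det2E !dualE /=.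
  by congr (_ / _); ring.
rewrite GL2_mulE red_mul red_lift /height /bottom_val !mulmx2E !mx2E.
rewrite !mul0r !add0r !mul1r; congr (_ - _).
have -> : \det (mx2 1 t 0 1 *m red g) = \det (red g).
  by rewrite det_mulmx [\det (mx2 _ _ _ _)]det2 !mx2E mulr1 mulr0 subr0 mul1r.
by [].
Qed.

(** At height n >= 0 the slope moves by an integer, on which psi0 is 1; at n < 0 it may move by
    more, and there a_n = 0 is used. *)
Lemma radialK a x k : (forall n, n < 0 -> a n = 0) -> Keps k ->
  radial a (x * k)%g = radial a x.
Proof.
move=> a0 /KepsP[h hI ->]; elim/PGL2_ind: x => g.
rewrite PGL2_mul_pi !radialE height_mul_int //.
have [lt0|ge0] := ltP (height (red g)) 0; first by rewrite a0 // !mulr0.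
rewrite -[slope (g * h)%g](subrK (slope g)) psi0D psi0_int ?mul1r //.
exact: slope_mul_int.
Qed.

Lemma radial_inG a (g : GL2 F) : radial a (inG (\pi_(PGL2 F) g)) = a (height g).
Proof. by rewrite inG_pi radialE slope_lift psi0_0 mul1r red_lift. Qed.

Lemma height_tmx r : height (mx2 (w ^ r) 0 0 1) = - r.
Proof.
rewrite /height /bottom_val !mx2E /row_val eqxx lf_val1 !det2E mulr1 !mulr0 subr0.
by rewrite lf_val_exp // sub0r.
Qed.

Lemma radial_tmx a r : radial a (inG (tmx (w ^ r))) = a (- r).
Proof.
by rewrite (tmxE (tmx_unit (uniformizer_exp_neq0 w_gen r))) radial_inG height_tmx.
Qed.

Lemma radial_one a : radial a 1%g = a 0.
Proof.
rewrite -inG1 PGL2_one_pi radial_inG; congr a.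
by rewrite /= /height /bottom_val !mxE /= /row_val eqxx det1 lf_val1.
Qed.

(* The invariance properties shared by the elements of V_{m,1}^K and their
   images under the Hecke operator. *)
Record equivariant f : Prop := {
  equivariant_eps : forall (m' : 'M[F]_2) (g : G), \tr m' = 0 ->
    f (one_eps m' * inG g)%g = psi0 (m' 1 0) * f (inG g);
  equivariant_unip : forall u g : G, unip u -> f (inG (u * g)%g) = f (inG g);
  equivariant_K : forall k x, Keps k -> f (x * k)%g = f x }.

Lemma V_equivariant f : V_m1_Keps psi0 f -> equivariant f.
Proof.
move=> [[_ fe fu _] fK]; split=> //.
- by move=> m' g tm; rewrite fe // psi_m0E.
- by move=> k x kK; have := fK k kK => /(congr1 (fun h => h x)).
Qed.

Lemma dual_lift_E (g : GL2 F) i j : GL2_mx (dual_lift g) i j = (GL2_mx g i j, 0).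
Proof. exact: lift_mxE. Qed.

Lemma one_eps_tmx (x y : F) : x != 0 ->
  (one_eps (mx2 0 0 y 0) * inG (tmx x) = inG (tmx x) * one_eps (mx2 0 0 (x * y)%R 0))%g.
Proof.
move=> x0; rewrite (tmxE (tmx_unit x0)) !one_epsE inG_pi !PGL2_mul_pi.
set t := GL2_of _; have tE : GL2_mx t = mx2 x 0 0 1 by [].
apply: eq_PGL2_mul; elim/ord2_ind; elim/ord2_ind;
  rewrite !dual_lift_E tE !one_eps_GL2E !mx2E !dualE /=; by congr pair; ring.
Qed.

Definition profile f : int -> C := fun n => f (inG (tmx (w ^ (- n)))).

(** Moving 1 + epsilon [[0, 0], [y, 0]], an element of K, to the left of t_(w^-n) turns y into w^n
    y. As w^n is not integral, some integral y has psi0(w^n y) != 1, which forces the value to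
    vanish. *)
Lemma profile_neg f n : equivariant f -> n < 0 -> profile f n = 0.
Proof.
move=> [fe fu fK] n0.
have vw : ~~ vge 0 (w ^ n) by rewrite vge_exp // -ltNge.
have [y vy py] := psi0_nontrivial vw.
pose m : 'M[F]_2 := mx2 0 0 y 0; pose m' : 'M[F]_2 := mx2 0 0 (w ^ n * y) 0.
have tm' : \tr m' = 0 by rewrite trace2 !mx2E addr0.
set t := inG (tmx (w ^ (- n))).
have wn0 : w ^ (- n) != 0 by exact: uniformizer_exp_neq0.
have comm : (one_eps m' * t = t * one_eps m)%g.
  have e : w ^ (- n) * (w ^ n * y) = y.
    by rewrite mulrA -expfzDr ?uniformizer_neq0 // addNr expr0z mul1r.
  by have := one_eps_tmx (w ^ n * y) wn0; rewrite e.
have Km : Keps (one_eps m).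
  rewrite one_epsE; apply: Keps_pi; split.
    by elim/ord2_ind; elim/ord2_ind; rewrite one_eps_GL2E dge_pair ?mx2E ?vge0 ?vge1.
  rewrite dual_det1 !one_eps_GL2E /= mulr1 mulr0 subr0; exact: lf_val1.
have e1 : f (one_eps m' * t)%g = psi0 (m' 1 0) * f t := fe _ _ tm'.
have e2 : f (t * one_eps m)%g = f t := fK _ _ Km.
have : psi0 (w ^ n * y) * f t = f t.
  by have := etrans (esym e1) (etrans (congr1 f comm) e2); rewrite mx2E.
move/eqP; rewrite -subr_eq0 -{2}[f t]mul1r -mulrBl mulf_eq0.
by rewrite subr_eq0 (negbTE py) /= => /eqP.
Qed.

(** Both sides transform alike under the factors of [factor_eps] and [factor_unip], which leaves
    only the values at powers of w. *)
Lemma equivariant_radial f : equivariant f -> f = radial (profile f).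
Proof.
move=> fE; have [fe fu fK] := fE; apply/funext; elim/PGL2_ind => g.
have [m [tm ms] ->] := factor_eps F_char g.
rewrite radial_one_eps fe //; congr (_ * _).
have [u [k [uu kI] ->]] := factor_unip w_gen (red_GL2 g).
have kK : Keps (inG (\pi_(PGL2 F) k)) by rewrite inG_pi; exact: Keps_pi.
rewrite !inGM fK // radialK //; last by move=> n; exact: profile_neg.
by rewrite radial_unip // -inGM fu // radial_tmx opprK.
Qed.

End Radial.

(** * Smoothness and compact support *)

Section Neighbourhoods.
Variable F : nonArchLocalFieldType.
Local Notation dF := (dual F).

Lemma nbhs_vge (x : F) (n : int) : \forall y \near x, vge n (y - x).
Proof.
apply/nbhsP; exists [set xy : F * F | xy.1 = xy.2 \/ n <= lf_val (xy.1 - xy.2)].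
  by rewrite lf_entourageE; exists n.
move=> y; rewrite xsectionE /= => -[->|h]; first by rewrite subrr vge0.
by rewrite -vgeN opprB /vge h orbT.
Qed.

Lemma nbhs_vgeP (x : F) (P : set F) : nbhs x P ->
  exists n, forall y, vge n (y - x) -> P y.
Proof.
move=> /nbhsP[E]; rewrite lf_entourageE => -[n _ nE] EP; exists n => y vy.
apply: EP; rewrite xsectionE; apply: nE => /=.
have [->|yx] := eqVneq x y; [by left|right].
by rewrite -lf_valN opprB -vgeE // subr_eq0 eq_sym.
Qed.

Lemma nbhs_dge (x : dF) (n : int) : \forall y \near x, dge n (y - x).
Proof.
exists ([set y | vge n (y - x.1)], [set y | vge n (y - x.2)]) => /=.
  by split; exact: nbhs_vge.
by move=> [y1 y2] [/= h1 h2]; rewrite /dge /= h1.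
Qed.

Lemma nbhs_GL2 (A : topComUnitRingType) (g : GL2 A) (P : 'I_2 -> 'I_2 -> set A) :
  (forall i j, nbhs (GL2_mx g i j) (P i j)) ->
  \forall h \near g, forall i j, P i j (GL2_mx h i j).
Proof.
move=> gP; have : nbhs (GL2_mx g) [set M | forall i j, P i j (M i j)] by exists P.
exact: (@initial_continuous (GL2 A) 'M[A]_2 (@GL2_mx A)).
Qed.

Lemma nbhs_GL2_vge (g : GL2 F) n :
  \forall h \near g, forall i j, vge n (GL2_mx h i j - GL2_mx g i j).
Proof. exact: (nbhs_GL2 (fun i j => nbhs_vge (GL2_mx g i j) n)). Qed.

Lemma nbhs_GL2_dge (g : GL2 dF) n :
  \forall h \near g, forall i j, dge n (GL2_mx h i j - GL2_mx g i j).
Proof. exact: (nbhs_GL2 (fun i j => nbhs_dge (GL2_mx g i j) n)). Qed.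

Lemma dge_mx_bound (M : 'M[dF]_2) : exists e, forall i j, dge e (M i j).
Proof.
have b (x : F) : vge (- `|lf_val x|) x by rewrite /vge; case: eqP => //= _; lia.
have bd (x : dF) : dge (- (`|lf_val x.1| + `|lf_val x.2|)) x.
  by apply/andP; split; apply: vgeW (b _); lia.
pose f i j := `|lf_val (M i j).1| + `|lf_val (M i j).2|.
have fE i j : f i j = `|lf_val (M i j).1| + `|lf_val (M i j).2| by [].
have f0 i j : 0 <= f i j by rewrite fE; lia.
exists (- (f 0 0 + f 0 1 + f 1 0 + f 1 1)) => i j.
apply: dgeW (bd (M i j)); rewrite -fE; have := (f0 0 0, f0 0 1, f0 1 0, f0 1 1).
clearbody f; move=> [[[h1 h2] h3] h4]; move: i j; elim/ord2_ind; elim/ord2_ind; lia.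
Qed.

(** The element is 1 + x^-1 g^-1 (h - g) x, and 1 + w M_2(O_epsilon) lies in GL_2(O_epsilon). *)
Lemma near_GL2_int (g x : GL2 dF) : exists n, forall h : GL2 dF,
  (forall i j, dge n (GL2_mx h i j - GL2_mx g i j)) ->
  GL2_int (x^-1 * g^-1 * h * x)%g.
Proof.
have [e eP] := dge_mx_bound (GL2_mx (x^-1 * g^-1)%g).
have [e' e'P] := dge_mx_bound (GL2_mx x).
(* With e and e' lower bounds for the valuations of the entries of x^-1 g^-1 and x, this precision
   makes the perturbation Y divisible by w. *)
exists (1 - e - e') => h hg.
pose Y := GL2_mx (x^-1 * g^-1)%g *m (GL2_mx h - GL2_mx g) *m GL2_mx x.
have YE : GL2_mx (x^-1 * g^-1 * h * x)%g = 1%:M + Y.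
  rewrite /Y mulmxBr mulmxBl -!GL2_mulE.
  have -> : (x^-1 * g^-1 * g * x)%g = 1%g by rewrite -(mulgA (x^-1)%g) mulVg mulg1 mulVg.
  by rewrite addrC subrK.
have vY i j : dge 1 (Y i j).
  rewrite /Y mulmx2E; apply: dgeD;
  (have -> : 1 = (e + (1 - e - e')) + e' by lia); apply: dgeM => //;
  rewrite mulmx2E; apply: dgeD; apply: dgeM => //; rewrite !mxE; exact: hg.
clearbody Y; have id1 i j : dge 0 ((1%:M : 'M[dF]_2) i j).
  by rewrite mxE; case: (i == j); [exact: dge1|exact: dge00].
split.
  move=> i j; rewrite YE mxE; apply: dgeD => //; exact: dgeW (vY i j).
have v1 i j : vge 1 (Y i j).1 by case/andP: (vY i j).
rewrite YE dual_det1 !mxE !dualE /=.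
set d := _ - _; have [] := @lf_val_near F 1 d 1 (oner_neq0 F).
- by rewrite lf_val1.
- rewrite /d [X in vge _ X](_ : _ = (Y 0 0).1 + (Y 1 1).1 + (Y 0 0).1 * (Y 1 1).1
     - (Y 0 1).1 * (Y 1 0).1); last by ring.
  apply: vgeB; [apply: vgeD; first exact: vgeD|];
  exact: vgeW (vgeM (v1 _ _) (v1 _ _)).
- by move=> _ ->; rewrite lf_val1.
Qed.

Lemma PGL2_near (A : topComUnitRingType) (x : PGL2 A) (P : set (PGL2 A)) :
  (forall g : GL2 A, P (\pi_(PGL2 A) g) -> \forall h \near g, P (\pi_(PGL2 A) h)) ->
  P x -> \forall y \near x, P y.
Proof.
move=> gP Px; apply: open_nbhs_nbhs; split => //.
by rewrite /open /= /PGL2_open openE => g Pg; exact: gP.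
Qed.

(** Smoothness of the translate by x: the conjugate x K x^-1 is a neighbourhood of 1. *)
Lemma near_translate_Keps (T : Type) (f : PGL2 dF -> T) (x y : PGL2 dF) :
  (forall k z, Keps k -> f (z * k)%g = f z) ->
  \forall z \near y, f (z * x)%g = f (y * x)%g.
Proof.
move=> fK; apply: (@PGL2_near dF y (fun z => f (z * x)%g = f (y * x)%g)) => // g <-.
elim/PGL2_ind: x => x.
have [n nP] := near_GL2_int g x.
near=> h.
have -> : (\pi_(PGL2 dF) h * \pi_(PGL2 dF) x)%g = (\pi_(PGL2 dF) g * \pi_(PGL2 dF) x *
     \pi_(PGL2 dF) (x^-1 * g^-1 * h * x)%g)%g.
  by rewrite !PGL2_mul_pi; congr (\pi_(PGL2 dF) _); rewrite !mulgA mulgK mulgV mul1g.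
apply: fK; apply: Keps_pi; apply: nP.
by near: h; exact: nbhs_GL2_dge.
Unshelve. all: by end_near. Qed.

Definition PGL2_height (x : PGL2 F) : int := height (GL2_mx (repr x)).

Lemma PGL2_heightE (g : GL2 F) : PGL2_height (\pi_(PGL2 F) g) = height g.
Proof.
rewrite /PGL2_height; have [z uz ->] := PGL2_repr g.
by rewrite heightZ ?GL2_det_neq0 // -unitfE.
Qed.

Lemma near_PGL2_height (x : PGL2 F) : \forall y \near x, PGL2_height y = PGL2_height x.
Proof.
apply: (@PGL2_near F x (fun y => PGL2_height y = PGL2_height x)) => // g <-.
(* The lift to dual numbers lets the statements about [GL2_int] serve for G too. *)
have [n nP] := near_GL2_int (dual_lift g) 1%g.
near=> h; rewrite !PGL2_heightE.
have hg : GL2_int (1^-1 * (dual_lift g)^-1 * dual_lift h * 1)%g.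
  apply: nP => i j; rewrite /= !lift_mxE /dge /= subrr vge0 andbT.
  by move: i j; near: h; exact: nbhs_GL2_vge.
have := height_mul_int (dual_lift g) hg.
rewrite invg1 mul1g mulg1 mulgA mulgV mul1g.
by rewrite /= !red_lift.
Unshelve. all: by end_near. Qed.

Lemma compact_height_bounded (D : set (PGL2 F)) : compact D ->
  exists M : nat, forall x, D x -> (absz (PGL2_height x) <= M)%N.
Proof.
move=> /compact_near_coveringP /(_ nat \oo (fun M x => (absz (PGL2_height x) <= M)%N) _).
case.
  move=> x Dx.
  exists ([set y | PGL2_height y = PGL2_height x], [set M | (absz (PGL2_height x) <= M)%N]).
    split; first exact: near_PGL2_height.
    by exists (absz (PGL2_height x)).
  by move=> [y M] [/= -> h].
by move=> M _ h; exists M => x Dx; apply: (h M) => /=.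
Qed.

End Neighbourhoods.

(** * Sets of bounded height are covered by U times a compact set *)

Section Compactness.
Variable F : nonArchLocalFieldType.
Variable w : F.
Hypothesis w_gen : generates_max_ideal w.

Lemma ultra_finite_cover (T : Type) (I : eqType) (U : set_system T) (s : seq I)
    (S : I -> set T) : UltraFilter U ->
  U [set t | exists2 b, b \in s & S b t] -> exists2 b, b \in s & U (S b).
Proof.
move=> UU; elim: s => [|b s IH] h.
  by have [t [b]] := filter_ex h; rewrite in_nil.
have [Sb|SbC] := in_ultra_setVsetC (S b) UU; first by exists b; rewrite ?mem_head.
have [|c cs Uc] := IH; last by exists c => //; rewrite in_cons cs orbT.
apply: filterS (filterI h SbC) => t [[c]]; rewrite in_cons => /orP[/eqP ->|cs] Sc nSb //.
by exists c.
Qed.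

(** Finiteness of O/wO: at each step the ultrafilter selects one residue class, the next w-adic
    digit of f. *)
Lemma ultra_approx (T : Type) (U : set_system T) (f : T -> F) : UltraFilter U ->
  U [set t | vge 0 (f t)] ->
  forall n : nat, exists a, U [set t | vge n%:Z (f t - a)].
Proof.
move=> UU U0; elim=> [|n [a Ua]].
  by exists 0; apply: filterS U0 => t /=; rewrite subr0.
have : U [set t | exists2 b, b \in residue_reps F & vge n.+1%:Z (f t - (a + w ^ n%:Z * b))].
  apply: filterS Ua => t /= h.
  have wn0 := uniformizer_exp_neq0 w_gen n%:Z.
  have fE : f t - a = w ^ n%:Z * ((w ^ n%:Z)^-1 * (f t - a)) by rewrite mulVKf.
  have : vge 0 ((w ^ n%:Z)^-1 * (f t - a)).
    by move: h; rewrite {1}fE vge_shift // subrr.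
  move=> /residue_reps_surj[b bs hb]; exists b => //.
  rewrite opprD addrA fE -mulrBr vge_shift //.
  by have -> : n.+1%:Z - n%:Z = 1 by lia.
by move=> /ultra_finite_cover[] // b _ Ub; exists (a + w ^ n%:Z * b).
Qed.

(** Compactness of O in a form that applies to each entry of a matrix: the image of U under f is
    Cauchy, and F is complete. *)
Lemma ultra_limit (T : Type) (U : set_system T) (f : T -> F) : UltraFilter U ->
  U [set t | vge 0 (f t)] ->
  exists l, forall n : int, U [set t | vge n (f t - l)].
Proof.
move=> UU U0; pose G : set_system F := [set A | U [set t | A (f t)]].
have GP : ProperFilter G.
  have GF : Filter G.
    split; first exact: filterT.
      by move=> A B; exact: filterI.
    by move=> A B AB; apply: filterS => t; exact: AB.
  by apply: Build_ProperFilter_ex => A GA;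
    have [t At] := filter_ex (GA : U [set t | A (f t)]); exists (f t).
have Gc : cauchy G.
  move=> E; rewrite lf_entourageE => -[n _ nE].
  have [a Ua] := ultra_approx UU U0 (absz n).
  exists ([set y | vge n (y - a)], [set y | vge n (y - a)]) => /=.
    by split; apply: filterS Ua => t /=; apply: (@vgeW _ _ (absz n)%:Z); lia.
  move=> [y z] [/= hy hz]; apply: nE => /=.
  have [->|yz] := eqVneq y z; [by left|right].
  rewrite -vgeE ?subr_eq0 // (_ : y - z = (y - a) - (z - a)); last by ring.
  exact: vgeB.
have [l Gl] := lf_complete G GP Gc; exists l => n.
have := Gl _ (nbhs_vge l n); exact.
Qed.

(** The bound on v(det) prevents limits of integral matrices from becoming singular. *)
Definition integral_GL2 (M : nat) : set (GL2 F) :=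
  [set g | (forall i j, vge 0 (GL2_mx g i j)) /\ lf_val (\det (GL2_mx g)) <= M%:Z].

Lemma compact_integral_GL2 M : compact (integral_GL2 M).
Proof.
rewrite compact_ultra => U UU UM.
have lim i j : exists l, forall n : int, U [set g : GL2 F | vge n (GL2_mx g i j - l)].
  by apply: ultra_limit; apply: filterS UM => g [gI _]; exact: gI.
pose l : 'M[F]_2 := \matrix_(i, j) projT1 (cid (lim i j)).
have lP i j (n : int) : U [set g : GL2 F | vge n (GL2_mx g i j - l i j)].
  by rewrite mxE; case: cid.
have lPP (n : 'I_2 -> 'I_2 -> int) :
    U [set g : GL2 F | forall i j, vge (n i j) (GL2_mx g i j - l i j)].
  apply: filterS (filterI (filterI (lP 0 0 (n 0 0)) (lP 0 1 (n 0 1)))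
    (filterI (lP 1 0 (n 1 0)) (lP 1 1 (n 1 1)))) => g [[h1 h2] [h3 h4]].
  by elim/ord2_ind; elim/ord2_ind.
(* An approximation modulo w^(M+1) is finer than v(det g) <= M, so det l inherits the valuation of
   det g. *)
have [g [[gI gM] gl]] := filter_ex (filterI UM (lPP (fun _ _ => M.+1%:Z))).
have lI i j : vge 0 (l i j).
  rewrite -(subKr (GL2_mx g i j) (l i j)); apply: vgeB => //.
  exact: vgeW (gl i j).
have [dl0 vl] : \det l != 0 /\ lf_val (\det l) = lf_val (\det (GL2_mx g)).
  apply: (@lf_val_near _ _ _ M.+1%:Z); rewrite ?GL2_det_neq0 //.
  rewrite !det2.
  rewrite (_ : _ - _ = - ((GL2_mx g 0 0 - l 0 0) * GL2_mx g 1 1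
    + l 0 0 * (GL2_mx g 1 1 - l 1 1)
    - ((GL2_mx g 0 1 - l 0 1) * GL2_mx g 1 0 + l 0 1 * (GL2_mx g 1 0 - l 1 0)))); last by ring.
  by rewrite vgeN; apply: vgeB; apply: vgeD; (apply: vge0M_l + apply: vge0M_r).
have ul : \det l \is a GRing.unit by rewrite unitfE.
exists (GL2_of ul); split.
  by split => //=; rewrite vl.
move=> W; rewrite nbhsE => -[V [[B oB BV] Vl] VW]; move: Vl VW; rewrite -BV => Bl VW.
have : nbhs l B by apply: open_nbhs_nbhs.
move=> [P Pl PB].
have nP i j : {n | forall y, vge n (y - l i j) -> P i j y}.
  by apply: cid; apply: nbhs_vgeP; exact: Pl.
apply: filterS (lPP (fun i j => projT1 (nP i j))) => h hl; apply: VW; apply: PB => i j.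
by have := hl i j; case: (nP i j) => n /= nPi; exact: nPi.
Qed.

Lemma continuous_PGL2_pi (A : topComUnitRingType) :
  continuous (fun g : GL2 A => \pi_(PGL2 A) g).
Proof. by apply/continuousP => U oU. Qed.

Lemma compact_height_cover (M : nat) : exists2 D : set (PGL2 F), compact D &
  [set x | (absz (PGL2_height x) <= M)%N] `<=` [set (u * d)%g | u in @unip F & d in D].
Proof.
exists ((fun g : GL2 F => \pi_(PGL2 F) g) @` integral_GL2 M).
  apply: continuous_compact; last exact: compact_integral_GL2.
  by apply: continuous_subspaceT; exact: continuous_PGL2_pi.
elim/PGL2_ind => g /=; rewrite PGL2_heightE => hM.
have [u [k [uu kI] ->]] := factor_unip w_gen g.
have [kI1 vk] := GL2_int_red kI; rewrite /= red_lift in kI1 vk.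
set n := height g in hM *.
exists u => //; exists (tmx (w ^ (- n))%R * \pi_(PGL2 F) k)%g; last by rewrite mulgA.
have wn0 := uniformizer_exp_neq0 w_gen.
(* For n <= 0 the matrix diag(w^-n, 1) is integral; for n > 0 its scalar multiple diag(1, w^n) is
   taken. *)
have tI : exists t : GL2 F, [/\ tmx (w ^ (- n)) = \pi_(PGL2 F) t,
    forall i j, vge 0 (GL2_mx t i j) & lf_val (\det (GL2_mx t)) <= M%:Z].
  have [n0|n0] := leP n 0.
    exists (GL2_of (tmx_unit (wn0 (- n)))); split; first exact: tmxE.
      by elim/ord2_ind; elim/ord2_ind; rewrite /= mx2E ?vge0 ?vge1 // vge_exp //; lia.
    by rewrite /= det2 !mx2E mulr1 mul0r subr0 lf_val_exp //; lia.
  have ut : \det (mx2 1 0 0 (w ^ n) : 'M[F]_2) \is a GRing.unit.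
    by rewrite det2 !mx2E mul1r mul0r subr0 unitfE.
  exists (GL2_of ut); split.
  - rewrite (tmxE (tmx_unit (wn0 (- n)))); apply: (@PGL2_scaleP F _ _ (w ^ (- n))).
      by rewrite unitfE.
    apply: matrix2P; rewrite [RHS]mxE /= !mx2E ?mulr0 ?mulr1 //.
    by rewrite -expfzDr ?uniformizer_neq0 // addNr expr0z.
  - by elim/ord2_ind; elim/ord2_ind; rewrite /= mx2E ?vge0 ?vge1 // vge_exp //; lia.
  - by rewrite /= det2 !mx2E mul1r mul0r subr0 lf_val_exp //; lia.
have [t [-> tI1 vt]] := tI.
rewrite PGL2_mul_pi; exists (t * k)%g => //; split.
  by move=> i j; rewrite GL2_mulE mulmx2E; apply: vgeD; exact: vge0M.
by rewrite GL2_mulE lf_val_detM ?GL2_det_neq0 // vk addr0.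
Qed.

End Compactness.

(* Failing unification problems must not unfold these to matrix computations. *)
#[local] Opaque PGL2_mul inG one_eps tmx.

Section SphericalVectors.
Variables (R : realType) (F : nonArchLocalFieldType).
Local Notation C := R[i].
Local Notation dF := (dual F).
Local Notation G := (PGL2 F).
Local Notation Geps := (PGL2 dF).
Variable w : F.
Hypothesis w_gen : generates_max_ideal w.
Variable psi0 : F -> C.
Hypothesis psi0_char : additive_character psi0.
Hypothesis psi0_cond : conductor_integers psi0.
Implicit Types (a b : int -> C) (f : Geps -> C).

(** Since sequences are indexed by [int], this includes vanishing at negative indices. *)
Definition fin_supp a := exists M : nat, forall n, a n != 0 -> 0 <= n <= M%:Z.

Lemma fin_supp_neg a n : fin_supp a -> n < 0 -> a n = 0.
Proof.
move=> [M aM] n0; apply/eqP; apply: contraTT n0 => /aM /andP[n0 _].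
by rewrite -leNgt.
Qed.

Lemma actM g h f : act (g * h)%g f = act g (act h f).
Proof. by apply/funext => x; rewrite /act mulgA. Qed.

Lemma act1 f : act 1%g f = f.
Proof. by apply/funext => x; rewrite /act mulg1. Qed.

Lemma PGL2_height_unip (u x : G) : unip u -> PGL2_height (u * x)%g = PGL2_height x.
Proof.
move=> [t _ <-]; elim/PGL2_ind: x => g.
rewrite (pglE (unip_unit _)) PGL2_mul_pi !PGL2_heightE.
have e : \det (mx2 1 t 0 1 *m GL2_mx g) = \det (GL2_mx g).
  by rewrite det_mulmx [\det (mx2 _ _ _ _)]det2 !mx2E mulr1 mulr0 subr0 mul1r.
rewrite /height /bottom_val GL2_mulE /= [\det _]e !mulmx2E !mx2E.
by rewrite !mul0r !add0r !mul1r.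
Qed.

(** Stated for translates, which need not be K-invariant, because linearity and invariance of the
    inner product are applied to them. *)
Lemma V_act_radial a g : fin_supp a -> V_m1 psi0 (act g (radial psi0 a)).
Proof.
move=> aS; split.
- move=> x; apply: near_translate_Keps => k z kK.
  by apply: (radialK psi0_char psi0_cond) => // n; exact: fin_supp_neg.
- move=> m x tm; rewrite /act -mulgA (radial_one_eps psi0_char) psi_m0E.
  by [].
- by move=> u x uu; rewrite /act inGM -mulgA (radial_unip psi0 a _ uu).
- have [M aM] := aS.
  elim/PGL2_ind: g => g.
  have [B hB] := height_mul_bounded (red_neq0 g).
  have [D cD DP] := compact_height_cover w_gen (M + B).
  exists D => // x /= ax; apply: DP => /=; move: ax; elim/PGL2_ind: x => x.
  rewrite /act inG_pi PGL2_mul_pi radialE mulf_eq0 negb_or => /andP[_ /aM].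
  rewrite GL2_mulE red_mul /= red_lift PGL2_heightE.
  have := hB _ (GL2_det_neq0 x).
  by move: (height (GL2_mx x)) (height _) => n1 n2; lia.
Qed.

Lemma V_radial a : fin_supp a -> V_m1_Keps psi0 (radial psi0 a).
Proof.
move=> aS; split; first by rewrite -(act1 (radial _ _)); exact: V_act_radial.
move=> k kK; apply/funext => x.
by apply: (radialK psi0_char psi0_cond) => // n; exact: fin_supp_neg.
Qed.

Lemma V_linear (c : C) f1 f2 : V_m1 psi0 f1 -> V_m1 psi0 f2 ->
  V_m1 psi0 (fun x => c * f1 x + f2 x).
Proof.
move=> [s1 e1 u1 [D1 c1 d1]] [s2 e2 u2 [D2 c2 d2]]; split.
- by move=> g; apply: filterS2 (s1 g) (s2 g) => h -> ->.
- move=> m g tm; rewrite (congr2 (fun p q => c * p + q) (e1 m g tm) (e2 m g tm)).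
  by rewrite mulrDr mulrCA.
- by move=> u g uu; exact: (congr2 (fun p q => c * p + q) (u1 _ g uu) (u2 _ g uu)).
- exists (D1 `|` D2); first exact: compactU.
  move=> g /= h; have [f1g|/d1] := eqVneq (f1 (inG g)) 0; last first.
    by move=> [u uu [d Dd ug]]; exists u => //; exists d => //; left.
  have /d2 : f2 (inG g) != 0 by move: h; rewrite f1g mulr0 add0r.
  by move=> [u uu [d Dd ug]]; exists u => //; exists d => //; right.
Qed.

Lemma V0 : V_m1 psi0 (fun=> 0).
Proof.
split.
- by move=> g; near=> h.
- by move=> *; rewrite mulr0.
- by [].
- by exists set0; [exact: compact0|move=> g /=; rewrite eqxx].
Unshelve. all: by end_near. Qed.

Lemma V_sum (I : Type) (s : seq I) (c : C) (fs : I -> Geps -> C) :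
  (forall i, V_m1 psi0 (fs i)) -> V_m1 psi0 (fun x => c * \sum_(i <- s) fs i x).
Proof.
move=> Vf; elim: s => [|i s IH].
  by rewrite (_ : (fun _ => _) = fun=> 0); [exact: V0|apply/funext => x; rewrite big_nil mulr0].
rewrite (_ : (fun _ => _) = fun x => c * fs i x + c * \sum_(i <- s) fs i x).
  exact: V_linear.
by apply/funext => x; rewrite big_cons mulrDr.
Qed.

(** The upper bound comes from the support: height is invariant under U and locally constant, hence
    bounded on a set that is compact modulo U. *)
Lemma fin_supp_profile f : V_m1_Keps psi0 f -> fin_supp (profile w f).
Proof.
move=> fV; have [[_ _ _ [D cD DP]] _] := fV.
have [M MP] := compact_height_bounded cD.
exists M => n fn; apply/andP; split.
  rewrite leNgt; apply: contraNN fn => n0; apply/eqP.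
  by apply: (profile_neg w_gen psi0_cond (V_equivariant fV)).
have [u uu [d Dd ud]] := DP _ fn.
have := MP _ Dd; rewrite -(PGL2_height_unip d uu) ud.
rewrite (tmxE (tmx_unit (uniformizer_exp_neq0 w_gen _))) PGL2_heightE height_tmx //.
by rewrite opprK; lia.
Qed.

Lemma radial_linear c a b :
  radial psi0 (fun n => c * a n + b n) = fun x => c * radial psi0 a x + radial psi0 b x.
Proof. by apply/funext => x; rewrite /radial mulrDr mulrCA. Qed.

Definition delta (m n : int) : C := (n == m)%:R.

Lemma fin_supp_delta m : 0 <= m -> fin_supp (delta m).
Proof.
move=> m0; exists (absz m) => n; rewrite /delta; case: (n =P m) => [->|_]; last by rewrite eqxx.
by lia.
Qed.

Hypothesis F_char : 2%N \notin [pchar F].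

Lemma V_eq_radial f : V_m1_Keps psi0 f -> f = radial psi0 (profile w f).
Proof.
move=> fV.
exact: (equivariant_radial F_char w_gen psi0_char psi0_cond (V_equivariant fV)).
Qed.

Lemma spherical_f0P f : spherical_f0 psi0 w f <-> f = radial psi0 (delta 0).
Proof.
split=> [[fV f1 ft]|->].
  rewrite (V_eq_radial fV); congr radial; apply/funext => n.
  rewrite /profile /delta; case: (n =P 0) => [->|/eqP n0].
    rewrite oppr0 expr0z -f1; congr f.
    have u1 : \det (mx2 1 0 0 1 : 'M[F]_2) \is a GRing.unit by exact: unip_unit.
    rewrite (tmxE u1) -inG1; congr inG; apply: eq_PGL2.
    by apply: matrix2P; rewrite /= !mxE.
  by apply: ft; rewrite oppr_eq0.
split.
- by apply: V_radial; exact: fin_supp_delta.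
- by rewrite radial_one // /delta eqxx.
- by move=> r r0; rewrite radial_tmx // /delta oppr_eq0 (negbTE r0).
Qed.

End SphericalVectors.

(** * The Hecke operator *)

Section Cosets.
Variable F : nonArchLocalFieldType.
Local Notation dF := (dual F).
Local Notation Geps := (PGL2 dF).
Local Notation K := (@Keps F).
Variable w : F.
Hypothesis w_gen : generates_max_ideal w.

Lemma lcoset_mulK (x k : Geps) : K k -> lcoset_set K (x * k)%g = lcoset_set K x.
Proof.
move=> kK; apply/seteqP; split=> _ [h hK <-].
  by exists (k * h)%g; [exact: Keps_mul|rewrite mulgA].
exists (k^-1 * h)%g; first by apply: Keps_mul => //; exact: Keps_inv.
by rewrite mulgA mulgK.
Qed.

Lemma lcoset_refl (x : Geps) : lcoset_set K x x.
Proof. by exists 1%g; [exact: Keps_one|rewrite mulg1]. Qed.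

Lemma lcoset_eqP (g h : GL2 dF) :
  lcoset_set K (\pi_(PGL2 dF) g) = lcoset_set K (\pi_(PGL2 dF) h) ->
  exists z, exists2 k : GL2 dF, GL2_int k & forall i j, GL2_mx h i j =
    z * (GL2_mx g i 0 * GL2_mx k 0 j + GL2_mx g i 1 * GL2_mx k 1 j).
Proof.
move=> gh; have := lcoset_refl (\pi_(PGL2 dF) h); rewrite -gh => -[k /KepsP[k' kI ->]].
rewrite PGL2_mul_pi => /esym/PGL2_eqP[z _ hE].
by exists z, k' => // i j; rewrite hE mxE GL2_mulE mulmx2E.
Qed.

Lemma lcoset_pi_mul (g h k : GL2 dF) : GL2_int k -> GL2_mx h = GL2_mx g *m GL2_mx k ->
  lcoset_set K (\pi_(PGL2 dF) h) = lcoset_set K (\pi_(PGL2 dF) g).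
Proof.
move=> kI hgk.
have e : \pi_(PGL2 dF) h = (\pi_(PGL2 dF) g * \pi_(PGL2 dF) k)%g.
  by rewrite PGL2_mul_pi; exact: eq_PGL2.
exact: (etrans (congr1 (lcoset_set K) e) (lcoset_mulK _ (Keps_pi kI))).
Qed.

Let w0 : w != 0. Proof. exact: uniformizer_neq0. Qed.
Let vw : lf_val w = 1. Proof. exact: lf_val_uniformizer. Qed.

Lemma upper_unit (x : dF) : \det (mx2 ((w, 0) : dF) x 0 1) \is a GRing.unit.
Proof. by rewrite dual_unitE dual_det1 !mx2E /= mulr1 mulr0 subr0. Qed.

Lemma lower_unit (y : F) : \det (mx2 (1 : dF) 0 (0, y) (w, 0)) \is a GRing.unit.
Proof. by rewrite dual_unitE dual_det1 !mx2E /= mul1r mul0r subr0. Qed.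

Definition upper_rep (x : dF) : GL2 dF := GL2_of (upper_unit x).
Definition lower_rep (y : F) : GL2 dF := GL2_of (lower_unit y).

Lemma upper_repE x : GL2_mx (upper_rep x) = mx2 ((w, 0) : dF) x 0 1.
Proof. by []. Qed.
Lemma lower_repE y : GL2_mx (lower_rep y) = mx2 (1 : dF) 0 (0, y) (w, 0).
Proof. by []. Qed.

Local Notation upper x := (\pi_(PGL2 dF) (upper_rep x)).
Local Notation lower y := (\pi_(PGL2 dF) (lower_rep y)).

Lemma dge_wM (z : dF) : dge 0 z -> dge 1 (((w, 0) : dF) * z).
Proof.
move=> h; have := @dgeM F 1 0 ((w, 0) : dF) z; rewrite addr0; apply => //.
by rewrite dge_pair vge0 andbT vgeE // vw.
Qed.

(** Comparing bottom rows in upper(x') = z upper(x) k shows that z = k_11^-1 is integral; the upper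
    right entry then gives x' - x = w z k_01. *)
Lemma upper_lcoset_eq x x' : lcoset_set K (upper x) = lcoset_set K (upper x') ->
  dge 1 (x' - x).
Proof.
move=> /lcoset_eqP[z [k [kI vk] zk]].
have := (zk 0 1, zk 1 0, zk 1 1); rewrite !upper_repE !mx2E => -[[e01 e10] e11].
rewrite !mul0r !mul1r !add0r in e10 e11.
have z1 : z.1 * (GL2_mx k 1 1).1 = 1 by have /(congr1 fst) := e11.
have k10 : (GL2_mx k 1 0).1 = 0.
  have /(congr1 fst) /= /esym/eqP := e10; rewrite mulf_eq0 => /orP[/eqP z0|/eqP //].
  by move: z1; rewrite z0 mul0r => /eqP; rewrite eq_sym oner_eq0.
have k11 : (GL2_mx k 1 1).1 != 0.
  by apply: contra_eq_neq z1 => ->; rewrite mulr0 eq_sym oner_neq0.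
have k00 : (GL2_mx k 0 0).1 != 0.
  have := GL2_dual_det_neq0 k; rewrite dual_det1 k10 mulr0 subr0.
  by rewrite mulf_eq0 negb_or => /andP[].
have zE : z = (GL2_mx k 1 1)^-1.
  by rewrite -[LHS]mulr1 -[X in _ * X](@mulrV _ (GL2_mx k 1 1)) ?dual_unitE // mulrA -e11 mul1r.
have vk11 : lf_val (GL2_mx k 1 1).1 = 0.
  move: vk; rewrite dual_det1 k10 mulr0 subr0 lf_valM // => vk.
  have /andP[+ _] := kI 0 0; have /andP[+ _] := kI 1 1; rewrite !vgeE //.
  by move: (lf_val _) (lf_val _) vk => *; lia.
have zI : dge 0 z by rewrite zE; apply: dge_inv.
have -> : x' - x = ((w, 0) : dF) * (z * GL2_mx k 0 1).
  rewrite e01 mulrDr [z * (x * _)]mulrCA -e11 mulr1 addrK mulrCA; congr (_ * _).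
apply: dge_wM; rewrite -[0%R]addr0; exact: dgeM.
Qed.

Lemma lower_lcoset_eq y y' : lcoset_set K (lower y) = lcoset_set K (lower y') ->
  vge 1 (y' - y).
Proof.
move=> /lcoset_eqP[z [k [kI vk] zk]].
have := (zk 0 0, zk 0 1, zk 1 0); rewrite !lower_repE !mx2E => -[[e00 e01] e10].
rewrite !mul0r !mul1r !addr0 in e00 e01.
have z1 : z.1 * (GL2_mx k 0 0).1 = 1 by have /(congr1 fst) := e00.
have k01 : (GL2_mx k 0 1).1 = 0.
  have /(congr1 fst) /= /esym/eqP := e01; rewrite mulf_eq0 => /orP[/eqP z0|/eqP //].
  by move: z1; rewrite z0 mul0r => /eqP; rewrite eq_sym oner_eq0.
have k00 : (GL2_mx k 0 0).1 != 0.
  by apply: contra_eq_neq z1 => ->; rewrite mulr0 eq_sym oner_neq0.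
have k11 : (GL2_mx k 1 1).1 != 0.
  have := GL2_dual_det_neq0 k; rewrite dual_det1 k01 mul0r subr0.
  by rewrite mulf_eq0 negb_or => /andP[].
have zE : z = (GL2_mx k 0 0)^-1.
  by rewrite -[LHS]mulr1 -[X in _ * X](@mulrV _ (GL2_mx k 0 0)) ?dual_unitE // mulrA -e00 mul1r.
have vk00 : lf_val (GL2_mx k 0 0).1 = 0.
  move: vk; rewrite dual_det1 k01 mul0r subr0 lf_valM // => vk.
  have /andP[+ _] := kI 0 0; have /andP[+ _] := kI 1 1; rewrite !vgeE //.
  by move: (lf_val _) (lf_val _) vk => *; lia.
have zI : dge 0 z by rewrite zE; apply: dge_inv.
have /andP[_] : dge 1 ((0, y' - y) : dF).
  have -> : (0, y' - y) = ((w, 0) : dF) * (z * GL2_mx k 1 0) :> dF.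
    have -> : (0, y' - y) = (0, y') - (0, y) :> dF by rewrite dualE /= subr0.
    rewrite e10 mulrDr [z * (_ * GL2_mx k 0 0)]mulrCA -e00 mulr1 addrC addKr; exact: mulrCA.
  apply: dge_wM; rewrite -[0%R]addr0; exact: dgeM.
by [].
Qed.

(** The reduction of k would be upper triangular with unit diagonal, and the two diagonal entries
    would force v(z) = -1 and v(z) = 1. *)
Lemma upper_lower_lcoset_neq x y :
  lcoset_set K (upper x) <> lcoset_set K (lower y).
Proof.
move=> /lcoset_eqP[z [k [kI vk] zk]].
have /(congr1 fst) := zk 0 0; have /(congr1 fst) := zk 1 0; have /(congr1 fst) := zk 1 1.
rewrite !upper_repE !lower_repE !mx2E !dualE /= !mul0r !mul1r !add0r => e11 e10 e00.
have z0 : z.1 != 0.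
  by apply: contra_eq_neq e11 => ->; rewrite mul0r.
have k10 : (GL2_mx k 1 0).1 = 0.
  by move/esym/eqP: e10; rewrite mulf_eq0 (negbTE z0) => /eqP.
rewrite k10 mulr0 addr0 in e00.
have := GL2_dual_det_neq0 k; rewrite dual_det1 k10 mulr0 subr0.
rewrite mulf_eq0 negb_or => /andP[k00 k11].
move: vk; rewrite dual_det1 k10 mulr0 subr0 lf_valM // => vk.
have v00 : lf_val z.1 + (1 + lf_val (GL2_mx k 0 0).1) = 0.
  have : lf_val (z.1 * (w * (GL2_mx k 0 0).1)) = 0 by rewrite -e00 lf_val1.
  by rewrite !lf_valM ?mulf_neq0 // vw.
have v11 : lf_val z.1 + lf_val (GL2_mx k 1 1).1 = 1.
  have : lf_val (z.1 * (GL2_mx k 1 1).1) = 1 by rewrite -e11.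
  by rewrite lf_valM.
have /andP[+ _] := kI 0 0; have /andP[+ _] := kI 1 1; rewrite !vgeE //.
move: (lf_val z.1) v00 v11 => n; move: (lf_val _) (lf_val _) vk => *; lia.
Qed.

(** The cosets correspond to the projective line over the dual numbers of the residue field: q^2
    affine points, and q points reducing to infinity, whose parameter is epsilon y. *)
Definition hecke_reps : seq Geps :=
  [seq upper ((x0, x1) : dF) | x0 <- residue_reps F, x1 <- residue_reps F] ++
  [seq lower y | y <- residue_reps F].

Lemma uniq_hecke_lcosets : uniq [seq lcoset_set K g | g <- hecke_reps].
Proof.
have upper_inj x0 x1 x0' x1' : x0 \in residue_reps F -> x1 \in residue_reps F ->
    x0' \in residue_reps F -> x1' \in residue_reps F ->
    lcoset_set K (upper ((x0, x1) : dF)) = lcoset_set K (upper ((x0', x1') : dF)) ->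
    (x0, x1) = (x0', x1').
  move=> h0 h1 h0' h1' /upper_lcoset_eq /andP[/= d0 d1].
  by congr pair; apply/esym; apply: residue_reps_inj.
rewrite map_cat cat_uniq; apply/and3P; split.
- rewrite map_allpairs allpairs_uniq ?uniq_residue_reps //.
  move=> [x0 x1] [x0' x1'] /allpairsP[[a0 a1] [/= h0 h1 [-> ->]]].
  move=> /allpairsP[[b0 b1] [/= h0' h1' [-> ->]]]; exact: upper_inj.
- apply/hasPn => _ /mapP[_ /mapP[y _ ->] ->]; apply/negP => /mapP[_ /allpairsP[[x0 x1] [/= _ _ ->]]].
  by move=> /esym; exact: upper_lower_lcoset_neq.
- rewrite -map_comp map_inj_in_uniq ?uniq_residue_reps // => y y' hy hy' /lower_lcoset_eq h.
  by apply/esym; apply: residue_reps_inj.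
Qed.

End Cosets.

Section HeckeCosets.
Variable F : nonArchLocalFieldType.
Local Notation dF := (dual F).
Local Notation Geps := (PGL2 dF).
Local Notation K := (@Keps F).
Variable w : F.
Hypothesis w_gen : generates_max_ideal w.
Local Notation upper x := (\pi_(PGL2 dF) (upper_rep w_gen x)).
Local Notation lower y := (\pi_(PGL2 dF) (lower_rep w_gen y)).

Let w0 : w != 0. Proof. exact: uniformizer_neq0. Qed.
Let vw : lf_val w = 1. Proof. exact: lf_val_uniformizer. Qed.

Let uw : \det (mx2 w 0 0 1 : 'M[F]_2) \is a GRing.unit.
Proof. exact: tmx_unit. Qed.

Lemma inG_tmxw : inG (tmx w) = \pi_(PGL2 dF) (dual_lift (GL2_of uw)).
Proof. by rewrite (tmxE uw) inG_pi. Qed.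

Definition tw := dual_lift (GL2_of uw).

Lemma twE : GL2_mx tw = mx2 ((w, 0) : dF) 0 0 1.
Proof. by apply: matrix2P; rewrite dual_lift_E /= !mx2E. Qed.

Lemma GL2_int_of (M : 'M[dF]_2) : (forall i j, dge 0 (M i j)) ->
  (\det M).1 != 0 -> lf_val (\det M).1 = 0 -> exists2 k : GL2 dF, GL2_int k & GL2_mx k = M.
Proof.
move=> MI M0 vM; have u : \det M \is a GRing.unit by rewrite dual_unitE.
by exists (GL2_of u).
Qed.

(** Solve k t_w = upper(X) k' for k'. Its only entry that could fail to be integral is w^-1 (k_01 -
    X k_11), and X is chosen congruent to k_01 / k_11 modulo w. *)
Lemma lcoset_upper (k : GL2 dF) : GL2_int k -> vge 0 (GL2_mx k 1 1).1^-1 -> (GL2_mx k 1 1).1 != 0 ->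
  exists x0 x1, [/\ x0 \in residue_reps F, x1 \in residue_reps F &
   lcoset_set K (\pi_(PGL2 dF) (k * tw)%g) = lcoset_set K (upper ((x0, x1) : dF))].
Proof.
move=> [kI vk] vd d0.
have d0' : GL2_mx k 1 1 \is a GRing.unit by rewrite dual_unitE.
have vd0 : lf_val (GL2_mx k 1 1).1 = 0.
  by apply: vge_unit => //; case/andP: (kI 1 1).
set x := GL2_mx k 0 1 / GL2_mx k 1 1.
have xI : dge 0 x by rewrite /x -[0%R]addr0; apply: dgeM => //; exact: dge_inv.
have /andP[/residue_reps_surj[x0 x0r h0] /residue_reps_surj[x1 x1r h1]] := xI.
exists x0, x1; split => //; pose X := (x0, x1) : dF.
have xX : dge 1 (x - X) by apply/andP.
pose e : dF := ((w^-1, 0) : dF) * (GL2_mx k 0 1 - X * GL2_mx k 1 1).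
have we : ((w, 0) : dF) * e = GL2_mx k 0 1 - X * GL2_mx k 1 1.
  rewrite /e mulrA (_ : ((w, 0) : dF) * (w^-1, 0) = 1) ?mul1r //.
  by apply: dual_eqP; rewrite !dualE /= ?mulfV // mulr0 mul0r addr0.
have eI : dge 0 e.
  have -> : e = ((w^-1, 0) : dF) * ((x - X) * GL2_mx k 1 1).
    by rewrite mulrBl /x divrK.
  apply: (@dgeW _ _ (-1 + (1 + 0))) => //.
  apply: dgeM; last exact: dgeM.
  by rewrite dge_pair vge0 andbT vgeE ?invr_neq0 // lf_valV // vw.
have [|||k' k'I k'E] := @GL2_int_of (mx2 (GL2_mx k 0 0 - X * GL2_mx k 1 0) e
    (((w, 0) : dF) * GL2_mx k 1 0) (GL2_mx k 1 1)).
- have XI : dge 0 X by rewrite dge_pair !residue_reps_int.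
  have m0 (a b : dF) : dge 0 a -> dge 0 b -> dge 0 (a * b).
    by move=> ha hb; rewrite -[0%R]addr0; exact: dgeM.
  elim/ord2_ind; elim/ord2_ind; rewrite mx2E //.
    by apply: dgeD => //; rewrite dgeN m0.
  by apply: dgeW (dge_wM w_gen (kI 1 0)).
- have -> : \det (mx2 (GL2_mx k 0 0 - X * GL2_mx k 1 0) e
    (((w, 0) : dF) * GL2_mx k 1 0) (GL2_mx k 1 1)) = \det (GL2_mx k).
    by rewrite !det2 !mx2E [e * _]mulrA [e * _]mulrC we; ring.
  exact: GL2_dual_det_neq0.
- have -> : \det (mx2 (GL2_mx k 0 0 - X * GL2_mx k 1 0) e
    (((w, 0) : dF) * GL2_mx k 1 0) (GL2_mx k 1 1)) = \det (GL2_mx k).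
    by rewrite !det2 !mx2E [e * _]mulrA [e * _]mulrC we; ring.
  exact: vk.
apply: (lcoset_pi_mul k'I); rewrite GL2_mulE twE upper_repE k'E.
apply: eq_mulmx2; elim/ord2_ind; elim/ord2_ind; rewrite !mx2E ?we ?/X ?/Y; by ring.
Qed.

(** The other chart: k_11 is not a unit, so k_01 is one. The entry w^-1 (k_11 - epsilon y k_01) of
    k' is integral because w divides the reduction of k_11 and y is congruent to the quotient of the
    epsilon part of k_11 by the reduction of k_01. *)
Lemma lcoset_lower (k : GL2 dF) : GL2_int k -> vge 1 (GL2_mx k 1 1).1 ->
  exists2 y, y \in residue_reps F &
   lcoset_set K (\pi_(PGL2 dF) (k * tw)%g) = lcoset_set K (lower y).
Proof.
move=> [kI vk] vd.
have kI1 i j : vge 0 (GL2_mx k i j).1 by case/andP: (kI i j).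
have kI2 i j : vge 0 (GL2_mx k i j).2 by case/andP: (kI i j).
pose b1 := (GL2_mx k 0 1).1.
have [b0 vb] : b1 != 0 /\ lf_val b1 = 0.
  have h : ~~ vge 1 (\det (GL2_mx k)).1.
    by rewrite vgeE ?GL2_dual_det_neq0 // vk.
  have hb : ~~ vge 1 b1.
    apply: contraNN h => hb; rewrite dual_det1; apply: vgeB.
      exact: vge0M_l.
    exact: vge0M_r.
  have b0 : b1 != 0 by apply: contraNneq hb => ->; exact: vge0.
  split => //; move: hb (kI1 0 1); rewrite -/b1 !vgeE //.
  by move: (lf_val b1) => n; lia.
have : vge 0 ((GL2_mx k 1 1).2 / b1).
  by apply: vge0M => //; rewrite vgeE ?invr_neq0 // lf_valV // vb.
move=> /residue_reps_surj[y yr hy]; exists y => //.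
pose Y : dF := (0, y).
pose e : dF := ((w^-1, 0) : dF) * (GL2_mx k 1 1 - Y * GL2_mx k 0 1).
have we : ((w, 0) : dF) * e = GL2_mx k 1 1 - Y * GL2_mx k 0 1.
  rewrite /e mulrA (_ : ((w, 0) : dF) * (w^-1, 0) = 1) ?mul1r //.
  by apply: dual_eqP; rewrite !dualE /= ?mulfV // mulr0 mul0r addr0.
have eI : dge 0 e.
  apply: (@dgeW _ _ (-1 + 1)) => //.
  apply: dgeM.
    by rewrite dge_pair vge0 andbT vgeE ?invr_neq0 // lf_valV // vw.
  apply/andP; rewrite !dualE /= !mul0r subr0 add0r; split => //.
  have -> : (GL2_mx k 1 1).2 - y * (GL2_mx k 0 1).1 = ((GL2_mx k 1 1).2 / b1 - y) * b1.
    by rewrite mulrBl divfK.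
  exact: (vge0M_r hy (kI1 0 1)).
have detE : \det (mx2 (((w, 0) : dF) * GL2_mx k 0 0) (GL2_mx k 0 1)
    (GL2_mx k 1 0 - Y * GL2_mx k 0 0) e) = \det (GL2_mx k).
  by rewrite !det2 !mx2E mulrAC we; ring.
have [|||k' k'I k'E] := @GL2_int_of (mx2 (((w, 0) : dF) * GL2_mx k 0 0) (GL2_mx k 0 1)
    (GL2_mx k 1 0 - Y * GL2_mx k 0 0) e).
- have YI : dge 0 Y by rewrite dge_pair vge0 residue_reps_int.
  have m0 (a b : dF) : dge 0 a -> dge 0 b -> dge 0 (a * b).
    by move=> ha hb; rewrite -[0%R]addr0; exact: dgeM.
  elim/ord2_ind; elim/ord2_ind; rewrite mx2E //.
    by apply: dgeW (dge_wM w_gen (kI 0 0)).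
  by apply: dgeD => //; rewrite dgeN m0.
- by rewrite detE; exact: GL2_dual_det_neq0.
- by rewrite detE.
apply: (lcoset_pi_mul k'I); rewrite GL2_mulE twE lower_repE k'E.
apply: eq_mulmx2; elim/ord2_ind; elim/ord2_ind; rewrite !mx2E ?we ?/X ?/Y; by ring.
Qed.

Lemma hecke_cosets_pi (k : GL2 dF) : GL2_int k ->
  hecke_cosets w (lcoset_set K (\pi_(PGL2 dF) (k * tw)%g)).
Proof.
move=> kI; exists (\pi_(PGL2 dF) k * inG (tmx w) * 1)%g.
  exists (\pi_(PGL2 dF) k); first exact: Keps_pi.
  by exists 1%g => //; exact: Keps_one.
by rewrite mulg1 inG_tmxw PGL2_mul_pi.
Qed.

Lemma upper_hecke_coset x : dge 0 x -> hecke_cosets w (lcoset_set K (upper x)).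
Proof.
move=> xI; have [|||k kI kE] := @GL2_int_of (mx2 1 x 0 1).
- elim/ord2_ind; elim/ord2_ind; rewrite mx2E //; [exact: dge1|exact: dge00|exact: dge1].
- by rewrite dual_det1 !mx2E /= mulr1 mulr0 subr0 oner_neq0.
- by rewrite dual_det1 !mx2E /= mulr1 mulr0 subr0 lf_val1.
have -> : upper x = \pi_(PGL2 dF) (k * tw)%g.
  apply: eq_PGL2; rewrite GL2_mulE kE twE upper_repE.
  by apply: matrix2P; rewrite !mulmx2E !mx2E; ring.
exact: hecke_cosets_pi.
Qed.

Lemma lower_hecke_coset y : vge 0 y -> hecke_cosets w (lcoset_set K (lower y)).
Proof.
move=> yI; have [|||k kI kE] := @GL2_int_of (mx2 0 1 1 ((0, y) : dF)).
- elim/ord2_ind; elim/ord2_ind; rewrite mx2E; [exact: dge00|exact: dge1|exact: dge1|].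
  by rewrite dge_pair vge0.
- by rewrite dual_det1 !mx2E /= mulr1 mul0r sub0r oppr_eq0 oner_neq0.
- by rewrite dual_det1 !mx2E /= mulr1 mul0r sub0r lf_valN lf_val1.
have [|||s sI sE] := @GL2_int_of (mx2 0 1 1 0).
- by elim/ord2_ind; elim/ord2_ind; rewrite mx2E; [exact: dge00|exact: dge1|exact: dge1|exact: dge00].
- by rewrite dual_det1 !mx2E /= mulr1 mul0r sub0r oppr_eq0 oner_neq0.
- by rewrite dual_det1 !mx2E /= mulr1 mul0r sub0r lf_valN lf_val1.
(* lower(y) = k t_w s, where the Weyl element s swaps the columns. *)
have -> : lcoset_set K (lower y) = lcoset_set K (\pi_(PGL2 dF) (k * tw)%g).
  apply: (lcoset_pi_mul sI); rewrite GL2_mulE kE twE lower_repE sE.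
  by apply: matrix2P; rewrite !mulmx2E !mx2E; ring.
exact: hecke_cosets_pi.
Qed.

Lemma hecke_cosetsE :
  hecke_cosets w = [set` [seq lcoset_set K g | g <- hecke_reps w_gen]].
Proof.
apply/seteqP; split=> X.
  move=> [_ [_ /KepsP[k kI ->]] [k' k'K <-] <-].
  rewrite lcoset_mulK // inG_tmxw PGL2_mul_pi /=.
  (* The two charts of the projective line, according to whether k_11 is a unit. *)
  have [/andP[d0 vd]|] := boolP (((GL2_mx k 1 1).1 != 0) && vge 0 (GL2_mx k 1 1).1^-1).
    have [x0 [x1 [h0 h1 ->]]] := lcoset_upper kI vd d0.
    by apply: map_f; rewrite mem_cat; apply/orP; left; apply/allpairsP; exists (x0, x1).
  rewrite negb_and negbK => h.
  have vd : vge 1 (GL2_mx k 1 1).1.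
    move: h; have [->|d0] := eqVneq (GL2_mx k 1 1).1 0; first by rewrite vge0.
    have /andP[+ _] := kI.1 1 1.
    by rewrite /= !vgeE ?invr_neq0 // lf_valV //; move: (lf_val _) => n; lia.
  have [y yr ->] := lcoset_lower kI vd.
  by apply: map_f; rewrite mem_cat; apply/orP; right; apply: map_f.
move=> /= /mapP[g]; rewrite mem_cat => /orP[/allpairsP[[x0 x1] [/= h0 h1 ->]]|/mapP[y yr ->]] ->.
  by apply: upper_hecke_coset; rewrite dge_pair !residue_reps_int.
by apply: lower_hecke_coset; exact: residue_reps_int.
Qed.

End HeckeCosets.

Section Hecke.
Variables (R : realType) (F : nonArchLocalFieldType).
Local Notation C := R[i].
Local Notation dF := (dual F).
Local Notation G := (PGL2 F).
Local Notation Geps := (PGL2 dF).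
Local Notation K := (@Keps F).
Variable w : F.
Hypothesis w_gen : generates_max_ideal w.
Variable psi0 : F -> C.
Hypothesis psi0_char : additive_character psi0.
Hypothesis psi0_cond : conductor_integers psi0.
Implicit Types (a b : int -> C) (f : Geps -> C).
Local Notation q := (residue_card F).
Local Notation K_invariant f := (forall k z, K k -> f (z * k)%g = f z).

Let w0 : w != 0. Proof. exact: uniformizer_neq0. Qed.

Lemma lcoset_xget f (x g : Geps) : K_invariant f ->
  f (x * xget 1 (lcoset_set K g))%g = f (x * g)%g.
Proof.
move=> fK; have : lcoset_set K g (xget 1%g (lcoset_set K g)).
  by apply: (@xgetPex _ 1%g); exists g; exact: lcoset_refl.
by move=> [k kK <-]; rewrite mulgA; exact: fK.
Qed.

Lemma T0E f x : K_invariant f ->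
  T0 w f x = q%:R^-1 * \sum_(g <- hecke_reps w_gen) f (x * g)%g.
Proof.
move=> fK; rewrite /T0 (hecke_cosetsE w_gen) -fsbig_seq ?uniq_hecke_lcosets // big_map.
by congr (_ * _); apply: eq_bigr => g _; exact: lcoset_xget.
Qed.

(** Reindexing the sum in T0 along this bijection yields the K-invariance of T0 f. *)
Lemma hecke_cosets_translate (k : Geps) : K k ->
  set_bij (hecke_cosets w) (hecke_cosets w) (fun X => [set (k * y)%g | y in X]).
Proof.
have tr (l g : Geps) : [set (l * y)%g | y in lcoset_set K g] = lcoset_set K (l * g)%g.
  apply/seteqP; split=> z [h].
    by move=> [h' h'K <-] <-; exists h' => //; exact/esym/mulgA.
  by move=> hK <-; exists (g * h)%g; [exists h|exact: mulgA].
have st (l : Geps) : K l -> set_fun (hecke_cosets w) (hecke_cosets w)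
    (fun X => [set (l * y)%g | y in X]).
  move=> lK _ [_ [k1 k1K [k2 k2K <-]] <-]; rewrite tr.
  exists (l * (k1 * inG (tmx w) * k2))%g => //.
  exists (l * k1)%g; first exact: Keps_mul.
  by exists k2 => //; rewrite !mulgA.
have imK (l : Geps) (X : set Geps) : [set (l^-1 * y)%g | y in [set (l * y)%g | y in X]] = X.
  apply/seteqP; split=> [_ [_ [z Xz <-] <-]|z Xz]; first by rewrite mulKg.
  by exists (l * z)%g; [exists z|rewrite mulKg].
move=> kK; split; first exact: st.
  by move=> X Y _ _ XY; rewrite -[X](imK k) -[Y](imK k) XY.
move=> X XS; exists [set (k^-1 * y)%g | y in X]; first by apply: st => //; exact: Keps_inv.
by have := imK (k^-1)%g X; rewrite invgK.
Qed.

Lemma T0_K f : K_invariant f -> K_invariant (T0 w f).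
Proof.
move=> fK k x kK; rewrite /T0; congr (_ * _).
apply: (etrans _ (esym (reindex_fsbig _ _ _
  (fun Y => act (xget 1%g Y) f x) (hecke_cosets_translate kK)))).
apply: eq_fsbigr => X; rewrite inE => -[g _ <-]; rewrite /act lcoset_xget //.
have -> : [set (k * y)%g | y in lcoset_set K g] = lcoset_set K (k * g)%g.
  apply/seteqP; split=> z [h].
    by move=> [h' h'K <-] <-; exists h' => //; exact/esym/mulgA.
  by move=> hK <-; exists (g * h)%g; [exists h|exact: mulgA].
by rewrite lcoset_xget // mulgA.
Qed.

Lemma radial_K_invariant a : fin_supp a -> K_invariant (radial psi0 a).
Proof.
move=> aS k z kK; apply: (radialK psi0_char psi0_cond) => // n.
exact: fin_supp_neg.
Qed.

Lemma T0_equivariant a : fin_supp a -> equivariant psi0 (T0 w (radial psi0 a)).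
Proof.
move=> aS; have aK := radial_K_invariant aS; split.
- move=> m g tm; apply: (etrans (T0E _ aK)).
  rewrite (T0E (inG g) aK) mulrCA; congr (_ * _).
  rewrite mulr_sumr; apply: eq_bigr => h _.
  exact: (etrans (congr1 _ (esym (mulgA _ _ _))) (radial_one_eps psi0_char _ _ _)).
- move=> u g uu; apply: (etrans (T0E _ aK)); apply: (etrans _ (esym (T0E _ aK))).
  apply: (congr1 (fun s => q%:R^-1 * s)); apply: eq_bigr => h _.
  apply: (etrans _ (radial_unip psi0 a _ uu)).
  by apply: (congr1 (radial psi0 a)); rewrite inGM mulgA.
- exact: T0_K.
Qed.

Local Notation upper x := (\pi_(PGL2 dF) (upper_rep w_gen x)).
Local Notation lower y := (\pi_(PGL2 dF) (lower_rep w_gen y)).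

Lemma GL2_tmx_mul (t : F) (u : \det (mx2 t 0 0 1 : 'M[F]_2) \is a GRing.unit) (g : GL2 dF) :
  GL2_mx (dual_lift (GL2_of u) * g)%g =
  mx2 (((t, 0) : dF) * GL2_mx g 0 0) (((t, 0) : dF) * GL2_mx g 0 1)
      (GL2_mx g 1 0) (GL2_mx g 1 1).
Proof.
rewrite GL2_mulE; apply: matrix2P; rewrite mulmx2E !dual_lift_E /= !mx2E;
  by apply: dual_eqP; rewrite !dualE /=; ring.
Qed.

(** The bottom row is (0, 1), so the slope is 0 and only the determinant gains a factor w. *)
Lemma radial_upper a n x :
  radial psi0 a (inG (tmx (w ^ (- n))%R) * upper x)%g = a (n - 1).
Proof.
have wn0 : w ^ (- n) != 0 by exact: uniformizer_exp_neq0.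
rewrite (tmxE (tmx_unit wn0)) inG_pi PGL2_mul_pi radialE GL2_tmx_mul.
rewrite upper_repE !mx2E.
set M := mx2 _ _ _ _.
have dM : (\det M).1 = w ^ (- n) * w.
  by rewrite dual_det1 !mx2E !dualE /= mulr1 !mulr0 subr0.
have -> : slope M = 0 by rewrite /slope !mx2E /= mul0r mulr0 subrr mul0r.
rewrite psi0_0 // mul1r.
congr a; rewrite /height det_red dM /bottom_val !redE !mx2E /= /row_val eqxx lf_val1.
by rewrite lf_valM // lf_val_exp // lf_val_uniformizer //; lia.
Qed.

(** The bottom row is (epsilon y, w): the slope w^n y is integral as n >= 0, and the height gains 2
    - 1. *)
Lemma radial_lower a n y : 0 <= n -> vge 0 y ->
  radial psi0 a (inG (tmx (w ^ (- n))%R) * lower y)%g = a (n + 1).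
Proof.
move=> n0 yI; have wn0 : w ^ (- n) != 0 by exact: uniformizer_exp_neq0.
rewrite (tmxE (tmx_unit wn0)) inG_pi PGL2_mul_pi radialE GL2_tmx_mul.
rewrite lower_repE !mx2E.
set M := mx2 _ _ _ _.
have dM : (\det M).1 = w ^ (- n) * w.
  by rewrite dual_det1 !mx2E !dualE /= mulr1 !mulr0 subr0.
have -> : slope M = w ^ n * y.
  rewrite /slope dM !mx2E /= mul0r subr0.
  have := uniformizer_exp_neq0 w_gen n; rewrite -invr_expz => wn.
  by field; rewrite wn w0.
rewrite psi0_int ?vge_shift ?sub0r // ?mul1r; last by apply: vgeW yI; lia.
congr a; rewrite /height det_red dM /bottom_val !redE !mx2E /= /row_val eqxx.
by rewrite lf_valM // lf_val_exp // lf_val_uniformizer //; lia.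
Qed.

(** The q^2 upper and the q lower representatives contribute equal terms each, and T0 divides by q.
    At n < 0 the value vanishes by [profile_neg]. *)
Lemma profile_T0 a n : fin_supp a ->
  profile w (T0 w (radial psi0 a)) n =
  if 0 <= n then q%:R * a (n - 1) + a (n + 1) else 0.
Proof.
move=> aS; case: ifP => n0; last first.
  apply: (profile_neg w_gen psi0_cond (T0_equivariant aS)).
  by rewrite ltNge n0.
have q0 : (q%:R : C) != 0 by rewrite pnatr_eq0 -lt0n residue_card_gt0.
rewrite /profile (T0E _ (radial_K_invariant aS)) /hecke_reps big_cat big_allpairs_dep /=.
rewrite (eq_bigr (fun=> q%:R * a (n - 1))); last first.
  move=> x0 _; rewrite (eq_bigr (fun=> a (n - 1))); last by move=> x1 _; exact: radial_upper.
  by rewrite big_const_seq count_predT iter_addr_0 -size_residue_reps mulr_natl.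
rewrite [X in _ * (_ + X)](eq_big_seq (fun=> a (n + 1))); last first.
  by move=> _ /mapP[y yr ->]; apply: radial_lower => //; exact: residue_reps_int.
rewrite !big_const_seq !count_predT !iter_addr_0 (size_map (fun y => lower y)) !size_residue_reps.
rewrite -[X in _ * (X + _)]mulr_natl -[X in _ * (_ + X)]mulr_natl.
by rewrite -mulrDr mulKf.
Qed.

Definition hecke_profile a : int -> C :=
  fun n => if 0 <= n then q%:R * a (n - 1) + a (n + 1) else 0.

Lemma fin_supp_hecke a : fin_supp a -> fin_supp (hecke_profile a).
Proof.
move=> aS; have [M aM] := aS; exists M.+1 => n; rewrite /hecke_profile.
case: ifP => n0; last by rewrite eqxx.
have [->|/aM h _] := eqVneq (a (n - 1)) 0; last by lia.
by rewrite mulr0 add0r => /aM; lia.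
Qed.

Lemma T0_radial (F_char : 2%N \notin [pchar F]) a : fin_supp a ->
  T0 w (radial psi0 a) = radial psi0 (hecke_profile a).
Proof.
move=> aS.
rewrite (equivariant_radial F_char w_gen psi0_char psi0_cond (T0_equivariant aS)).
by congr radial; apply/funext => n; exact: profile_T0.
Qed.

Lemma hecke_rep_double_coset g : g \in hecke_reps w_gen ->
  exists k, exists2 k', K k /\ K k' & g = (k * inG (tmx w) * k')%g.
Proof.
move=> gr; have : hecke_cosets w (lcoset_set K g).
  by rewrite (hecke_cosetsE w_gen) /=; exact: map_f.
move=> [_ [k kK [k' k'K <-]] E].
have := lcoset_refl g; rewrite -E => -[k2 k2K <-].
exists k, (k' * k2)%g; last by rewrite mulgA.
by split => //; exact: Keps_mul.
Qed.

End Hecke.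

(** * Orthogonality of the basic spherical vectors *)

Section InnerProduct.
Variables (R : realType) (F : nonArchLocalFieldType).
Local Notation C := R[i].
Local Notation dF := (dual F).
Local Notation Geps := (PGL2 dF).
Local Notation K := (@Keps F).
Hypothesis F_char : 2%N \notin [pchar F].
Variable w : F.
Hypothesis w_gen : generates_max_ideal w.
Variable psi0 : F -> C.
Hypothesis psi0_char : additive_character psi0.
Hypothesis psi0_cond : conductor_integers psi0.
Implicit Types (a b : int -> C) (f : Geps -> C).
Local Notation q := (residue_card F).
Local Notation V := (V_m1 psi0).
Local Notation VK := (V_m1_Keps psi0).

Variable ip : (Geps -> C) -> (Geps -> C) -> C.
Hypothesis ipU : unitary_structure V ip.

Lemma ip_sum (I : Type) (s : seq I) (c : C) (fs : I -> Geps -> C) f :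
  (forall i, V (fs i)) -> V f ->
  ip (fun x => c * \sum_(i <- s) fs i x) f = c * \sum_(i <- s) ip (fs i) f.
Proof.
move=> Vf f0; elim: s => [|i s IH].
  (* Linearity is given for a f1 + f2 only, so the zero function is written as -f + f. *)
  rewrite big_nil mulr0 (_ : (fun _ => _) = fun x => (-1) * f x + f x); last first.
    by apply/funext => x; rewrite big_nil mulr0 mulN1r addNr.
  by rewrite (ip_linear ipU (-1) f0 f0 f0) mulN1r addNr.
rewrite (_ : (fun _ => _) = fun x => c * fs i x + c * \sum_(j <- s) fs j x); last first.
  by apply/funext => x; rewrite big_cons mulrDr.
by rewrite (ip_linear ipU c (Vf i) (V_sum s c Vf) f0) IH big_cons mulrDr.
Qed.

Lemma V_act f g : VK f -> V (act g f).
Proof.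
move=> fV; rewrite (V_eq_radial w_gen psi0_char psi0_cond F_char fV).
exact: (V_act_radial w_gen psi0_char psi0_cond g (fin_supp_profile w_gen psi0_cond fV)).
Qed.

Lemma VK_V f : VK f -> V f. Proof. by case. Qed.

(** k' fixes f1, and since k fixes f2, invariance under k removes it from the other side.
    Consequently all cosets in T0 contribute the same amount. *)
Lemma ip_double_coset f1 f2 k g k' : VK f1 -> VK f2 -> K k -> K k' ->
  ip (act (k * g * k')%g f1) f2 = ip (act g f1) f2.
Proof.
move=> V1 V2 kK k'K; rewrite !actM (V1.2 _ k'K).
exact: (etrans (congr1 (ip _) (esym (V2.2 k kK)))
  (ip_invariant ipU k (V_act g V1) (VK_V V2))).
Qed.

Lemma T0_act f : VK f ->
  T0 w f = fun x => q%:R^-1 * \sum_(g <- hecke_reps w_gen) act g f x.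
Proof.
move=> fV; apply/funext => x; rewrite (T0E w_gen) // => k z kK.
exact: (congr1 (fun h => h z) (fV.2 k kK)).
Qed.

Lemma ip_T0 f1 f2 : VK f1 -> VK f2 -> ip (T0 w f1) f2 =
  q%:R^-1 * (size (hecke_reps w_gen))%:R * ip (act (inG (tmx w)) f1) f2.
Proof.
move=> V1 V2; rewrite (T0_act V1) (ip_sum _ _ (fun g => V_act g V1) (VK_V V2)).
rewrite -mulrA; congr (_ * _); rewrite (eq_big_seq (fun=> ip (act (inG (tmx w)) f1) f2)).
  by rewrite big_const_seq count_predT iter_addr_0 mulr_natl.
move=> g /(hecke_rep_double_coset (w_gen := w_gen))[k [k' [kK k'K] ->]].
exact: ip_double_coset.
Qed.

(** Up to a scalar the inverse is diag(1, w), which the Weyl element conjugates to t_w. *)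
Lemma inG_tmx_inv : exists2 k, K k & (inG (tmx w))^-1%g = (k * inG (tmx w) * k)%g.
Proof.
have [|||s sI sE] := @GL2_int_of F (mx2 0 1 1 0).
- by elim/ord2_ind; elim/ord2_ind; rewrite mx2E; [exact: dge00|exact: dge1|exact: dge1|exact: dge00].
- by rewrite dual_det1 !mx2E /= mulr1 mul0r sub0r oppr_eq0 oner_neq0.
- by rewrite dual_det1 !mx2E /= mulr1 mul0r sub0r lf_valN lf_val1.
exists (\pi_(PGL2 dF) s); first exact: Keps_pi.
rewrite (inG_tmxw w_gen) -/(tw w_gen) PGL2_inv_pi.
rewrite (PGL2_mul_pi s (tw w_gen)) (PGL2_mul_pi (s * tw w_gen)%g s).
have dE : \det (GL2_mx (tw w_gen)) = ((w, 0) : dF).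
  by rewrite twE det2 !mx2E; apply: dual_eqP; rewrite !dualE /=; ring.
have wu : ((w, 0) : dF) \is a GRing.unit.
  by rewrite dual_unitE /= (uniformizer_neq0 w_gen).
apply: (@PGL2_scaleP dF _ _ ((w, 0) : dF)^-1); first by rewrite unitrV.
rewrite GL2_invE dE; congr (_ *: _).
rewrite 2!GL2_mulE sE !twE; apply: matrix2P;
  rewrite !mulmx2E !mx2E; apply: dual_eqP; rewrite !dualE /=; ring.
Qed.

(** By [ip_T0] the claim reduces to moving t_w across the inner product. It becomes t_w^-1, which
    lies in the same double coset; the remaining factor is real. *)
Lemma T0_selfadjoint f1 f2 : VK f1 -> VK f2 -> ip (T0 w f1) f2 = ip f1 (T0 w f2).
Proof.
move=> V1 V2.
have VT f : VK f -> V (T0 w f).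
  by move=> fV; rewrite (T0_act fV); exact: V_sum _ _ (fun g => V_act g fV).
have [k kK tV] := inG_tmx_inv.
have e : ip f1 (act (inG (tmx w)) f2) = ip (act (inG (tmx w)) f1) f2.
  apply: (etrans (esym (ip_invariant ipU (inG (tmx w))^-1%g (VK_V V1) (V_act _ V2)))).
  rewrite -actM mulVg act1 tV; exact: (ip_double_coset _ V1 V2 kK kK).
apply: (etrans _ (esym (ip_hermitian ipU (VT _ V2) (VK_V V1)))).
rewrite (ip_T0 V1 V2) (ip_T0 V2 V1) [RHS]rmorphM /=; congr (_ * _).
  by rewrite rmorphM /= rmorph_nat fmorphV /= rmorph_nat.
apply: (etrans (esym e)); exact: (ip_hermitian ipU (V_act _ V2) (VK_V V1)).
Qed.

End InnerProduct.

Section Orthogonality.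
Variables (R : realType) (F : nonArchLocalFieldType).
Local Notation C := R[i].
Local Notation dF := (dual F).
Local Notation Geps := (PGL2 dF).
Local Notation K := (@Keps F).
Variable w : F.
Hypothesis w_gen : generates_max_ideal w.
Variable psi0 : F -> C.
Hypothesis psi0_char : additive_character psi0.
Hypothesis psi0_cond : conductor_integers psi0.
Implicit Types (a : int -> C) (f : Geps -> C).
Local Notation q := (residue_card F).
Local Notation V := (V_m1 psi0).
Local Notation VK := (V_m1_Keps psi0).

(** The sum S of a nontrivial character of O/wO: translation by some y with psi0(u y) != 1 permutes
    the classes, so S = psi0(u y) S. *)
Lemma psi0_sum (u : F) : u != 0 -> lf_val u = -1 ->
  \sum_(b <- residue_reps F) psi0 (u * b) = 0.
Proof.
move=> u0 vu; have nu : ~~ vge 0 u by rewrite vgeE // vu.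
have [y vy py] := psi0_nontrivial psi0_cond nu.
(* The representatives are not closed under addition, so b + y is replaced by the representative of
   its class. *)
have sig (b : F) : exists c, b \in residue_reps F -> c \in residue_reps F /\ vge 1 (b + y - c).
  have [br|] := boolP (b \in residue_reps F); last by exists 0.
  have /residue_reps_surj[c cr hc] : vge 0 (b + y) by apply: vgeD => //; exact: residue_reps_int.
  by exists c.
pose s b := projT1 (cid (sig b)).
have sP b : b \in residue_reps F -> s b \in residue_reps F /\ vge 1 (b + y - s b).
  by rewrite /s; case: cid.
have sinj : {in residue_reps F &, injective s}.
  move=> b b' br br' sbb; have [_ h] := sP b br; have [_ h'] := sP b' br'.
  apply: residue_reps_inj => //.
  rewrite (_ : b - b' = (b + y - s b) - (b' + y - s b')); first exact: vgeB.
  by rewrite sbb; ring.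
have perm : perm_eq [seq s b | b <- residue_reps F] (residue_reps F).
  have us : uniq [seq s b | b <- residue_reps F].
    by rewrite map_inj_in_uniq ?uniq_residue_reps.
  have sub : {subset [seq s b | b <- residue_reps F] <= residue_reps F}.
    by move=> _ /mapP[b br ->]; case: (sP b br).
  apply: uniq_perm => //; first exact: uniq_residue_reps.
  by have [] := uniq_min_size us sub; rewrite size_map.
set S := \sum_(b <- _) _.
have eS : psi0 (u * y) * S = S.
  rewrite {2}/S -(perm_big _ perm) big_map /S mulr_sumr; apply: eq_big_seq => b br.
  have [_ h] := sP b br.
  rewrite -(psi0D psi0_char).
  have -> : u * y + u * b = u * (b + y - s b) + u * s b by ring.
  rewrite (psi0D psi0_char) (psi0_int psi0_cond) ?mul1r //.
  by apply: (@vgeW _ _ (-1 + 1)) => //; apply: vgeM => //; rewrite vgeE // vu.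
apply/eqP; have /eqP : (psi0 (u * y) - 1) * S = 0 by rewrite mulrBl mul1r eS subrr.
by rewrite mulf_eq0 subr_eq0 (negbTE py).
Qed.

(* The shift of the slope of g by right translation by 1 + epsilon [[0, s], [t, 0]]. *)
Definition slope_shift (g : 'M[dF]_2) (s t : F) : F :=
  (g 1 1).1 ^+ 2 / (\det g).1 * t - (g 1 0).1 ^+ 2 / (\det g).1 * s.

Lemma radial_mul_one_eps a (g : GL2 dF) s t :
  radial psi0 a (\pi_(PGL2 dF) g * one_eps (mx2 0 s t 0))%g =
  psi0 (slope_shift g s t) * radial psi0 a (\pi_(PGL2 dF) g).
Proof.
rewrite one_epsE PGL2_mul_pi !radialE mulrA -(psi0D psi0_char).
have -> : red (g * one_eps_GL2 (mx2 0 s t 0))%g = red g.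
  by rewrite GL2_mulE red_mul red_one_eps mulmx1.
congr (psi0 _ * _); rewrite /slope /slope_shift GL2_mulE.
have -> : (\det (GL2_mx g *m one_eps_GL2 (mx2 0 s t 0))).1 = (\det (GL2_mx g)).1.
  by rewrite -!det_red red_mul red_one_eps mulmx1.
rewrite !mulmx2E !one_eps_GL2E !mx2E !dualE /=.
have D0 := GL2_dual_det_neq0 g; by field.
Qed.

Hypothesis F_char : 2%N \notin [pchar F].
Variable ip : (Geps -> C) -> (Geps -> C) -> C.
Hypothesis ipU : unitary_structure V ip.

Definition sph (n : nat) : Geps -> C := radial psi0 (delta R n%:Z).

Lemma V_sph n : VK (sph n).
Proof. by apply: (V_radial w_gen psi0_char psi0_cond); exact: fin_supp_delta. Qed.

(** The coefficients c^2 / D and d^2 / D have valuation at least 2 min(v(c), v(d)) - v(D) = n. *)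
Lemma slope_shift_int n (g : GL2 dF) s t : height (red g) = n ->
  vge (- n) s -> vge (- n) t -> vge 0 (slope_shift g s t).
Proof.
move=> hn vs vt; set c := (GL2_mx g 1 0).1; set d := (GL2_mx g 1 1).1.
set D := (\det (GL2_mx g)).1; have D0 : D != 0 := GL2_dual_det_neq0 g.
set r := row_val c d.
have hr : n = 2 * r - lf_val D.
  by rewrite -hn /height /bottom_val det_red !redE.
have /andP[hc hd] : vge r c && vge r d.
  by rewrite /r /c /d -!redE row_valP // row_neq0 ?red_neq0.
have vD : vge (- lf_val D) D^-1 by rewrite vgeE ?invr_neq0 // lf_valV.
have e : 0 = r + r - lf_val D - n by rewrite hr; move: (lf_val D); clearbody r; lia.
rewrite /slope_shift -/c -/d -/D e.
by apply: vgeB; apply: vgeM => //; apply: vgeM => //; rewrite expr2; exact: vgeM.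
Qed.

(** One step beyond w^-j, the scale at which translations still fix e_j; this scale still fixes
    every e_n with n > j. *)
Let base j := w ^ (- (j + 1)).

(** The double sum is a product of two character sums. For whichever of c, d attains the minimal
    valuation, the coefficient has valuation j - (j + 1) = -1, and that factor is 0. *)
Lemma sum_psi0_slope_shift j (g : GL2 dF) : height (red g) = j ->
  \sum_(x <- residue_reps F) \sum_(y <- residue_reps F)
     psi0 (slope_shift g (base j * x) (base j * y)) = 0.
Proof.
move=> hj; set c := (GL2_mx g 1 0).1; set d := (GL2_mx g 1 1).1.
set D := (\det (GL2_mx g)).1; have D0 : D != 0 := GL2_dual_det_neq0 g.
have b0 : base j != 0 by exact: uniformizer_exp_neq0.
have hr : j = 2 * row_val c d - lf_val D.
  by rewrite -hj /height /bottom_val det_red !redE.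
have split x y : psi0 (slope_shift g (base j * x) (base j * y)) =
    psi0 (- (c ^+ 2 / D * base j) * x) * psi0 (d ^+ 2 / D * base j * y).
  rewrite -(psi0D psi0_char) /slope_shift -/c -/d -/D; congr psi0; ring.
rewrite (eq_bigr (fun x => psi0 (- (c ^+ 2 / D * base j) * x) *
    \sum_(y <- residue_reps F) psi0 (d ^+ 2 / D * base j * y))); last first.
  by move=> x _; rewrite mulr_sumr; apply: eq_bigr => y _; exact: split.
rewrite -mulr_suml.
have val (u : F) : u != 0 -> lf_val u = row_val c d ->
    u ^+ 2 / D * base j != 0 /\ lf_val (u ^+ 2 / D * base j) = -1.
  move=> u0 vu; have u20 : u ^+ 2 != 0 by rewrite expf_neq0.
  split; first by rewrite !mulf_neq0 ?invr_neq0.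
  rewrite lf_valM ?mulf_neq0 ?invr_neq0 // lf_val_div // expr2 lf_valM //.
  rewrite lf_val_exp // vu hr; move: (row_val c d) (lf_val D); lia.
have [c0|[d0 vd]] : (c != 0 /\ lf_val c = row_val c d) \/ (d != 0 /\ lf_val d = row_val c d).
  have := row_neq0 (red_neq0 g); rewrite !redE -/c -/d /row_val.
  have [->|c0] := eqVneq c 0; first by move=> /= d0; right.
  have [->|d0] := eqVneq d 0; first by left.
  by move=> _; case: (leP (lf_val c) (lf_val d)) => h; [left|right].
- have [h1 h2] := val _ c0.1 c0.2.
  by rewrite psi0_sum ?mul0r ?oppr_eq0 ?lf_valN.
- have [h1 h2] := val _ d0 vd.
  by rewrite [X in _ * X]psi0_sum ?mulr0.
Qed.

Lemma sph_act n s t : vge (- n%:Z) s -> vge (- n%:Z) t ->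
  act (one_eps (mx2 0 s t 0)) (sph n) = sph n.
Proof.
move=> vs vt; apply/funext; elim/PGL2_ind => g; rewrite /act /sph.
apply: (etrans (radial_mul_one_eps _ _ _ _)); rewrite radialE /delta.
have [h|_] := eqVneq (height (red g)) n%:Z; last by rewrite !mulr0.
by rewrite (psi0_int psi0_cond (slope_shift_int h vs vt)) mul1r.
Qed.

Lemma sum_act_sph (j : nat) :
  (fun z => 1 * \sum_(x <- residue_reps F) \sum_(y <- residue_reps F)
     act (one_eps (mx2 0 (base j%:Z * x) (base j%:Z * y) 0)) (sph j) z) = fun=> 0.
Proof.
apply/funext; elim/PGL2_ind => g; rewrite mul1r.
under eq_bigr do under eq_bigr do rewrite /act /sph radial_mul_one_eps.
under eq_bigr do rewrite -mulr_suml.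
rewrite -mulr_suml radialE /delta.
have [h|_] := eqVneq (height (red g)) j%:Z; last by rewrite !mulr0.
by rewrite sum_psi0_slope_shift ?mul0r.
Qed.

(** The q^2 translations of [sum_act_sph] fix e_n, so each translate of e_j has the same inner
    product with e_n as e_j itself; but these translates add up to 0. *)
Lemma ip_sph_neq j n : (j < n)%N -> ip (sph j) (sph n) = 0.
Proof.
move=> jn; set L := ip _ _.
have VA g : V (act g (sph j)) := V_act F_char w_gen psi0_char psi0_cond g (V_sph j).
have ip0 : ip (fun=> 0) (sph n) = 0.
  have := ip_sum ipU [::] 1 (fun i : nat => VA 1%g) (VK_V (V_sph n)).
  rewrite big_nil mulr0 => h; apply: (etrans _ h); congr ip.
  by apply/funext => x; rewrite big_nil mulr0.
have vb x : x \in residue_reps F -> vge (- n%:Z) (base j%:Z * x).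
  by move=> xr; rewrite vge_shift //; apply: vgeW (residue_reps_int xr); lia.
have := ip0; rewrite -(sum_act_sph j).
pose fs x : Geps -> C := fun z => 1 * \sum_(y <- residue_reps F)
     act (one_eps (mx2 0 (base j%:Z * x) (base j%:Z * y) 0)) (sph j) z.
have Vfs x : V (fs x) by apply: V_sum.
have -> : (fun z => 1 * \sum_(x <- residue_reps F) \sum_(y <- residue_reps F)
     act (one_eps (mx2 0 (base j%:Z * x) (base j%:Z * y) 0)) (sph j) z) =
   fun z => 1 * \sum_(x <- residue_reps F) fs x z.
  by apply/funext => z; congr (_ * _); apply: eq_bigr => x _; rewrite /fs mul1r.
rewrite (ip_sum ipU _ _ Vfs (VK_V (V_sph n))) mul1r.
rewrite (eq_big_seq (fun=> (size (residue_reps F))%:R * L)).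
  rewrite big_const_seq count_predT iter_addr_0.
  move/eqP; rewrite mulrn_eq0 mulf_eq0 pnatr_eq0 size_residue_reps.
  by rewrite (gtn_eqF (residue_card_gt0 F)) => /eqP.
move=> x xr; rewrite /fs (ip_sum ipU _ _ (fun y => VA _) (VK_V (V_sph n))) mul1r.
rewrite (eq_big_seq (fun=> L)).
  by rewrite big_const_seq count_predT iter_addr_0 mulr_natl.
move=> y yr; have e := sph_act (vb x xr) (vb y yr).
apply: (etrans (congr1 (ip _) (esym e))).
exact: (ip_invariant ipU _ (VK_V (V_sph j)) (VK_V (V_sph n))).
Qed.

Lemma ip_sph_sym j n : j != n -> ip (sph j) (sph n) = 0.
Proof.
rewrite neq_ltn => /orP[|jn]; first exact: ip_sph_neq.
rewrite (ip_hermitian ipU (VK_V (V_sph n)) (VK_V (V_sph j))) ip_sph_neq //.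
exact: rmorph0.
Qed.

(** e_(n-1) with e_(-1) = 0, so that the recursion for T0 holds uniformly in n. *)
Definition sph_pred (n : nat) : Geps -> C := if n is m.+1 then sph m else fun=> 0.

Lemma T0_sph n : T0 w (sph n) = fun x => q%:R * sph n.+1 x + sph_pred n x.
Proof.
rewrite /sph T0_radial //; last exact: fin_supp_delta.
case: n => [|n].
  rewrite (_ : hecke_profile _ _ = fun k => q%:R * delta R 1 k + 0); last first.
    apply/funext => k; rewrite /hecke_profile /delta; case: ifP => k0.
      rewrite (_ : (k - 1 == 0) = (k == 1)); last by lia.
      by rewrite (_ : (k + 1 == 0) = false); last by lia.
    by rewrite (_ : (k == 1) = false) ?mulr0 ?addr0 //; lia.
  by rewrite radial_linear; apply/funext => x; rewrite {2}/radial mulr0.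
rewrite -radial_linear; congr radial; apply/funext => k.
rewrite /hecke_profile /delta; case: ifP => k0.
  rewrite (_ : (k - 1 == n.+1%:Z) = (k == n.+2%:Z)); last by lia.
  by rewrite (_ : (k + 1 == n.+1%:Z) = (k == n%:Z)); last by lia.
rewrite (_ : (k == n.+2%:Z) = false); last by lia.
by rewrite (_ : (k == n%:Z) = false) ?mulr0 ?addr0 //; lia.
Qed.

Lemma V_sph_pred n : V (sph_pred n).
Proof. by case: n => [|n]; [exact: V0|exact: VK_V (V_sph n)]. Qed.

Lemma ip_sph_pred n m : m != n -> ip (sph_pred n.+1) (sph m) = 0.
Proof. by move=> mn; rewrite ip_sph_sym // eq_sym. Qed.

(** q <e_(n+1), e_(n+1)> = <T0 e_n, e_(n+1)> = <e_n, T0 e_(n+1)> = <e_n, e_n>, by the recursion and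
    orthogonality. *)
Lemma ip_sph_norm n : ip (sph 0) (sph 0) = 1 ->
  ip (sph n) (sph n) = (q%:R^-1) ^+ n.
Proof.
move=> h0; have q0 : (q%:R : C) != 0 by rewrite pnatr_eq0 -lt0n residue_card_gt0.
have V' k : V (sph k) := VK_V (V_sph k).
have ip0 k : ip (sph_pred 0) (sph k) = 0.
  have := ip_sum ipU [::] 1 (fun i : nat => V' 0%N) (V' k).
  rewrite big_nil mulr0 => h; apply: (etrans _ h); congr ip.
  by apply/funext => x; rewrite big_nil mulr0.
elim: n => [|n IH]; first by rewrite h0 expr0.
have e1 : ip (T0 w (sph n)) (sph n.+1) = q%:R * ip (sph n.+1) (sph n.+1).
  rewrite T0_sph (ip_linear ipU _ (V' _) (V_sph_pred _) (V' _)).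
  case: n {IH} => [|n]; first by rewrite ip0 addr0.
  by rewrite ip_sph_pred ?addr0 //; lia.
have e2 : ip (T0 w (sph n.+1)) (sph n) = ip (sph n) (sph n).
  rewrite T0_sph (ip_linear ipU _ (V' _) (V_sph_pred _) (V' _)) /=.
  by rewrite ip_sph_sym ?mulr0 ?add0r //; lia.
have VT : V (T0 w (sph n.+1)).
  by rewrite T0_sph; exact: (V_linear q%:R (V' n.+2) (V_sph_pred n.+1)).
have : q%:R * ip (sph n.+1) (sph n.+1) = ip (sph n) (sph n).
  rewrite -e1 (T0_selfadjoint F_char w_gen psi0_char psi0_cond ipU (V_sph _) (V_sph _)).
  rewrite (ip_hermitian ipU VT (V' n)) e2; exact: esym (ip_hermitian ipU (V' n) (V' n)).
by rewrite IH exprS => <-; rewrite mulKf.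
Qed.

End Orthogonality.

(** * Orthogonal polynomials of the semicircle measure *)

Section SemicircleDensity.
Variables (R : realType) (q : nat).
Local Notation lambda := (@lebesgue_measure R).
Local Notation mu := (@semicircle_measure R q).
Local Notation w := (@semicircle_density R q).
Local Notation TR := (measurableTypeR R).

Let w0 x : 0 <= w x. Proof. exact: semicircle_density_ge0. Qed.
Let mw : measurable_fun setT w. Proof. exact: semicircle_density_measurable. Qed.

(** The first case in passing from indicators to simple, nonnegative and finally signed
    functions. *)
Let integral_indic_density (E : set TR) : measurable E ->
  (\int[mu]_x (\1_E x)%:E = \int[lambda]_x (\1_E x * w x)%:E)%E.
Proof.
move=> mE; rewrite integral_indic//= setIT /semicircle_measure.
rewrite integral_mkcond; apply: eq_integral => x _; rewrite patchE indicE.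
by case: ifPn => _; rewrite ?mul1r ?mul0r.
Qed.

Import HBNNSimple.

Let integral_nnsfun_density (f : {nnsfun TR >-> R}) :
  (\int[mu]_x (f x)%:E = \int[lambda]_x (f x * w x)%:E)%E.
Proof.
under [LHS]eq_integral do rewrite fimfunE -fsumEFin//.
rewrite [LHS]ge0_integral_fsum//; last 2 first.
  - by move=> r; exact/measurable_EFinP/measurableT_comp.
  - by move=> n x _; rewrite EFinM nnfun_muleindic_ge0.
under [RHS]eq_integral.
  move=> x xD; rewrite EFinM fimfunE -fsumEFin// ge0_mule_fsuml; last first.
    by move=> r; rewrite EFinM nnfun_muleindic_ge0.
  over.
rewrite [RHS]ge0_integral_fsum//; last 2 first.
  - move=> r; apply: emeasurable_funM; last exact/measurable_EFinP.
    by apply/measurable_EFinP; do 2 apply/measurableT_comp => //.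
  - by move=> n x _; rewrite mule_ge0 ?lee_fin //; have := nnfun_muleindic_ge0 f n x; rewrite -EFinM lee_fin.
apply: eq_fsbigr => r _.
rewrite integralZl_indic_nnsfun//= integral_indic_density//.
transitivity (\int[lambda]_x (r%:E * (\1_(f @^-1` [set r]) x * w x)%:E))%E; last first.
  by apply: eq_integral => x _; rewrite -EFinM mulrA.
have [r0|r0] := leP 0 r.
  rewrite ge0_integralZl//.
  - by apply/measurable_EFinP/measurable_funM => //.
  - by move=> x _; rewrite lee_fin mulr_ge0.
(* For r < 0 the product with r is not monotone, but a nonnegative f never takes this value. *)
have -> : f @^-1` [set r] = set0.
  apply/seteqP; split => x //= fx; have : 0 <= f x by exact: fun_ge0.
  by rewrite fx leNgt r0.
rewrite indic0 (eq_integral (cst 0%E)); last by move=> x _; rewrite /= mul0r.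
by rewrite [RHS](eq_integral (cst 0%E)) ?integral0 ?mule0// => x _; rewrite /= mul0r mule0.
Qed.

Let ge0_integral_density (f : TR -> R) :
  measurable_fun setT f -> (forall x, 0 <= f x) ->
  (\int[mu]_x (f x)%:E = \int[lambda]_x (f x * w x)%:E)%E.
Proof.
move=> mf f0; have mfE : measurable_fun setT (EFin \o f) by exact/measurable_EFinP.
pose f_ := nnsfun_approx measurableT mfE.
have fE0 x : (0 <= (EFin \o f) x)%E by rewrite lee_fin.
transitivity (lim (\int[mu]_x (f_ n x)%:E @[n --> \oo])%E).
  rewrite -monotone_convergence//=.
  - apply: eq_integral => ? /[!inE] xD; apply/esym/cvg_lim => //=.
    by apply: (cvg_nnsfun_approx measurableT mfE).
  - by move=> n; exact/measurable_EFinP/measurable_funTS.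
  - by move=> n ? _; rewrite lee_fin.
  - by move=> ? _ ? ? mn; rewrite lee_fin; exact/lefP/nd_nnsfun_approx.
transitivity (lim (\int[lambda]_x (f_ n x * w x)%:E @[n --> \oo])%E).
  by apply: congr_lim; apply/funext => n /=; exact: integral_nnsfun_density.
rewrite -monotone_convergence//=.
- apply: eq_integral => x _; apply/cvg_lim => //=.
  rewrite EFinM; under eq_fun do rewrite EFinM.
  by apply: cvgeZr => //; exact: (cvg_nnsfun_approx measurableT mfE).
- by move=> n; apply/measurable_EFinP/measurable_funM => //; exact: measurable_funTS.
- by move=> n ? _; rewrite lee_fin mulr_ge0.
- move=> x _ ? ? mn; rewrite lee_fin ler_wpM2r//; exact/lefP/nd_nnsfun_approx.
Qed.

(** Positive and negative parts commute with multiplication by the nonnegative density, which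
    reduces the claim to the nonnegative case. *)
Lemma integral_semicircle (D : set TR) (f : TR -> R) : measurable D ->
  measurable_fun D f ->
  (\int[mu]_(x in D) (f x)%:E = \int[lambda]_(x in D) (f x * w x)%:E)%E.
Proof.
move=> mD mf.
have g0 (g : TR -> R) : measurable_fun D g -> (forall x, 0 <= g x) ->
    (\int[mu]_(x in D) (g x)%:E = \int[lambda]_(x in D) (g x * w x)%:E)%E.
  move=> mg g0; rewrite integral_mkcond [RHS]integral_mkcond.
  transitivity (\int[mu]_x ((g \_ D) x)%:E)%E.
    by apply: eq_integral => x _; rewrite !patchE; case: ifP.
  rewrite ge0_integral_density.
  - apply: eq_integral => x _; rewrite !patchE; case: ifP => //= _.
    by rewrite mul0r.
  - by apply/measurable_restrict => //; rewrite setTI.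
  - by move=> x; rewrite patchE; case: ifP.
rewrite [LHS]integralE [RHS]integralE; congr (_ - _)%E.
- transitivity (\int[mu]_(x in D) (Num.max (f x) 0)%:E)%E.
    by apply: eq_integral => x _; rewrite funeposE /= -EFin_max.
  rewrite g0.
  - apply: eq_integral => x _; rewrite funeposE /= -EFin_max; congr EFin.
    by rewrite maxr_pMl // mul0r.
  - by apply: measurable_maxr => //.
  - by move=> x; rewrite le_max lexx orbT.
- transitivity (\int[mu]_(x in D) (Num.max (- f x) 0)%:E)%E.
    by apply: eq_integral => x _; rewrite funenegE /= -?EFinN -EFin_max.
  rewrite g0.
  - apply: eq_integral => x _; rewrite funenegE /= -?EFinN -EFin_max; congr EFin.
    by rewrite -mulNr maxr_pMl // mul0r.
  - by apply: measurable_maxr => //; exact: measurableT_comp.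
  - by move=> x; rewrite le_max lexx orbT.
Qed.

End SemicircleDensity.

Section SphericalPolynomials.
Variables (R : realType) (q : nat).
Hypothesis q_gt0 : (0 < q)%N.
Local Notation lambda := (@lebesgue_measure R).
Local Notation mu := (@semicircle_measure R q).
Local Notation I := (@semicircle_itv R q).
Local Notation TR := (measurableTypeR R).

(* The pair (Q_(n-1), Q_n), where Q_(-1) = 0, Q_0 = 1 and
   x Q_n = q Q_(n+1) + Q_(n-1). *)
Fixpoint sph_poly_pair (n : nat) (x : R) : R * R :=
  if n is m.+1 then
    ((sph_poly_pair m x).2,
     (x * (sph_poly_pair m x).2 - (sph_poly_pair m x).1) / q%:R)
  else (0, 1).

Definition sph_poly n x := (sph_poly_pair n x).2.
Definition sph_poly_pred n x := (sph_poly_pair n x).1.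

Lemma sph_poly_predS n : sph_poly_pred n.+1 = sph_poly n. Proof. by []. Qed.

Let q0 : (q%:R : R) != 0. Proof. by rewrite pnatr_eq0 -lt0n. Qed.

Lemma sph_poly_rec n x :
  x * sph_poly n x = q%:R * sph_poly n.+1 x + sph_poly_pred n x.
Proof.
by rewrite {2}/sph_poly /= -/(sph_poly n x) -/(sph_poly_pred n x) [q%:R * _]mulrC divfK // subrK.
Qed.

Let continuous_sph_poly_pair n :
  continuous (sph_poly n) /\ continuous (sph_poly_pred n).
Proof.
elim: n => [|n [IH1 IH2]].
  by split=> x; rewrite /sph_poly /sph_poly_pred /=; exact: cvg_cst.
split; last by rewrite sph_poly_predS.
move=> x; rewrite /sph_poly /= -/(sph_poly n _) -/(sph_poly_pred n _).
apply: cvgM; last exact: cvg_cst.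
by apply: cvgB; [apply: cvgM; [exact: cvg_id|exact: IH1]|exact: IH2].
Qed.

Lemma continuous_sph_poly n : continuous (sph_poly n).
Proof. by case: (continuous_sph_poly_pair n). Qed.

Let r := Num.sqrt (q%:R : R).
Let r0 : 0 < r. Proof. by rewrite sqrtr_gt0 ltr0n. Qed.
Let rr : r * r = q%:R. Proof. by rewrite -expr2 sqr_sqrtr // ltW. Qed.

(* With x = 2 sqrt q cos t, the polynomial q^(n/2) Q_n is the Chebyshev
   polynomial of the second kind. *)
Lemma sph_poly_cos n t : sph_poly n (2 * r * cos t) * sin t = r ^- n * sin (n.+1%:R * t).
Proof.
suff [] : sph_poly n (2 * r * cos t) * sin t = r ^- n * sin (n.+1%:R * t) /\
  sph_poly_pred n (2 * r * cos t) * sin t * r^-1 = r ^- n * sin (n%:R * t) by [].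
elim: n => [|n [IH1 IH2]].
  by rewrite /sph_poly /sph_poly_pred /= expr0 invr1 !mul1r !mul0r sin0.
split; last first.
  by rewrite sph_poly_predS IH1 exprS invfM; ring.
have rn0 : r != 0 by rewrite gt_eqF.
have -> : sph_poly n.+1 (2 * r * cos t) * sin t =
  (2 * r * cos t * (sph_poly n (2 * r * cos t) * sin t) -
   r * (sph_poly_pred n (2 * r * cos t) * sin t * r^-1)) / (r * r).
  by rewrite {1}/sph_poly /= -/(sph_poly n _) -/(sph_poly_pred n _) -rr; field.
rewrite IH1 IH2 exprS.
have -> : n.+2%:R * t = n.+1%:R * t + t by rewrite -(natr1 n.+1) mulrDl mul1r.
have -> : n%:R * t = n.+1%:R * t - t by rewrite -(natr1 n) mulrDl mul1r addrK.
rewrite sinB sinD; field; by rewrite rn0 expf_neq0.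
Qed.

Let c := 2 * r.
Let F (t : R) : R := c * cos t.
Let c0 : 0 < c. Proof. by rewrite mulr_gt0. Qed.

Let dF t : is_derive t (1 : R) F (- c * sin t).
Proof.
rewrite /F; apply: is_derive_eq.
by rewrite /GRing.scale /= mulNr mulrN.
Qed.

Let F' : derive1 F = fun t => - c * sin t.
Proof. by apply/funext => t; rewrite derive1E; case: (dF t). Qed.

Let cF' : continuous (fun t : R => - c * sin t).
Proof. by move=> t; apply: cvgM; [exact: cvg_cst|exact: continuous_sin]. Qed.

Let cF : continuous F.
Proof. by move=> t; apply: cvgM; [exact: cvg_cst|exact: continuous_cos]. Qed.

(** The substitution x = c cos t is decreasing, so 0 and pi go to the upper and the lower end, and
    the sign of the derivative disappears. *)
Lemma semicircle_subst (G : R -> R) : continuous G ->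
  (\int[lambda]_(x in I) (G x)%:E =
   \int[lambda]_(t in `[0%R, pi]) (G (c * cos t) * (c * sin t))%:E)%E.
Proof.
move=> cG.
have Fpi : F pi = - c by rewrite /F cospi mulrN1.
have F0 : F 0 = c by rewrite /F cos0 mulr1.
have -> : I = `[F pi, F 0]%classic by rewrite Fpi F0.
rewrite (@integration_by_substitution_decreasing _ F G 0 pi) ?pi_ge0 //.
- apply: eq_integral => t _; rewrite F'; congr EFin.
  by change (G (F t) * - (- c * sin t) = G (c * cos t) * (c * sin t)); rewrite mulNr opprK.
- by move=> x y xI yI xy; rewrite /F ltr_pM2l // ltr_cos.
- by rewrite F' => t _; exact: cF'.
- by rewrite F'; apply: cvgP; apply: cvg_at_right_filter; exact: cF'.
- by rewrite F'; apply: cvgP; apply: cvg_at_left_filter; exact: cF'.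
- split; first by move=> t _; exact: ex_derive.
    by apply: cvg_at_right_filter; exact: cF.
  by apply: cvg_at_left_filter; exact: cF.
- by apply: continuous_subspaceT => x; exact: cG.
Qed.

Lemma sinn_pi n : sin (n%:R * pi) = 0 :> R.
Proof.
elim: n => [|n IH]; first by rewrite mul0r sin0.
by rewrite -natr1 mulrDl mul1r sinDpi IH oppr0.
Qed.

Lemma integral_sin_sin (n m : nat) :
  (\int[lambda]_(t in `[0%R, pi]) ((2 / pi * (sin (n.+1%:R * t) * sin (m.+1%:R * t)))%R)%:E =
   (n == m)%:R%:E)%E.
Proof.
pose d : R := n%:R - m%:R; pose s : R := (n + m + 2)%:R.
have s0 : s != 0 by rewrite pnatr_eq0 addn2.
have pi0 : (pi : R) != 0 by rewrite gt_eqF // pi_gt0.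
(* From 2 sin a sin b = cos(a - b) - cos(a + b): an antiderivative of the first cosine, which is
   constantly 1 when n = m. *)
pose D (t : R) : R := if n == m then t else sin (d * t) / d.
pose A (t : R) : R := pi^-1 * (D t - sin (s * t) / s).
have dD (t : R) : is_derive t (1 : R) D (cos (d * t)).
  rewrite /D; case: eqP => [nm|/eqP nm].
    have -> : cos (d * t) = 1 by rewrite /d nm subrr mul0r cos0.
    exact: is_derive_id.
  have d0 : d != 0 by rewrite subr_eq0 eqr_nat.
  apply: is_derive_eq; rewrite /GRing.scale /=; by field.
have dA (t : R) : is_derive t (1 : R) A (2 / pi * (sin (n.+1%:R * t) * sin (m.+1%:R * t))).
  apply: is_derive_eq; rewrite /GRing.scale /=.
  have -> : d * t = n.+1%:R * t - m.+1%:R * t by rewrite /d -(natr1 n) -(natr1 m); ring.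
  have -> : s * t = n.+1%:R * t + m.+1%:R * t.
    by rewrite /s !natrD -(natr1 n) -(natr1 m); ring.
  rewrite mulr0 add0r mulr1 mulrCA mulVf // mulr1 cosB cosD; move: (pi : R) pi0 => p p0; by field.
have A' : derive1 A = fun t => 2 / pi * (sin (n.+1%:R * t) * sin (m.+1%:R * t)).
  by apply/funext => t; rewrite derive1E; case: (dA t).
have cA : continuous A.
  by move=> t; apply: differentiable_continuous; apply/derivable1_diffP; exact: ex_derive.
have cs k : continuous (fun t : R => sin (k * t)).
  move=> t; apply: continuous_comp; last exact: continuous_sin.
  by apply: cvgM; [exact: cvg_cst|exact: cvg_id].
rewrite (@continuous_FTC2 _ _ A) ?pi_gt0 //.
- have sp : sin (s * pi) = 0 by exact: sinn_pi.
  have A0 : A 0 = 0.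
    by rewrite /A /D !mulr0 sin0 !mul0r subr0; case: ifP => _; rewrite mulr0.
  rewrite A0 sube0 /A /D sp mul0r subr0; case: eqP => [nm|nm].
    by rewrite mulVf.
  by rewrite /d mulrBl sinB !sinn_pi !(mul0r, mulr0) subr0 mul0r mulr0.
- apply: continuous_subspaceT => t; apply: cvgM; first exact: cvg_cst.
  by apply: cvgM; exact: cs.
- split; first by move=> t _; exact: ex_derive.
    by apply: cvg_at_right_filter; exact: cA.
  by apply: cvg_at_left_filter; exact: cA.
- by move=> t _; rewrite A'.
Qed.

Lemma continuous_semicircle_density : continuous (@semicircle_density R q).
Proof.
move=> x; apply: cvgM; first exact: cvg_cst.
apply: (@continuous_comp _ _ _ (fun x : R => 4 * q%:R - x ^+ 2) Num.sqrt); last exact: sqrt_continuous.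
by apply: cvgB; [exact: cvg_cst|exact: exprn_continuous].
Qed.

Lemma measurable_I : measurable (I : set TR).
Proof. exact: measurable_itv. Qed.

(** Under x = 2 sqrt(q) cos t the density and the Jacobian contribute one factor sin t each, one for
    each polynomial in [sph_poly_cos]. The constant 4q / (2 pi q) = 2 / pi is the one that
    normalizes the sines. *)
Lemma integral_sph_poly n m :
  (\int[mu]_(x in I) ((sph_poly n x * sph_poly m x)%R)%:E =
   ((n == m)%:R * q%:R^-1 ^+ n)%:E)%E.
Proof.
have cQQ : continuous (fun x => sph_poly n x * sph_poly m x).
  by move=> x; apply: cvgM; exact: continuous_sph_poly.
rewrite (@integral_semicircle R q I (fun x => sph_poly n x * sph_poly m x)) //; last 2 first.
- exact: measurable_I.
- by apply: measurable_funTS; exact: continuous_measurable_fun.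
rewrite semicircle_subst; last first.
  by move=> x; apply: cvgM; [exact: cQQ|exact: continuous_semicircle_density].
have pi0 : (pi : R) != 0 by rewrite gt_eqF // pi_gt0.
have rn0 : r != 0 by rewrite gt_eqF.
transitivity (\int[lambda]_(t in `[0%R, pi]) ((r ^- (n + m))%:E *
   ((2 / pi * (sin (n.+1%:R * t) * sin (m.+1%:R * t)))%R)%:E))%E.
  apply: eq_integral => t; rewrite inE /= => tI; rewrite -EFinM; congr EFin.
  have st : 0 <= sin t by rewrite sin_ge0_pi //; move: tI; rewrite in_itv.
  have -> : semicircle_density q (c * cos t) = (2 * pi * q%:R)^-1 * (c * sin t).
    rewrite /semicircle_density; congr (_ * _).
    have -> : 4 * q%:R - (c * cos t) ^+ 2 = (c * sin t) ^+ 2.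
      by rewrite -rr /c !exprMn sin2cos2; ring.
    by rewrite sqrtr_sqr ger0_norm // mulr_ge0 // ltW.
  transitivity ((sph_poly n (2 * r * cos t) * sin t) * (sph_poly m (2 * r * cos t) * sin t)
    * (2 / pi)).
    by rewrite /c -rr; move: (pi : R) pi0 => p p0; field; rewrite rn0 p0.
  rewrite !sph_poly_cos exprD; move: (pi : R) pi0 => p p0; field; by rewrite p0 !expf_neq0.
rewrite integralZl //; last first.
  apply: continuous_compact_integrable; first exact: segment_compact.
  have cs k : continuous (fun t : R => sin (k * t)).
    move=> t; apply: continuous_comp; last exact: continuous_sin.
    by apply: cvgM; [exact: cvg_cst|exact: cvg_id].
  apply: continuous_subspaceT => t; apply: cvgM; first exact: cvg_cst.
  by apply: cvgM; exact: cs.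
rewrite integral_sin_sin -EFinM; congr EFin; case: eqP => [->|_]; last by rewrite mulr0 mul0r.
by rewrite mulr1 mul1r exprD -exprMn rr exprVn.
Qed.

End SphericalPolynomials.

(** * Orthogonal systems in pre-Hilbert spaces *)

Section PreHilbert.
Variable R : realType.
Local Notation C := R[i].
Local Notation Re := complex.Re.
Local Notation Im := complex.Im.

Lemma ReD (z z' : C) : Re (z + z') = Re z + Re z'.
Proof. by case: z z' => [a b] [c d]. Qed.
Lemma ImD (z z' : C) : Im (z + z') = Im z + Im z'.
Proof. by case: z z' => [a b] [c d]. Qed.
Lemma ReN (z : C) : Re (- z) = - Re z.
Proof. by case: z. Qed.
Lemma ImN (z : C) : Im (- z) = - Im z.
Proof. by case: z. Qed.
Lemma ReM (z z' : C) : Re (z * z') = Re z * Re z' - Im z * Im z'.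
Proof. by case: z z' => [a b] [c d]. Qed.
Lemma ImM (z z' : C) : Im (z * z') = Re z * Im z' + Im z * Re z'.
Proof. by case: z z' => [a b] [c d]. Qed.
Lemma ReJ (z : C) : Re z^* = Re z. Proof. by case: z. Qed.
Lemma ImJ (z : C) : Im z^* = - Im z. Proof. by case: z. Qed.
Definition ReImE := (ReD, ImD, ReN, ImN, ReM, ImM, ReJ, ImJ).

Lemma complex_eqP (z z' : C) : Re z = Re z' -> Im z = Im z' -> z = z'.
Proof. by case: z z' => [a b] [c d] /= -> ->. Qed.

Lemma ge0_complexE (z : C) : 0 <= z -> z = (Re z)%:C.
Proof. by move=> z0; apply: complex_eqP => //=; exact: ger0_Im. Qed.

Section Space.
Variables (V : lmodType C) (S : set V) (B : V -> V -> C).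

(** The form is only semidefinite and lives on a subset S, so that square-integrable functions,
    without passing to classes modulo null functions, fit alongside an abstract Hilbert space. *)
Record prehilbert : Prop := {
  prehilbert0 : S 0;
  prehilbert_closed : forall a u v, S u -> S v -> S (a *: u + v);
  prehilbert_linear : forall a u v x, S u -> S v -> S x ->
    B (a *: u + v) x = a * B u x + B v x;
  prehilbert_hermitian : forall u v, S u -> S v -> B v u = (B u v)^*;
  prehilbert_ge0 : forall u, S u -> 0 <= B u u }.

Definition sqnorm u : R := Re (B u u).

Definition prehilbert_complete : Prop := forall u : nat -> V, (forall n, S (u n)) ->
  (forall e : R, 0 < e -> exists N, forall m n, (N <= m)%N -> (N <= n)%N ->
     sqnorm (u m - u n) < e) ->
  exists2 l, S l & forall e : R, 0 < e -> exists N, forall n, (N <= n)%N ->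
     sqnorm (u n - l) < e.

Hypothesis BP : prehilbert.

Lemma sqnormE u : S u -> B u u = (sqnorm u)%:C.
Proof. by move=> /(prehilbert_ge0 BP)/ge0_complexE. Qed.

Lemma sqnorm_ge0 u : S u -> 0 <= sqnorm u.
Proof. by move=> Su; have := prehilbert_ge0 BP Su; rewrite sqnormE // ler0c. Qed.

Lemma prehilbertZ a u : S u -> S (a *: u).
Proof. by move=> Su; rewrite -[_ *: _]addr0; apply: prehilbert_closed => //; exact: prehilbert0. Qed.

Lemma prehilbertD u v : S u -> S v -> S (u + v).
Proof. by move=> Su Sv; rewrite -[u]scale1r; exact: prehilbert_closed. Qed.

Lemma prehilbertN u : S u -> S (- u).
Proof. by move=> Su; rewrite -scaleN1r; exact: prehilbertZ. Qed.

Lemma prehilbertB u v : S u -> S v -> S (u - v).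
Proof. by move=> Su Sv; apply: prehilbertD => //; exact: prehilbertN. Qed.

Lemma prehilbert_sum (I : Type) (r : seq I) (F : I -> V) :
  (forall i, S (F i)) -> S (\sum_(i <- r) F i).
Proof.
by move=> SF; elim/big_ind: _ => //; [exact: (prehilbert0 BP)|exact: prehilbertD].
Qed.

Lemma formDl u v x : S u -> S v -> S x -> B (u + v) x = B u x + B v x.
Proof.
by move=> *; rewrite -[X in X + v]scale1r (prehilbert_linear BP) // mul1r.
Qed.

Lemma form0l x : S x -> B 0 x = 0.
Proof.
move=> Sx; have S0 := prehilbert0 BP.
have := formDl S0 S0 Sx; rewrite addr0 => /eqP.
by rewrite -subr_eq subrr eq_sym => /eqP.
Qed.

Lemma form0r x : S x -> B x 0 = 0.
Proof.
move=> Sx; rewrite (prehilbert_hermitian BP (prehilbert0 BP) Sx) form0l //; exact: rmorph0.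
Qed.

Lemma formZl a u x : S u -> S x -> B (a *: u) x = a * B u x.
Proof.
move=> Su Sx; rewrite -[_ *: u]addr0 (prehilbert_linear BP) //; last exact: (prehilbert0 BP).
by rewrite form0l // addr0.
Qed.

Lemma formBl u v x : S u -> S v -> S x -> B (u - v) x = B u x - B v x.
Proof.
move=> Su Sv Sx; rewrite formDl //; last exact: prehilbertN.
by rewrite -scaleN1r formZl // mulN1r.
Qed.

Lemma formDr u v x : S u -> S v -> S x -> B x (u + v) = B x u + B x v.
Proof.
move=> Su Sv Sx; rewrite (prehilbert_hermitian BP (prehilbertD Su Sv) Sx) formDl //.
rewrite rmorphD /=; congr (_ + _); exact/esym/(prehilbert_hermitian BP).
Qed.

Lemma formZr a u x : S u -> S x -> B x (a *: u) = a^* * B x u.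
Proof.
move=> Su Sx; rewrite (prehilbert_hermitian BP (prehilbertZ a Su) Sx) formZl //.
by rewrite rmorphM /=; congr (_ * _); exact/esym/(prehilbert_hermitian BP).
Qed.

Lemma sqnormD u v : S u -> S v ->
  sqnorm (u + v) = sqnorm u + 2 * Re (B u v) + sqnorm v.
Proof.
move=> Su Sv; have Suv := prehilbertD Su Sv.
rewrite /sqnorm formDl // !formDr // (prehilbert_hermitian BP Su Sv) !ReImE; ring.
Qed.

Lemma sqnormZ a u : S u -> sqnorm (a *: u) = (Re a ^+ 2 + Im a ^+ 2) * sqnorm u.
Proof.
move=> Su; rewrite /sqnorm formZl ?formZr //; last exact: prehilbertZ.
by rewrite (sqnormE Su) /= !ReImE /=; ring.
Qed.

Lemma sqnormN u : S u -> sqnorm (- u) = sqnorm u.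
Proof.
by move=> Su; rewrite -scaleN1r sqnormZ //= oppr0 expr0n addr0 sqrrN expr1n mul1r.
Qed.

Lemma sqnormD_le u v : S u -> S v -> sqnorm (u + v) <= 2 * sqnorm u + 2 * sqnorm v.
Proof.
move=> Su Sv; have := sqnorm_ge0 (prehilbertB Su Sv).
rewrite !sqnormD ?sqnormN //; last exact: prehilbertN.
by rewrite -scaleN1r formZr // rmorphN1 mulN1r ReN; lra.
Qed.

(* A weak form of the Cauchy-Schwarz inequality, obtained from
   0 <= |t c u - v|^2 for c a fourth root of unity. *)
Lemma form_bound (t : R) u v : 0 < t -> S u -> S v ->
  `|Re (B u v)| <= t * sqnorm u + sqnorm v / t /\
  `|Im (B u v)| <= t * sqnorm u + sqnorm v / t.
Proof.
move=> t0 Su Sv.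
have key c : Re c ^+ 2 + Im c ^+ 2 = 1 -> - Re (c * B u v) <= t * sqnorm u + sqnorm v / t.
  move=> c1; have Scu : S ((t%:C * c) *: u) by exact: prehilbertZ.
  have := sqnorm_ge0 (prehilbertD Scu Sv).
  rewrite sqnormD // sqnormZ // formZl // -mulrA !ReImE /= !mul0r !subr0 !addr0.
  have -> : (t * Re c) ^+ 2 + (t * Im c) ^+ 2 = t ^+ 2 by rewrite !exprMn -mulrDr c1 mulr1.
  set z := Re c * Re (B u v) - Im c * Im (B u v) => h.
  have n0 := sqnorm_ge0 Su; have m0 := sqnorm_ge0 Sv.
  rewrite -(ler_pM2l t0) mulrDr mulrA (mulrC t (_ / t)) divfK ?gt_eqF // -expr2.
  nra.
have h1 : - Re (B u v) <= t * sqnorm u + sqnorm v / t.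
  by have := key 1; rewrite mul1r; apply => /=; ring.
have h2 : Re (B u v) <= t * sqnorm u + sqnorm v / t.
  by have := key (-1); rewrite mulN1r [Re (- B u v)]ReN opprK; apply => /=; ring.
have h3 : Im (B u v) <= t * sqnorm u + sqnorm v / t.
  have := key 'i; rewrite ReM /= mul0r mul1r sub0r opprK; apply; ring.
have h4 : - Im (B u v) <= t * sqnorm u + sqnorm v / t.
  have := key (- 'i); rewrite ReM /= oppr0 mul0r mulN1r sub0r opprK; apply; ring.
by rewrite !ler_norml; split; apply/andP; split; rewrite // lerNl.
Qed.

Lemma form_small v (e : R) : S v -> 0 < e -> exists2 d : R, 0 < d &
  forall u, S u -> sqnorm u < d -> `|Re (B u v)| < e /\ `|Im (B u v)| < e.
Proof.
move=> Sv e0; have n0 := sqnorm_ge0 Sv.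
(* Makes the second term of [form_bound] at most e / 2; the added 1 keeps t positive when v is
   null. *)
pose t := 2 * (sqnorm v + 1) / e.
have t0 : 0 < t by rewrite divr_gt0 // mulr_gt0 // ltr_wpDl.
exists (e / 2 / t); first by apply: divr_gt0 => //; exact: divr_gt0.
move=> u Su hu; have [h1 h2] := form_bound t0 Su Sv.
have b1 : t * sqnorm u < e / 2 by rewrite mulrC -ltr_pdivlMr.
have b2 : sqnorm v / t <= e / 2.
  have et : e / 2 * t = sqnorm v + 1 by rewrite /t; field; rewrite gt_eqF.
  by rewrite ler_pdivrMr // et lerDl.
by split; [apply: le_lt_trans h1 _|apply: le_lt_trans h2 _]; lra.
Qed.

Lemma form_null u v : S u -> S v -> sqnorm u = 0 -> B u v = 0.
Proof.
move=> Su Sv u0.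
have h (x : R) : (forall e, 0 < e -> `|x| < e) -> x = 0.
  move=> xe; apply/eqP; rewrite -normr_le0 leNgt; apply/negP => x0.
  by have := xe _ x0; rewrite ltxx.
apply: complex_eqP; apply: h => e e0; have [d d0 /(_ u Su)] := form_small Sv e0;
  by rewrite u0 => /(_ d0)[].
Qed.

Variables (x : nat -> V) (nu : nat -> R).
Hypothesis Sx : forall n, S (x n).
Hypothesis nu_gt0 : forall n, 0 < nu n.
Hypothesis x_orth : forall n m, B (x n) (x m) = ((n == m)%:R * nu n)%:C.
Implicit Types c : nat -> C.

(** The c n are prescribed inner products with the x n, hence the division by the square norms. *)
Definition osum c N : V := \sum_(n < N) (c n / (nu n)%:C) *: x n.

Definition oterm c n : R := (Re (c n) ^+ 2 + Im (c n) ^+ 2) / nu n.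

Lemma osumS c N : osum c N.+1 = osum c N + (c N / (nu N)%:C) *: x N.
Proof. by rewrite /osum big_ord_recr. Qed.

Lemma S_osum c N : S (osum c N).
Proof. by apply: prehilbert_sum => i; exact: prehilbertZ. Qed.

Let nuC n : (nu n)%:C != 0.
Proof. by rewrite -[0]/(0%:C) (inj_eq (@complexI R)) gt_eqF. Qed.

Lemma form_osum c N m : B (osum c N) (x m) = if (m < N)%N then c m else 0.
Proof.
elim: N => [|N IH]; first by rewrite /osum big_ord0 form0l.
rewrite osumS formDl //; [|exact: S_osum|exact: prehilbertZ].
rewrite IH formZl // x_orth ltnS.
have [->|mN] := eqVneq m N; first by rewrite ltnn leqnn mul1r add0r divfK.
by rewrite mul0r mulr0 addr0 ltn_neqAle mN.
Qed.

Lemma form_orth_osum v c N : S v -> (forall m, (m < N)%N -> B v (x m) = 0) ->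
  B v (osum c N) = 0.
Proof.
move=> Sv; elim: N => [|N IH] h.
  rewrite /osum big_ord0 (prehilbert_hermitian BP (prehilbert0 BP) Sv) form0l //.
  exact: conjc0.
rewrite osumS formDr //; [|exact: S_osum|exact: prehilbertZ].
by rewrite IH ?add0r ?formZr ?h ?mulr0 // => m mN; apply: h; rewrite ltnS ltnW.
Qed.

Lemma sqnorm_term c N : sqnorm ((c N / (nu N)%:C) *: x N) = oterm c N.
Proof.
rewrite sqnormZ // /sqnorm x_orth eqxx mul1r /= /oterm.
have -> : c N / (nu N)%:C = c N * ((nu N)^-1)%:C by rewrite fmorphV.
rewrite !ReImE /= !mulr0 subr0 add0r; field; by rewrite gt_eqF.
Qed.

Lemma sqnorm_osumB c N M : (N <= M)%N ->
  sqnorm (osum c M - osum c N) = \sum_(N <= n < M) oterm c n.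
Proof.
elim: M => [|M IH].
  by rewrite leqn0 => /eqP ->; rewrite subrr big_geq // /sqnorm form0l //; exact: (prehilbert0 BP).
rewrite leq_eqVlt => /orP[/eqP ->|NM].
  by rewrite subrr big_geq // /sqnorm form0l //; exact: (prehilbert0 BP).
rewrite big_nat_recr //= -IH // osumS addrAC [LHS]sqnormD //; last 2 first.
- by apply: prehilbertB; exact: S_osum.
- exact: prehilbertZ.
rewrite sqnorm_term formZr //; last by apply: prehilbertB; exact: S_osum.
rewrite formBl //; [|exact: S_osum|exact: S_osum].
by rewrite !form_osum ltnn ltnNge -ltnS NM /= subrr mulr0 /= mulr0 addr0.
Qed.

Lemma oterm_ge0 c n : 0 <= oterm c n.
Proof. by rewrite divr_ge0 ?addr_ge0 ?sqr_ge0 // ltW. Qed.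

(** The partial sum is the orthogonal projection of h, and the remainder only adds to the square
    norm. *)
Lemma bessel h N : S h -> \sum_(0 <= n < N) oterm (fun n => B h (x n)) n <= sqnorm h.
Proof.
move=> Sh; set c := fun n => B h (x n); have So := S_osum c N.
have <- : sqnorm (osum c N) = \sum_(0 <= n < N) oterm c n.
  by rewrite -sqnorm_osumB // /osum big_ord0 subr0.
have Sd := prehilbertB Sh So.
rewrite -[X in _ <= sqnorm X](subrK (osum c N) h) sqnormD // form_orth_osum //.
  by rewrite mulr0 addr0 lerDr sqnorm_ge0.
by move=> m mN; rewrite formBl // form_osum mN subrr.
Qed.

(** Nonnegative terms with bounded sums have small tails, so the partial sums are Cauchy. Their
    inner product with a fixed x n is eventually c n, and this passes to the limit. *)
Lemma riesz_fischer c (M : R) : prehilbert_complete ->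
  (forall N, \sum_(0 <= n < N) oterm c n <= M) ->
  exists2 l, S l & (forall n, B l (x n) = c n) /\
   forall e : R, 0 < e -> exists N, forall n, (N <= n)%N -> sqnorm (osum c n - l) < e.
Proof.
move=> VC cM.
have cauchy (e : R) : 0 < e -> exists N, forall m n, (N <= m)%N -> (N <= n)%N ->
    sqnorm (osum c m - osum c n) < e.
  move=> e0; pose s N := \sum_(0 <= n < N) oterm c n.
  have s_le N m : (N <= m)%N -> s N <= s m.
    move=> Nm; rewrite /s (big_cat_nat (leq0n N) Nm) /= lerDl.
    by rewrite sumr_ge0 // => i _; exact: oterm_ge0.
  have sup_s : has_sup (range s).
    by split; [exists (s 0%N); exists 0%N|exists M => _ [N _ <-]; exact: cM].
  (* From this N on, the sums stay within e of their supremum, so every later block is below e. *)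
  have [_ [N _ <-] hN] := sup_adherent e0 sup_s.
  exists N.
  have main m n : (N <= n)%N -> (n <= m)%N -> sqnorm (osum c m - osum c n) < e.
    move=> Nn nm; rewrite sqnorm_osumB //.
    have sm : s m = s n + \sum_(n <= i < m) oterm c i.
      by rewrite /s (big_cat_nat (leq0n n) nm).
    have h1 : s m <= sup (range s) by apply: ub_le_sup; [exact: sup_s.2|exists m].
    have h2 := s_le _ _ Nn; lra.
  move=> m n Nm Nn; case: (leqP n m) => [|/ltnW] h; first exact: main.
  rewrite -sqnormN; last by apply: prehilbertB; exact: S_osum.
  by rewrite opprB; exact: main.
have [l Sl lP] := VC _ (S_osum c) cauchy; exists l => //; split => // m.
have small (e : R) : 0 < e ->
    `|Re (c m - B l (x m))| < e /\ `|Im (c m - B l (x m))| < e.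
  move=> e0; have [d d0 dP] := form_small (Sx m) e0.
  have [N NP] := lP _ d0; pose k := maxn N m.+1.
  have := dP (osum c k - l) (prehilbertB (S_osum c k) Sl) (NP _ (leq_maxl _ _)).
  rewrite formBl //; last exact: S_osum.
  by rewrite form_osum leq_maxr.
have h (y : R) : (forall e, 0 < e -> `|y| < e) -> y = 0.
  move=> ye; apply/eqP; rewrite -normr_le0 leNgt; apply/negP => y0.
  by have := ye _ y0; rewrite ltxx.
apply/esym/eqP; rewrite -subr_eq0; apply/eqP; apply: complex_eqP; apply: h => e e0.
  by have [] := small e e0.
by have [] := small e e0.
Qed.

(** Concludes that v is null rather than zero, as the form may be degenerate. *)
Definition total_system : Prop :=
  forall v, S v -> (forall n, B v (x n) = 0) -> sqnorm v = 0.

(** Depends only on coefficients and square norms, so it can be compared across two spaces. *)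
Definition parseval_sum c c' N : C := \sum_(n < N) c n * (c' n)^* / (nu n)%:C.

Lemma parseval h h' (e : R) : prehilbert_complete -> total_system ->
  S h -> S h' -> 0 < e -> exists N, forall n, (N <= n)%N ->
  let d := B h h' - parseval_sum (fun n => B h (x n)) (fun n => B h' (x n)) n in
  `|Re d| < e /\ `|Im d| < e.
Proof.
move=> VC VT Sh Sh' e0; set c := fun n => B h (x n); set c' := fun n => B h' (x n).
have [l Sl [lc ll]] := riesz_fischer VC (fun N => bessel N Sh).
have hl : B h h' = B l h'.
  have Shl := prehilbertB Sh Sl.
  have n0 : sqnorm (h - l) = 0 by apply: VT => // n; rewrite formBl // lc subrr.
  by have := form_null Shl Sh' n0; rewrite formBl // => /eqP; rewrite subr_eq0 => /eqP.
have osumE n : B (osum c n) h' = parseval_sum c c' n.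
  elim: n => [|n IH]; first by rewrite /osum /parseval_sum !big_ord0 form0l.
  rewrite osumS formDl //; [|exact: S_osum|exact: prehilbertZ].
  rewrite IH /parseval_sum big_ord_recr /= formZl //.
  by rewrite (prehilbert_hermitian BP Sh' (Sx n)) mulrAC.
have [d d0 dP] := form_small Sh' e0.
have [N NP] := ll _ d0; exists N => n Nn.
have := dP _ (prehilbertB (S_osum c n) Sl) (NP n Nn).
rewrite formBl //; last exact: S_osum.
rewrite osumE hl -opprB /= ReN ImN !normrN.
by [].
Qed.

End Space.

(** Both inner products are limits of one and the same Parseval sum. *)
Lemma isometry_of_coefficients (V1 V2 : lmodType C) (S1 : set V1) (S2 : set V2)
    (B1 : V1 -> V1 -> C) (B2 : V2 -> V2 -> C) (x : nat -> V1) (y : nat -> V2) (nu : nat -> R) :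
  prehilbert S1 B1 -> prehilbert S2 B2 ->
  prehilbert_complete S1 B1 -> prehilbert_complete S2 B2 ->
  (forall n, S1 (x n)) -> (forall n, S2 (y n)) -> (forall n, 0 < nu n) ->
  (forall n m, B1 (x n) (x m) = ((n == m)%:R * nu n)%:C) ->
  (forall n m, B2 (y n) (y m) = ((n == m)%:R * nu n)%:C) ->
  total_system S1 B1 x -> total_system S2 B2 y ->
  forall h h' k k', S1 h -> S1 h' -> S2 k -> S2 k' ->
  (forall n, B1 h (x n) = B2 k (y n)) -> (forall n, B1 h' (x n) = B2 k' (y n)) ->
  B1 h h' = B2 k k'.
Proof.
move=> P1 P2 C1 C2 Sx Sy nu0 xo yo T1 T2 h h' k k' Sh Sh' Sk Sk' hk hk'.
have small (e : R) : 0 < e ->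
    `|Re (B1 h h' - B2 k k')| < e /\ `|Im (B1 h h' - B2 k k')| < e.
  move=> e0; have e20 : 0 < e / 2 by rewrite divr_gt0.
  have [N NP] := parseval P1 Sx nu0 xo C1 T1 Sh Sh' e20.
  have [M MP] := parseval P2 Sy nu0 yo C2 T2 Sk Sk' e20.
  have := NP _ (leq_maxl N M); have := MP _ (leq_maxr N M) => /=.
  have -> : (fun n => B1 h (x n)) = (fun n => B2 k (y n)) by apply/funext.
  have -> : (fun n => B1 h' (x n)) = (fun n => B2 k' (y n)) by apply/funext.
  set s := parseval_sum _ _ _ _; rewrite !ReImE => -[a1 a2] [b1 b2].
  move: a1 a2 b1 b2; rewrite !ltr_norml => /andP[? ?] /andP[? ?] /andP[? ?] /andP[? ?].
  by split; apply/andP; split; lra.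
have z (v : R) : (forall e, 0 < e -> `|v| < e) -> v = 0.
  move=> ye; apply/eqP; rewrite -normr_le0 leNgt; apply/negP => y0.
  by have := ye _ y0; rewrite ltxx.
apply/eqP; rewrite -subr_eq0; apply/eqP; apply: complex_eqP; apply: z => e e0.
  by have [] := small e e0.
by have [] := small e e0.
Qed.

End PreHilbert.

(** * Square-integrable functions *)

Section L2Space.
Context d (T : measurableType d) (R : realType) (mu : {measure set T -> \bar R}) (D : set T).
Hypothesis mD : measurable D.
Local Notation C := R[i].
Local Notation Re := complex.Re.
Local Notation Im := complex.Im.
Local Notation L2 := (L2 mu D).
Local Notation dot := (L2_dot mu D).

Definition square_integrable (f : T -> R) : Prop :=
  measurable_fun D f /\ (\int[mu]_(x in D) (f x ^+ 2)%:E < +oo)%E.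

Lemma Re_norm_sqr (z : C) : Re `|z| ^+ 2 = Re z ^+ 2 + Im z ^+ 2.
Proof. by rewrite normc_def /= sqr_sqrtr // addr_ge0 ?sqr_ge0. Qed.

Lemma square_integrable_integrable f : square_integrable f ->
  mu.-integrable D (EFin \o (fun x => f x ^+ 2)).
Proof.
move=> [mf fi]; apply/integrableP; split.
  by apply/measurable_EFinP; exact: measurable_funX.
rewrite (eq_integral (fun x => (f x ^+ 2)%:E)) // => x _.
by rewrite /= ger0_norm // sqr_ge0.
Qed.

Lemma square_integrableM f g : square_integrable f -> square_integrable g ->
  mu.-integrable D (EFin \o (fun x => f x * g x)).
Proof.
move=> fi gi; have [mf _] := fi; have [mg _] := gi.
apply: (le_integrable mD _ _ (integrableD mD (square_integrable_integrable fi)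
  (square_integrable_integrable gi))).
  by apply/measurable_EFinP; exact: measurable_funM.
move=> x Dx; rewrite -EFinD /= lee_fin [leRHS]ger0_norm ?addr_ge0 ?sqr_ge0 //.
rewrite ler_norml; apply/andP; split; nra.
Qed.

Lemma square_integrableD f g : square_integrable f -> square_integrable g ->
  square_integrable (fun x => f x + g x).
Proof.
move=> fi gi; have [mf _] := fi; have [mg _] := gi.
split; first exact: measurable_funD.
have := integrableD mD (integrableZl mD 2 (square_integrable_integrable fi))
  (integrableZl mD 2 (square_integrable_integrable gi)).
move=> /(integrable_lty mD); apply: le_lt_trans; apply: ge0_le_integral => //.
- by move=> x _; rewrite lee_fin sqr_ge0.
- by apply/measurable_EFinP; apply: measurable_funX; exact: measurable_funD.
- apply/measurable_EFinP; apply: measurable_funD;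
    by apply: measurable_funM => //; exact: measurable_funX.
- by move=> x _; rewrite /= -!EFinM -EFinD lee_fin; have := sqr_ge0 (f x - g x); rewrite !expr2; lra.
Qed.

Lemma square_integrableZ (k : R) f : square_integrable f ->
  square_integrable (fun x => k * f x).
Proof.
move=> fi; have [mf _] := fi; split; first exact: measurable_funM.
have := integrableZl mD (k ^+ 2) (square_integrable_integrable fi).
move=> /(integrable_lty mD); rewrite (eq_integral (fun x => ((k * f x) ^+ 2)%:E)) //.
by move=> x _; rewrite /= -EFinM exprMn.
Qed.

Lemma L2P (f : T -> C) : L2 f <->
  square_integrable (fun x => Re (f x)) /\ square_integrable (fun x => Im (f x)).
Proof.
have dom (u v : T -> R) : measurable_fun D u -> measurable_fun D v ->
    (forall x, u x ^+ 2 <= v x) -> (\int[mu]_(x in D) (v x)%:E < +oo)%E ->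
    (\int[mu]_(x in D) (u x ^+ 2)%:E < +oo)%E.
  move=> mu_ mv uv; apply: le_lt_trans; apply: ge0_le_integral => //.
  - by move=> x _; rewrite lee_fin sqr_ge0.
  - by apply/measurable_EFinP; exact: measurable_funX.
  - exact/measurable_EFinP.
  - by move=> x _; rewrite lee_fin.
split=> [[m1 m2 i]|[[m1 i1] [m2 i2]]].
  have mn : measurable_fun D (fun x => Re `|f x| ^+ 2).
    apply: (eq_measurable_fun (fun x => Re (f x) ^+ 2 + Im (f x) ^+ 2)).
      by move=> x _; rewrite Re_norm_sqr.
    by apply: measurable_funD; exact: measurable_funX.
  split; split => //; apply: (dom _ _ _ mn _ i) => // x;
    by rewrite Re_norm_sqr ?lerDl ?lerDr sqr_ge0.
split => //.
have := integrableD mD (square_integrable_integrable (conj m1 i1))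
  (square_integrable_integrable (conj m2 i2)).
move=> /(integrable_lty mD).
rewrite (eq_integral (fun x => (Re `|f x| ^+ 2)%:E)) // => x _.
by rewrite Re_norm_sqr -EFinD.
Qed.

Lemma L2_closed (a : C) f g : L2 f -> L2 g -> L2 (fun x => a * f x + g x).
Proof.
move=> /L2P[f1 f2] /L2P[g1 g2]; apply/L2P; split.
  rewrite (_ : (fun _ => _) =
    fun x => (Re a * Re (f x) + (- Im a) * Im (f x)) + Re (g x)).
    by apply: square_integrableD => //; apply: square_integrableD; exact: square_integrableZ.
  by apply/funext => x; rewrite !ReImE mulNr.
rewrite (_ : (fun _ => _) =
  fun x => (Re a * Im (f x) + Im a * Re (f x)) + Im (g x)).
  by apply: square_integrableD => //; apply: square_integrableD; exact: square_integrableZ.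
by apply/funext => x; rewrite !ReImE.
Qed.

Lemma L2_0 : L2 (fun=> 0).
Proof.
apply/L2P; split; split=> //=; rewrite (eq_integral (cst 0%E)) ?integral0 ?ltry // => x _;
  by rewrite expr0n.
Qed.

Definition cintegrable (u : T -> C) : Prop :=
  mu.-integrable D (EFin \o (fun x => Re (u x))) /\
  mu.-integrable D (EFin \o (fun x => Im (u x))).

Definition cintegral (u : T -> C) : C :=
  (\int[mu]_(x in D) Re (u x)) +i* (\int[mu]_(x in D) Im (u x)).

Lemma L2_cintegrable f g : L2 f -> L2 g -> cintegrable (fun x => f x * (g x)^*).
Proof.
move=> /L2P[f1 f2] /L2P[g1 g2]; split.
  rewrite (_ : _ \o _ = (EFin \o (fun x => (Re (f x) * Re (g x))%R)) \+
      (EFin \o (fun x => (Im (f x) * Im (g x))%R)))%E.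
    by apply: integrableD => //; exact: square_integrableM.
  by apply/funext => x /=; rewrite -EFinD; congr EFin; rewrite !ReImE; ring.
rewrite (_ : _ \o _ = (EFin \o (fun x => (Im (f x) * Re (g x))%R)) \+
    (EFin \o (fun x => ((-1 * Re (f x)) * Im (g x))%R)))%E.
  apply: integrableD => //; apply: square_integrableM => //; exact: square_integrableZ.
by apply/funext => x /=; rewrite -EFinD; congr EFin; rewrite !ReImE; ring.
Qed.

Lemma cintegral_linear (a : C) u v : cintegrable u -> cintegrable v ->
  cintegral (fun x => a * u x + v x) = a * cintegral u + cintegral v.
Proof.
move=> [u1 u2] [v1 v2].
have lin (k l : R) (p r s : T -> R) : mu.-integrable D (EFin \o p) ->
    mu.-integrable D (EFin \o r) -> mu.-integrable D (EFin \o s) ->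
    \int[mu]_(x in D) (k * p x + l * r x + s x) =
    k * \int[mu]_(x in D) p x + l * \int[mu]_(x in D) r x + \int[mu]_(x in D) s x.
  move=> ip ir is_.
  have Z (m : R) (h : T -> R) : mu.-integrable D (EFin \o h) ->
      mu.-integrable D (EFin \o (fun x => m * h x)).
    by move=> ih; exact: (integrableZl mD m ih).
  rewrite RintegralD //; last exact: (integrableD mD (Z k p ip) (Z l r ir)).
  by rewrite RintegralD ?RintegralZl //; exact: Z.
apply: complex_eqP => /=.
  rewrite (@eq_Rintegral _ _ _ mu D (fun x => Re a * Re (u x) + - Im a * Im (u x) + Re (v x))).
    by rewrite lin // !ReImE /=; ring.
  by move=> x _; rewrite !ReImE mulNr.
rewrite (@eq_Rintegral _ _ _ mu D (fun x => Re a * Im (u x) + Im a * Re (u x) + Im (v x))).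
  by rewrite lin // !ReImE /=; ring.
by move=> x _; rewrite !ReImE.
Qed.

Lemma L2_dotE f g : dot f g = cintegral (fun x => f x * (g x)^*).
Proof. by []. Qed.

Local Notation V := (T -> C^o).

Lemma L2_prehilbert : @prehilbert R V L2 dot.
Proof.
split.
- exact: L2_0.
- exact: L2_closed.
- move=> a u v x Lu Lv Lx; rewrite !L2_dotE.
  rewrite -(cintegral_linear a (L2_cintegrable Lu Lx) (L2_cintegrable Lv Lx)).
  by congr cintegral; apply/funext => y; rewrite mulrDl -mulrA.
- move=> u v Lu Lv; rewrite !L2_dotE; have [i1 i2] := L2_cintegrable Lu Lv.
  apply: complex_eqP; rewrite ?ReJ ?ImJ /=.
    by apply: eq_Rintegral => x _; rewrite !ReImE; ring.
  rewrite -mulN1r -RintegralZl //.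
  by apply: eq_Rintegral => x _; rewrite !ReImE; ring.
- move=> u Lu; rewrite lecE /=; apply/andP; split.
    rewrite (@eq_Rintegral _ _ _ mu D (cst 0)) ?Rintegral_cst ?mul0r // => x _.
    by rewrite !ReImE /=; ring.
  by apply: Rintegral_ge0 => x _; rewrite !ReImE mulrN opprK addr_ge0 // -expr2 sqr_ge0.
Qed.

Lemma L2_sqnormE (f : V) : L2 f ->
  (sqnorm dot f)%:E = (\int[mu]_(x in D) (Re (f x) ^+ 2 + Im (f x) ^+ 2)%:E)%E.
Proof.
move=> Lf; have [i1 _] := L2_cintegrable Lf Lf.
rewrite /sqnorm /= /Rintegral fineK; last exact: integrable_fin_num.
by apply: eq_integral => x _; congr EFin; rewrite !ReImE; ring.
Qed.

Lemma L2_sqnorm_eq0 (f : V) : L2 f -> sqnorm dot f = 0 -> ae_eq mu D f (fun=> 0).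
Proof.
move=> Lf f0; have [[m1 i1] [m2 i2]] := (L2P f).1 Lf.
have := L2_sqnormE Lf; rewrite f0 => /esym h.
pose g x := (Re (f x) ^+ 2 + Im (f x) ^+ 2)%:E.
have mg : measurable_fun D g.
  by apply/measurable_EFinP; apply: measurable_funD; exact: measurable_funX.
have : (\int[mu]_(x in D) `|g x| = 0)%E.
  rewrite -[RHS]h; apply: eq_integral => x _; rewrite /g /= ger0_norm //.
  by rewrite addr_ge0 ?sqr_ge0.
move=> /(ae_eq_integral_abs mu mD mg); apply: filterS => x /= gx Dx.
have := gx Dx; rewrite /g => -[] /eqP; rewrite paddr_eq0 ?sqr_ge0 // !sqrf_eq0.
by move=> /andP[/eqP z1 /eqP z2]; exact: complex_eqP.
Qed.

Lemma ae_eq_L2_dot (f f' g : V) : L2 f -> L2 f' -> L2 g -> ae_eq mu D f f' ->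
  dot f g = dot f' g.
Proof.
move=> Lf Lf' Lg ff'.
have [/integrableP[m1 _] /integrableP[m2 _]] := L2_cintegrable Lf Lg.
have [/integrableP[m1' _] /integrableP[m2' _]] := L2_cintegrable Lf' Lg.
apply: complex_eqP => /=; rewrite /Rintegral; congr fine; apply: ae_eq_integral => //;
  by apply: filterS ff' => x h Dx /=; rewrite h.
Qed.

End L2Space.

(** * Completeness of L^2 through rapidly converging subsequences *)

Section Completeness.
Context d (T : measurableType d) (R : realType) (mu : {measure set T -> \bar R}) (D : set T).
Hypothesis mD : measurable D.
Local Notation C := R[i].
Local Notation Re := complex.Re.
Local Notation Im := complex.Im.

Lemma half_pow_small (c e : R) : 0 < e -> exists m : nat, c * 2 ^- m < e.
Proof.
move=> e0; pose m := Num.bound (c / e); exists m.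
have p0 : 0 < (2 : R) ^+ m by rewrite exprn_gt0.
rewrite ltr_pdivrMr // -ltr_pdivrMl // mulrC.
apply: le_lt_trans (ler_norm _) _; apply: lt_trans (archi_boundP (normr_ge0 _)) _.
rewrite -natrX ltr_nat.
suff -> : Num.bound `|c / e| = m by exact: ltn_expl.
by rewrite /m /Num.bound normr_id.
Qed.

(* Cauchy-Schwarz with the weights 2^k. *)
Lemma sqr_telescope_le (f : nat -> R) (m n : nat) : (m <= n)%N ->
  (f n - f m) ^+ 2 <=
  2 * 2 ^- m * \sum_(m <= k < n) 2 ^+ k * (f k.+1 - f k) ^+ 2.
Proof.
move=> mn; set s := \sum_(m <= k < n) _.
have p2 k : 0 < (2 : R) ^- k by rewrite invr_gt0 exprn_gt0.
have s0 k : 0 <= \sum_(m <= i < k) 2 ^+ i * (f i.+1 - f i) ^+ 2.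
  by apply: sumr_ge0 => i _; rewrite mulr_ge0 ?sqr_ge0 ?exprn_ge0 //.
(* The factor is exactly the sum of 2^-k over m <= k < n; this sharper bound is the one that can be
   proved by induction on n. *)
suff : (f n - f m) ^+ 2 <= (2 * 2 ^- m - 2 * 2 ^- n) * s.
  move=> h; apply: le_trans h _; rewrite ler_wpM2r ?s0 //.
  by rewrite lerBlDr lerDl mulr_ge0 // ltW.
rewrite /s; elim: n mn {s} => [|n IH].
  by rewrite leqn0 => /eqP ->; rewrite !subrr expr0n mul0r.
rewrite leq_eqVlt => /orP[/eqP <-|]; first by rewrite !subrr expr0n mul0r.
rewrite ltnS => mn; have {}IH := IH mn.
rewrite big_nat_recr //=; set B := \sum_(m <= i < n) _ in IH *.
set a := f n - f m in IH *; set b := f n.+1 - f n.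
have -> : f n.+1 - f m = a + b by rewrite /a /b; ring.
set A := 2 * 2 ^- m - 2 * 2 ^- n in IH *; set p := (2 : R) ^- n.
have pp : 0 < p := p2 n.
have A0 : 0 <= A.
  by rewrite /A subr_ge0 ler_pM2l // lef_pV2 ?posrE ?exprn_gt0 // ler_weXn2l // ler1n.
have -> : 2 * 2 ^- m - 2 * 2 ^- n.+1 = A + p.
  by rewrite /A /p exprS invfM; field; rewrite !expf_neq0.
have -> : 2 ^+ n * b ^+ 2 = b ^+ 2 / p by rewrite /p invrK mulrC.
have B0 : 0 <= B := s0 n.
set x := p * B; set y := A * (b ^+ 2 / p).
have x0 : 0 <= x by rewrite mulr_ge0 // ltW.
have y0 : 0 <= y by rewrite mulr_ge0 // divr_ge0 ?sqr_ge0 // ltW.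
(* Then x + y >= 2 sqrt(x y) >= 2 a b controls the cross term of (a + b)^2. *)
have xy : (a * b) ^+ 2 <= x * y.
  have -> : x * y = A * B * b ^+ 2 by rewrite /x /y; field; rewrite gt_eqF.
  by rewrite exprMn ler_wpM2r ?sqr_ge0.
have ab : 2 * (a * b) <= x + y.
  have h : (2 * (a * b)) ^+ 2 <= (x + y) ^+ 2.
    rewrite exprMn; apply: (@le_trans _ _ (2 ^+ 2 * (x * y))).
      by rewrite ler_wpM2l // sqr_ge0.
    by rewrite -subr_ge0 (_ : _ - _ = (x - y) ^+ 2) ?sqr_ge0 //; ring.
  apply: le_trans (ler_norm _) _.
  by rewrite -[leRHS]ger0_norm ?addr_ge0 // -ler_sqr ?nnegrE // !real_normK ?num_real.
have -> : (A + p) * (B + b ^+ 2 / p) = A * B + (x + y) + b ^+ 2.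
  by rewrite /x /y; field; rewrite gt_eqF.
by rewrite (_ : (a + b) ^+ 2 = a ^+ 2 + 2 * (a * b) + b ^+ 2); [lra|ring].
Qed.

(** The series S of the 2^k (f_(k+1) - f_k)^2 has integral at most 1, and telescoping gives (phi -
    f_m)^2 <= 2^(1-m) S pointwise. Where S is infinite the bound is trivial, so phi may be 0
    there. *)
Lemma rapidly_cauchy_limit (f : nat -> T -> R) :
  (forall n, measurable_fun D (f n)) ->
  (forall k, (\int[mu]_(x in D) (2 ^+ k * (f k.+1 x - f k x) ^+ 2)%:E <=
     (1 / (2 ^ k.+1)%:R)%:E)%E) ->
  exists2 phi : T -> R, measurable_fun D phi &
    forall m, (\int[mu]_(x in D) ((phi x - f m x) ^+ 2)%:E <= (2 * 2 ^- m)%:E)%E.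
Proof.
move=> mf fi.
pose g k x := (2 ^+ k * (f k.+1 x - f k x) ^+ 2)%:E.
have g0 k x : (0 <= g k x)%E by rewrite lee_fin mulr_ge0 ?sqr_ge0 ?exprn_ge0 //.
have mg k : measurable_fun D (g k).
  apply/measurable_EFinP; apply: measurable_funM => //.
  by apply: measurable_funX; exact: measurable_funB.
pose S x := (\sum_(0 <= k <oo) g k x)%E.
have mS : measurable_fun D S by apply: ge0_emeasurable_sum => //= k x _ _.
have S0 x : (0 <= S x)%E by apply: nneseries_ge0 => k _ _.
have iS : (\int[mu]_(x in D) S x <= 1)%E.
  (* The bounds 1 / 2^(k+1) add up to 1. *)
  rewrite integral_nneseries //; apply: le_trans (epsilon_trick0 _ ler01).
  by apply: lee_nneseries => k _; [move=> _; exact: integral_ge0|exact: fi].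
pose E := D `&` [set x | S x \is a fin_num].
have mE : measurable E by exact: emeasurable_fin_num.
have bound x m n : S x \is a fin_num -> (m <= n)%N ->
    (f n x - f m x) ^+ 2 <= 2 * 2 ^- m * fine (S x).
  move=> Sx mn; apply: le_trans (sqr_telescope_le (fun k => f k x) mn) _.
  rewrite ler_wpM2l // ?mulr_ge0 ?invr_ge0 ?exprn_ge0 //.
  rewrite -lee_fin fineK // -sumEFin; apply: le_trans (nneseries_lim_ge n _); last by move=> k _ _.
  rewrite [leRHS](big_cat_nat (leq0n m) mn) /= leeDr //.
  by apply: sume_ge0 => k _.
pose phi : T -> R := (fun x => limn (fun n => f n x)) \_ E.
have cvgf x : S x \is a fin_num -> (fun n => f n x) @ \oo --> limn (fun n => f n x).
  move=> Sx; apply/cauchy_cvgP; apply: cauchy_exP => e e0.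
  have [m hm] := half_pow_small (2 * fine (S x)) (exprn_gt0 2 e0).
  exists (f m x); exists m => // n /= mn; rewrite /ball /=.
  rewrite -ltr_sqr ?nnegrE // ?ltW // real_normK ?num_real //.
  rewrite -sqrrN opprB; apply: le_lt_trans (bound x m n Sx mn) _.
  by rewrite mulrAC.
have mphi : measurable_fun D phi.
  apply: (@measurable_fun_cvg _ _ _ _ (fun n => f n \_ E)).
    move=> m; apply/measurable_restrict => //.
    by apply: (measurable_funS mD _ (mf m)); exact: subIsetl.
  move=> x Dx; rewrite /phi patchE; case: ifPn => xE.
    rewrite (_ : (fun n => _) = fun n => f n x); last first.
      by apply/funext => n; rewrite patchE xE.
    by apply: cvgf; move: xE; rewrite inE => -[].
  rewrite (_ : (fun n => _) = fun=> 0); first exact: cvg_cst.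
  by apply/funext => n; rewrite patchE (negbTE xE).
exists phi => // m.
apply: (@le_trans _ _ (\int[mu]_(x in D) ((2 * 2 ^- m)%:E * S x))%E).
  apply: ge0_le_integral => //.
  - by move=> x _; rewrite lee_fin sqr_ge0.
  - by apply/measurable_EFinP; apply: measurable_funX; exact: measurable_funB.
  - by apply: emeasurable_funM.
  - move=> x Dx; have [Sx|] := boolP (S x \is a fin_num).
      have -> : phi x = limn (fun n => f n x) by rewrite /phi patchE mem_set.
      rewrite -(fineK Sx) -EFinM lee_fin.
      have cv : (fun n => (f n x - f m x) ^+ 2) @ \oo --> (limn (fun n => f n x) - f m x) ^+ 2.
        have c1 : (fun n => f n x - f m x) @ \oo --> limn (fun n => f n x) - f m x.
          by apply: cvgB; [exact: cvgf|exact: cvg_cst].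
        exact: (cvgM c1 c1).
      rewrite -(cvg_lim _ cv) //; apply: limr_le; first by apply/cvg_ex; eexists; exact: cv.
      by exists m => // n /= mn; exact: bound.
    rewrite ge0_fin_numE // -leNgt leye_eq => /eqP ->.
    by rewrite gt0_muley ?leey // lte_fin mulr_gt0 // invr_gt0 exprn_gt0.
have p0 : 0 <= 2 * 2 ^- m :> R by rewrite mulr_ge0 // invr_ge0 exprn_ge0.
rewrite ge0_integralZl // ?lee_fin // -[leRHS]mule1.
by rewrite lee_wpmul2l.
Qed.

End Completeness.

Section L2Complete.
Context d (T : measurableType d) (R : realType) (mu : {measure set T -> \bar R}) (D : set T).
Hypothesis mD : measurable D.
Local Notation C := R[i].
Local Notation Re := complex.Re.
Local Notation Im := complex.Im.
Local Notation L2 := (L2 mu D).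
Local Notation dot := (L2_dot mu D).
Local Notation V := (T -> C^o).

Lemma L2_complete : @prehilbert_complete R V L2 dot.
Proof.
move=> u Lu cu; have HP := L2_prehilbert mu mD.
(* Chosen so that 2^j r_j = 1 / 2^(j+1), as [rapidly_cauchy_limit] requires. *)
pose r j : R := (2 ^+ j * 2 ^+ j.+1)^-1.
have r0 j : 0 < r j by rewrite invr_gt0 mulr_gt0 // exprn_gt0.
have cuP j : {N | forall m n, (N <= m)%N -> (N <= n)%N -> sqnorm dot (u m - u n) < r j}.
  by apply: cid; exact: cu.
(* Adding up the thresholds gives nondecreasing indices that dominate each of them. *)
pose k j := (\sum_(i < j.+1) projT1 (cuP i))%N.
have kS j : (k j <= k j.+1)%N by rewrite /k [leqRHS]big_ord_recr leq_addr.
have kP j m n : (k j <= m)%N -> (k j <= n)%N -> sqnorm dot (u m - u n) < r j.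
  have h : (projT1 (cuP j) <= k j)%N by rewrite /k big_ord_recr leq_addl.
  by move=> jm jn; apply: (projT2 (cuP j)); apply: leq_trans h _.
pose f j := u (k j).
have Lf j : L2 (f j) by exact: Lu.
have LB (g h : V) : L2 g -> L2 h -> L2 (g - h) by exact: (prehilbertB HP).
have fS j : (\int[mu]_(x in D) (Re ((f j.+1 - f j : V) x) ^+ 2 + Im ((f j.+1 - f j : V) x) ^+ 2)%:E
    <= (r j)%:E)%E.
  rewrite -(L2_sqnormE mD (LB _ _ (Lf _) (Lf _))) lee_fin ltW //.
  by apply: kP => //; exact: kS.
(* Real and imaginary parts are treated by one argument. *)
have approx (p : C -> R) : (forall z, p z = Re z) \/ (forall z, p z = Im z) ->
    exists2 phi : T -> R, measurable_fun D phi &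
    forall m, (\int[mu]_(x in D) ((phi x - p (f m x)) ^+ 2)%:E <= (2 * 2 ^- m)%:E)%E.
  move=> pP.
  have pB z z' : p (z - z') = p z - p z' by case: pP => pE; rewrite !pE ?ReD ?ReN ?ImD ?ImN.
  have p_le z : p z ^+ 2 <= Re z ^+ 2 + Im z ^+ 2.
    by case: pP => ->; rewrite ?lerDl ?lerDr sqr_ge0.
  have mp n : measurable_fun D (fun x => p (f n x)).
    have [m1 m2 _] := Lf n.
    by case: pP => pE; [apply: (eq_measurable_fun _ _ m1)|apply: (eq_measurable_fun _ _ m2)] => x _;
      rewrite pE.
  have [|phi mphi phiP] := @rapidly_cauchy_limit _ _ _ mu D mD (fun n x => p (f n x)) mp.
    move=> j; have p2 : 0 <= (2 : R) ^+ j by rewrite exprn_ge0.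
    have -> : 1 / (2 ^ j.+1)%:R = 2 ^+ j * r j :> R.
      rewrite natrX /r; field; by rewrite !expf_neq0.
    rewrite (eq_integral (fun x => ((2 ^+ j)%:E * ((p (f j.+1 x) - p (f j x)) ^+ 2)%:E))%E); last first.
      by move=> x _; rewrite EFinM.
    rewrite ge0_integralZl ?lee_fin //; last 2 first.
    - by apply/measurable_EFinP; apply: measurable_funX; exact: measurable_funB.
    - by move=> x _; rewrite lee_fin sqr_ge0.
    rewrite EFinM; apply: lee_wpmul2l; first by rewrite lee_fin.
    apply: le_trans (fS j); apply: ge0_le_integral => //.
    - by move=> x _; rewrite lee_fin sqr_ge0.
    - by apply/measurable_EFinP; apply: measurable_funX; exact: measurable_funB.
    - have [m1 m2 _] := LB _ _ (Lf j.+1) (Lf j).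
      by apply/measurable_EFinP; apply: measurable_funD; exact: measurable_funX.
    - by move=> x _; rewrite lee_fin -pB; exact: p_le.
  by exists phi.
have [phi1 m1 phi1P] := approx (fun z => Re z) (or_introl (fun=> erefl)).
have [phi2 m2 phi2P] := approx (fun z => Im z) (or_intror (fun=> erefl)).
pose phi : V := fun x => phi1 x +i* phi2 x.
have Ld m : L2 (phi - f m : V).
  have [n1 n2 _] := Lf m; apply/L2P => //; split; split.
  - apply: (eq_measurable_fun (fun x => phi1 x - Re (f m x))).
      by move=> x _; rewrite ReD ReN.
    exact: measurable_funB.
  - rewrite (eq_integral (fun x => ((phi1 x - Re (f m x)) ^+ 2)%:E)).
      by apply: le_lt_trans (phi1P m) _; rewrite ltry.
    by move=> x _; rewrite ReD ReN.
  - apply: (eq_measurable_fun (fun x => phi2 x - Im (f m x))).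
      by move=> x _; rewrite ImD ImN.
    exact: measurable_funB.
  - rewrite (eq_integral (fun x => ((phi2 x - Im (f m x)) ^+ 2)%:E)).
      by apply: le_lt_trans (phi2P m) _; rewrite ltry.
    by move=> x _; rewrite ImD ImN.
have Lphi : L2 phi.
  by rewrite -[phi](subrK (f 0%N : V)); apply: (prehilbertD HP).
have close m : sqnorm dot (phi - f m : V) <= 4 * 2 ^- m.
  rewrite -lee_fin (L2_sqnormE mD (Ld m)).
  rewrite (eq_integral (fun x =>
    (((phi1 x - Re (f m x)) ^+ 2)%:E + ((phi2 x - Im (f m x)) ^+ 2)%:E))%E); last first.
    by move=> x _; rewrite -EFinD !ReImE.
  have [n1 n2 _] := Lf m.
  rewrite ge0_integralD //.
  - apply: (@le_trans _ _ ((2 * 2 ^- m)%:E + (2 * 2 ^- m)%:E)%E).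
      exact: leeD (phi1P m) (phi2P m).
    by rewrite -EFinD lee_fin; lra.
  - by move=> x _; rewrite lee_fin sqr_ge0.
  - by apply/measurable_EFinP; apply: measurable_funX; exact: measurable_funB.
  - by move=> x _; rewrite lee_fin sqr_ge0.
  - by apply/measurable_EFinP; apply: measurable_funX; exact: measurable_funB.
(* 10 = 2 + 2 * 4: [sqnormD_le] doubles the bounds 2^-j and 4 * 2^-j on the two summands. *)
exists phi => // e e0; have [j hj] := half_pow_small 10 e0.
exists (k j) => n jn.
have -> : (u n - phi : V) = (u n - f j) + (f j - phi) by rewrite addrA subrK.
apply: le_lt_trans (sqnormD_le HP (LB _ _ (Lu n) (Lf j)) (LB _ _ (Lf j) Lphi)) _.
have h1 : sqnorm dot (u n - f j : V) < r j by exact: kP.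
have h2 : sqnorm dot (f j - phi : V) <= 4 * 2 ^- j.
  by rewrite -[_ - _]opprB (sqnormN HP (Ld j)); exact: close.
have h3 : r j <= 2 ^- j.
  rewrite /r lef_pV2 ?posrE ?mulr_gt0 ?exprn_gt0 // ler_peMr ?exprn_ge0 //.
  by rewrite exprn_ege1 // ler1n.
move: hj; lra.
Qed.

End L2Complete.

(** * Totality of the polynomials *)

Section StepPolynomials.
Variable R : realFieldType.

Lemma bernoulli_onem (z : R) m : 0 <= z <= 1 -> 1 - m%:R * z <= (1 - z) ^+ m.
Proof.
move=> /andP[z0 z1]; elim: m => [|m IH]; first by rewrite mul0r subr0 expr0.
rewrite exprS -natr1.
have h : (1 - z) * (1 - m%:R * z) <= (1 - z) * (1 - z) ^+ m.
  by apply: ler_wpM2l => //; rewrite subr_ge0.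
by apply: le_trans h; have := mulr_ge0 (ler0n R m) (sqr_ge0 z); lra.
Qed.

Lemma bernoulli_onep (z : R) m : 0 <= z -> 1 + m%:R * z <= (1 + z) ^+ m.
Proof.
move=> z0; elim: m => [|m IH]; first by rewrite mul0r addr0 expr0.
rewrite exprS -natr1.
have h : (1 + z) * (1 + m%:R * z) <= (1 + z) * (1 + z) ^+ m.
  by apply: ler_wpM2l => //; rewrite addr_ge0.
by apply: le_trans h; have := mulr_ge0 (ler0n R m) (sqr_ge0 z); lra.
Qed.

(* Tends to 1 for 0 <= y < 1/2 and to 0 for 1/2 < y <= 1. *)
Definition step_poly n (y : R) := (1 - y ^+ n) ^+ (2 ^ n).

Lemma step_poly_itv n y : 0 <= y <= 1 -> 0 <= step_poly n y <= 1.
Proof.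
move=> /andP[y0 y1]; have h : 0 <= y ^+ n <= 1 by rewrite exprn_ge0 // exprn_ile1.
by rewrite exprn_ge0 ?exprn_ile1 //; move/andP: h => []; lra.
Qed.

(** Bernoulli for (1 - z)^m with z = y^n and m = 2^n, where m z = (2 y)^n. This product is why the
    exponent is 2^n and the threshold 1/2. *)
Lemma step_poly_ge n y : 0 <= y <= 1 -> 1 - (2 * y) ^+ n <= step_poly n y.
Proof.
move=> /andP[y0 y1]; have h : 0 <= y ^+ n <= 1 by rewrite exprn_ge0 // exprn_ile1.
by have := bernoulli_onem (2 ^ n) h; rewrite natrX -exprMn.
Qed.

(** With the same z and m: (1 - z)^m (1 + z)^m <= 1, while (1 + z)^m >= m z = (2 y)^n. *)
Lemma step_poly_le n y : 0 < y <= 1 -> step_poly n y <= (2 * y)^-1 ^+ n.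
Proof.
move=> /andP[y0 y1]; have z0 : 0 < y ^+ n by rewrite exprn_gt0.
have z1 : y ^+ n <= 1 by rewrite exprn_ile1 // ltW.
have t0 : 0 < (2 * y) ^+ n by rewrite exprn_gt0 // mulr_gt0.
rewrite exprVn -[leRHS]mul1r ler_pdivlMr //.
have h := bernoulli_onep (2 ^ n) (ltW z0); rewrite natrX -exprMn in h.
have p0 : 0 <= step_poly n y by rewrite exprn_ge0 // subr_ge0.
apply: (@le_trans _ _ (step_poly n y * (1 + y ^+ n) ^+ (2 ^ n))).
  by apply: ler_wpM2l => //; apply: le_trans h; rewrite lerDr.
rewrite -exprMn exprn_ile1 //; first by rewrite mulr_ge0; lra.
by have := sqr_ge0 (y ^+ n); rewrite expr2; lra.
Qed.

End StepPolynomials.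

Lemma cvg_step_poly1 (R : realType) (y : R) : 0 <= y -> 2 * y < 1 ->
  step_poly n y @[n --> \oo] --> (1 : R).
Proof.
move=> y0 y2; have y1 : 0 <= y <= 1 by apply/andP; split; lra.
apply: (@squeeze_cvgr _ _ _ _ (fun n => 1 - (2 * y) ^+ n) (fun=> 1)).
- by apply: nearW => n; rewrite step_poly_ge //; have /andP[] := step_poly_itv n y1.
- rewrite -[X in _ --> X]subr0; apply: cvgB; first exact: cvg_cst.
  by apply: cvg_expr; rewrite ger0_norm //; lra.
- exact: cvg_cst.
Qed.

Lemma cvg_step_poly0 (R : realType) (y : R) : y <= 1 -> 1 < 2 * y ->
  step_poly n y @[n --> \oo] --> (0 : R).
Proof.
move=> y1 y2; have y0 : 0 < y by lra.
have h1 : 0 <= y <= 1 by apply/andP; split; lra.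
apply: (@squeeze_cvgr _ _ _ _ (fun=> 0) (fun n => (2 * y)^-1 ^+ n)).
- apply: nearW => n; have /andP[-> _] := step_poly_itv n h1.
  by rewrite step_poly_le // y0.
- exact: cvg_cst.
- by apply: cvg_expr; rewrite ger0_norm ?invr_ge0 ?invf_lt1 //; lra.
Qed.

Section Moments.
Variable R : realType.
Local Notation lambda := (@lebesgue_measure R).
Variables (a b : R) (G : R -> R).
Hypothesis ab : a < b.
Hypothesis iG : lambda.-integrable `[a, b] (EFin \o G).
Local Notation I := (`[a, b]%classic : set R).
Local Notation L p := (\int[lambda]_(x in I) (G x * p x)).

Let mI : measurable (I : set (measurableTypeR R)). Proof. exact: measurable_itv. Qed.

Lemma integrable_mul_continuous (p : R -> R) : continuous p ->
  lambda.-integrable I (EFin \o (fun x => G x * p x)).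
Proof.
move=> cp; have cI : compact (p @` I).
  by apply: continuous_compact; [exact: continuous_subspaceT|exact: segment_compact].
have bp : [bounded p x | x in I].
  have [M [Mr hM]] := compact_bounded cI.
  exists M; split => // k Mk x Ix; apply: hM => //; by exists x.
have mp : measurable_fun (I : set (measurableTypeR R)) p.
  by apply: measurable_funTS; exact: continuous_measurable_fun.
have := integrableMl mI iG mp bp.
by apply: eq_integrable => // x _ /=; rewrite EFinM.
Qed.

Lemma moment_linear (k : R) (p r : R -> R) : continuous p -> continuous r ->
  L (fun x => k * p x + r x) = k * L p + L r.
Proof.
move=> cp cr.
have i1 := integrable_mul_continuous cp; have i2 := integrable_mul_continuous cr.
have i3 : lambda.-integrable I (EFin \o (fun x => k * (G x * p x))).
  exact: (integrableZl mI k i1).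
rewrite -RintegralZl // -RintegralD //.
by apply: eq_Rintegral => x _; ring.
Qed.

Hypothesis L0 : forall n, L (fun x => x ^+ n) = 0.

Lemma moment_poly (p : {poly R}) : L (fun x => p.[x]) = 0.
Proof.
(* The extra monomial makes the claim stable under passing from p to p X + c. *)
suff h k : L (fun x => x ^+ k * p.[x]) = 0.
  by rewrite -[RHS](h 0%N); apply: eq_Rintegral => x _; rewrite expr0 mul1r.
elim/poly_ind: p k => [|p c IH] k.
  by rewrite (@eq_Rintegral _ _ _ _ _ (fun=> 0)) ?Rintegral_cst ?mul0r // => x _; rewrite horner0 !mulr0.
have cX j : continuous (fun x : R => x ^+ j) by exact: exprn_continuous.
have cp : continuous (fun x : R => x ^+ k.+1 * p.[x]).
  by move=> x; apply: cvgM; [exact: cX|exact: continuous_horner].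
transitivity (L (fun x => c * x ^+ k + x ^+ k.+1 * p.[x])).
  by apply: eq_Rintegral => x _; rewrite hornerD hornerM hornerX hornerC exprS; ring.
by rewrite (moment_linear c (cX k) cp) L0 IH mulr0 addr0.
Qed.

(** Step polynomials in an affine variable tend boundedly to the indicator away from the single
    point c, and each has integral zero against G; dominated convergence concludes. *)
Lemma integral_moment_itv c : a < c < b ->
  \int[lambda]_(x in I) (G x * \1_(`]-oo, c]%classic) x) = 0.
Proof.
move=> /andP[ac cb]; have d0 : 0 < b - a by rewrite subr_gt0.
(* Maps [a, b] into [0, 1] and c to the threshold 1/2. *)
pose y (x : R) := 1 / 2 + (x - c) / (2 * (b - a)).
pose Y : {poly R} := (1 / 2)%:P + ((2 * (b - a))^-1)%:P * ('X - c%:P).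
have YE x : Y.[x] = y x by rewrite /Y !hornerE /y; ring.
pose P n : {poly R} := (1 - Y ^+ n) ^+ (2 ^ n).
have PE n x : (P n).[x] = step_poly n (y x).
  by rewrite /P /step_poly horner_exp hornerD hornerN horner_exp YE hornerC.
have yE x : 2 * y x = 1 + (x - c) / (b - a) by rewrite /y; field; rewrite gt_eqF.
have yI x : I x -> 0 <= y x <= 1.
  rewrite /= in_itv /= => /andP[ax xb].
  have h1 : -1 <= (x - c) / (b - a) by rewrite ler_pdivlMr //; lra.
  have h2 : (x - c) / (b - a) <= 1 by rewrite ler_pdivrMr //; lra.
  by have := yE x; move=> h; apply/andP; split; lra.
have [mG _] := integrableP _ _ _ iG; move/measurable_EFinP : mG => mG.
have [//|||||i1 _ i2] := @dominated_convergence _ _ _ lambda I mI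
  (fun n x => (G x * (P n).[x])%:E) (fun x => (G x * \1_(`]-oo, c]%classic) x)%:E)
  (fun x => `|(G x)%:E|%E).
- move=> n; apply/measurable_EFinP; apply: measurable_funM => //.
  by apply: measurable_funTS; apply: continuous_measurable_fun; exact: continuous_horner.
- by apply/measurable_EFinP; apply: measurable_funM => //.
- exists [set c]; split; [exact: measurable_set1|exact: lebesgue_measure_set1|].
  move=> x /= h; apply: contrapT => xc; apply: h => Ix.
  have /andP[y0 y1] := yI x Ix.
  apply: cvg_EFin; first exact: nearW.
  rewrite /=; apply: cvgM; first exact: cvg_cst.
  rewrite (_ : (fun n => _) = (fun n => step_poly n (y x))); last by apply/funext => n; exact: PE.
  have [xlc|clx|//] := ltgtP x c.
  + rewrite indicE mem_set /=; last by rewrite in_itv /= ltW.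
    apply: cvg_step_poly1 => //; rewrite yE gtrDl pmulr_llt0 ?invr_gt0 //; lra.
  + rewrite indicE memNset /=; last by rewrite in_itv /= => /(lt_le_trans clx); rewrite ltxx.
    apply: cvg_step_poly0 => //; rewrite yE ltrDl divr_gt0 // subr_gt0 //.
- exact: (integrable_abse iG).
- apply/aeW => x n Ix; rewrite !abse_EFin lee_fin normrM ler_piMr // PE.
  by have /andP[h1 h2] := step_poly_itv n (yI x Ix); rewrite ger0_norm.
have z n : (\int[lambda]_(x in I) (G x * (P n).[x])%:E = 0)%E.
  have /fineK <- : (\int[lambda]_(x in I) (G x * (P n).[x])%:E \is a fin_num)%E.
    apply: integrable_fin_num => //; apply: integrable_mul_continuous; exact: continuous_horner.
  by congr EFin; exact: moment_poly.
have : (fun n : nat => \int[lambda]_(x in I) (G x * (P n).[x])%:E)%E @ \oo --> 0%E.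
  by rewrite (_ : (fun n => _) = (fun=> 0%E)); [exact: cvg_cst|apply/funext => n; exact: z].
move=> /(cvg_unique (@ereal_hausdorff R) i2) h.
by rewrite /Rintegral h.
Qed.

(** The primitive of G, extended by 0, vanishes on ]a, b[ by [integral_moment_itv], and its
    derivative is G almost everywhere. *)
Lemma moments_ae0 : ae_eq lambda I (EFin \o G) (fun=> 0%E).
Proof.
pose G' := G \_ I.
have iG' D : measurable (D : set (measurableTypeR R)) -> lambda.-integrable D (EFin \o G').
  move=> mD; apply: (@integrableS _ _ _ _ setT) => //.
  by rewrite -restrict_EFin; apply/(integrable_mkcond _ mI).
have lG' : locally_integrable [set: R] G'.
  by apply: open_integrable_locally; [exact: openT|exact: iG'].
have ends : {ae lambda, forall x, x != a /\ x != b}.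
  exists [set a; b]; split.
  - by apply: measurableU; exact: measurable_set1.
  - by apply: null_set_setU; [exact: measurable_set1|exact: measurable_set1|
      exact: lebesgue_measure_set1|exact: lebesgue_measure_set1].
  - move=> x /= h; apply: contrapT => /not_orP[xa xb]; apply: h.
    by split; apply/eqP.
have := @FTC1Ny _ G' (fun y => iG' _ (measurable_itv _)) lG'.
apply: filterS2 ends; first exact: (ae_filter_ringOfSetsType lambda).
move=> x [xa xb] [_ Fx] Ix /=; congr EFin.
have axb : a < x < b.
  by move: Ix; rewrite /= in_itv /= => /andP[ax xle]; rewrite !lt_neqAle eq_sym xa ax xb xle.
have <- : G' x = G x by rewrite /G' patchE mem_set.
rewrite -Fx derive1E; apply/esym.
have F0 c : a < c < b -> \int[lambda]_(t in `]-oo, c]) G' t = 0.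
  move=> acb; rewrite -(integral_moment_itv acb) [LHS]Rintegral_mkcond [RHS]Rintegral_mkcond.
  apply: eq_Rintegral => t _; rewrite /G' !patchE indicE.
  by case: (t \in `]-oo, c]%classic); case: (t \in I); rewrite ?mulr1 ?mulr0.
rewrite (@near_eq_derive _ _ _ _ (fun=> 0)) ?derive_cst //.
near=> c; apply: F0; near: c; near_simpl.
by have := @near_in_itvoo R a b x; rewrite in_itv /= => /(_ axb).
Unshelve. all: end_near. Qed.

End Moments.

Section Totality.
Variables (R : realType) (q : nat).
Hypothesis q_gt0 : (0 < q)%N.
Local Notation C := R[i].
Local Notation lambda := (@lebesgue_measure R).
Local Notation mu := (@semicircle_measure R q).
Local Notation I := (@semicircle_itv R q).
Local Notation TR := (measurableTypeR R).
Local Notation w := (@semicircle_density R q).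
Local Notation Q := (@sph_poly R q).

Let mI : measurable (I : set TR). Proof. exact: measurable_I. Qed.
Let mw : measurable_fun (I : set TR) w.
Proof. by apply: measurable_funTS; exact: semicircle_density_measurable. Qed.

Lemma square_integrable_sph_poly n : square_integrable mu I (Q n).
Proof.
split; first by apply: measurable_funTS; apply: continuous_measurable_fun; exact: continuous_sph_poly.
under eq_integral do rewrite expr2.
by rewrite (integral_sph_poly _ q_gt0) ltry.
Qed.

(** Passes to G = g times the density, which is Lebesgue integrable since g is square-integrable and
    Q_0 = 1, and whose moments vanish. *)
Lemma sph_poly_orthogonal_eq0 (g : R -> R) : square_integrable mu I g ->
  (forall n, \int[mu]_(x in I) (g x * Q n x) = 0) ->
  (\int[mu]_(x in I) (g x ^+ 2)%:E = 0)%E.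
Proof.
move=> gi gQ; have [mg _] := gi.
pose G x := g x * w x.
have mG : measurable_fun (I : set TR) G by exact: measurable_funM.
have iG : lambda.-integrable I (EFin \o G).
  have := square_integrableM mI gi (square_integrable_sph_poly 0) => /integrableP[_].
  under eq_integral do rewrite /= mulr1.
  rewrite (integral_semicircle _ mI); last exact: measurableT_comp.
  move=> h; apply/integrableP; split; first exact/measurable_EFinP.
  apply: le_lt_trans h; rewrite le_eqVlt; apply/orP; left; apply/eqP.
  by apply: eq_integral => x _; rewrite /= normrM (ger0_norm (semicircle_density_ge0 _ _)).
pose c := 2 * Num.sqrt (q%:R : R).
have r0 : 0 < Num.sqrt (q%:R : R) by rewrite sqrtr_gt0 ltr0n.
have c0 : - c < c by rewrite /c; lra.
have GQ n : \int[lambda]_(x in `[- c, c]) (G x * Q n x) = 0.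
  rewrite -(gQ n) /Rintegral integral_semicircle //.
    by congr fine; apply: eq_integral => x _; rewrite /G mulrAC.
  apply: measurable_funM => //.
  by have [] := square_integrable_sph_poly n.
have cX j : continuous (fun x : R => x ^+ j) by exact: exprn_continuous.
have cXQ k n : continuous (fun x : R => x ^+ k * Q n x).
  by move=> x; apply: cvgM; [exact: cX|exact: continuous_sph_poly].
(* Quantified over n, because x Q_n = q Q_(n+1) + Q_(n-1) lowers k at the cost of changing n. *)
have moments k : (forall n, \int[lambda]_(x in `[- c, c]) (G x * (x ^+ k * Q n x)) = 0).
  elim: k => [|k IH] n.
    by rewrite -[RHS](GQ n); apply: eq_Rintegral => x _; rewrite expr0 mul1r.
  case: n => [|n].
    transitivity (\int[lambda]_(x in `[- c, c]) (G x * (q%:R * (x ^+ k * Q 1%N x) + 0))).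
      apply: eq_Rintegral => x _; rewrite exprSr -!mulrA (sph_poly_rec q_gt0); congr (_ * _).
      by rewrite /sph_poly_pred /=; ring.
    rewrite (@moment_linear R _ _ G iG) //; last by move=> x; exact: cvg_cst.
    rewrite IH mulr0 add0r (@eq_Rintegral _ _ _ _ _ (fun=> 0)) ?Rintegral_cst ?mul0r //.
    by move=> x _; rewrite mulr0.
  transitivity (\int[lambda]_(x in `[- c, c])
      (G x * (q%:R * (x ^+ k * Q n.+2 x) + x ^+ k * Q n x))).
    apply: eq_Rintegral => x _; rewrite exprSr -!mulrA (sph_poly_rec q_gt0).
    by rewrite sph_poly_predS; ring.
  by rewrite (@moment_linear R _ _ G iG) // !IH mulr0 addr0.
have G0 : ae_eq lambda I (EFin \o G) (fun=> 0%E).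
  apply: (moments_ae0 c0 iG) => n; rewrite -[RHS](moments n 0%N).
  by apply: eq_Rintegral => x _; rewrite mulr1.
rewrite (integral_semicircle _ mI); last exact: measurable_funX.
rewrite -[RHS](@integral0 _ _ _ lambda I).
apply: (@ae_eq_integral _ _ _ lambda) => //.
- by apply/measurable_EFinP; apply: measurable_funM => //; exact: measurable_funX.
(* g^2 times the density is g G, which avoids dividing by a density that vanishes at the ends. *)
- have [N [mN N0 sN]] := G0; exists N; split => // x h; apply: sN => gx; apply: h => Ix.
  have [gw] := gx Ix.
  by rewrite /= expr2 -mulrA -/(G x) gw mulr0.
Qed.

Definition sph_polyC n (x : R) : C^o := (Q n x)%:C.

Lemma L2_sph_polyC n : L2 mu I (sph_polyC n).
Proof.
apply/L2P => //; split; first exact: square_integrable_sph_poly.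
by have /(L2P _ mI)[_] := L2_0 mu mI.
Qed.

Lemma L2_dot_sph_polyC n m :
  L2_dot mu I (sph_polyC n) (sph_polyC m) = ((n == m)%:R * q%:R^-1 ^+ n)%:C.
Proof.
apply: complex_eqP => /=.
  transitivity (\int[mu]_(x in I) (Q n x * Q m x)).
    by apply: eq_Rintegral => x _; rewrite /sph_polyC /= ?ReImE /=; ring.
  by rewrite /Rintegral (integral_sph_poly _ q_gt0).
transitivity (\int[mu]_(x in I) (0 : R)).
  by apply: eq_Rintegral => x _; rewrite /sph_polyC /= ?ReImE /=; ring.
by rewrite Rintegral_cst ?mul0r.
Qed.

Lemma total_sph_polyC : total_system (L2 mu I) (L2_dot mu I : (R -> C^o) -> _) sph_polyC.
Proof.
move=> v Lv vQ; have [g1 g2] := (L2P _ mI v).1 Lv.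
have e1 : (\int[mu]_(x in I) (complex.Re (v x) ^+ 2)%:E = 0)%E.
  apply: sph_poly_orthogonal_eq0 => // n.
  have /(congr1 (@complex.Re R)) /= h := vQ n; rewrite -[RHS]h.
  by apply: eq_Rintegral => x _; rewrite !ReImE /=; ring.
have e2 : (\int[mu]_(x in I) (complex.Im (v x) ^+ 2)%:E = 0)%E.
  apply: sph_poly_orthogonal_eq0 => // n.
  have /(congr1 (@complex.Im R)) /= h := vQ n; rewrite -[RHS]h.
  by apply: eq_Rintegral => x _; rewrite !ReImE /=; ring.
apply/EFin_inj; rewrite (L2_sqnormE mI Lv).
under eq_integral do rewrite EFinD.
rewrite ge0_integralD //.
- by rewrite e1 e2 adde0.
- by move=> x _; rewrite lee_fin sqr_ge0.
- by apply/measurable_EFinP; apply: measurable_funX; case: g1.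
- by move=> x _; rewrite lee_fin sqr_ge0.
- by apply/measurable_EFinP; apply: measurable_funX; case: g2.
Qed.

End Totality.

(** * The isomorphism *)

Section DotPrehilbert.
Variables (R : realType) (H : lmodType R[i]) (dot : {dot H for @conjc R}).

Lemma dot_prehilbert : @prehilbert R H setT dot.
Proof.
split=> //.
- by move=> a u v x _ _ _; rewrite linearPl.
- by move=> u v _ _; rewrite (hermitian_subproof v u) expr0 mul1r.
Qed.

Lemma dot_prehilbert_complete : complete_dot dot -> @prehilbert_complete R H setT dot.
Proof.
have HP := dot_prehilbert.
have E u : dot u u = (sqnorm dot u)%:C by rewrite -(sqnormE HP).
move=> cd u _ cu; have [|l hl] := cd u.
  move=> e e0; have [N NP] := cu e e0; exists N => m n Nm Nn.
  by rewrite E ltcR; exact: NP.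
exists l => // e e0; have [N NP] := hl e e0; exists N => n Nn.
by have := NP n Nn; rewrite E ltcR.
Qed.

End DotPrehilbert.

Section Isomorphism.
Context d (T : measurableType d) (R : realType) (mu : {measure set T -> \bar R}) (D : set T).
Hypothesis mD : measurable D.
Local Notation C := R[i].
Local Notation V := (T -> C^o).
Local Notation L2 := (L2 mu D : set V).
Local Notation L2dot := (L2_dot mu D : V -> V -> C).

Lemma ae_eq_pointwise (f1 g1 f2 g2 f3 g3 f g : T -> C) :
  ae_eq mu D f1 g1 -> ae_eq mu D f2 g2 -> ae_eq mu D f3 g3 ->
  (forall x, f1 x = g1 x -> f2 x = g2 x -> f3 x = g3 x -> f x = g x) ->
  ae_eq mu D f g.
Proof.
move=> h1 h2 h3 h; apply: filterS3 h1 h2 h3.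
by move=> x e1 e2 e3 Dx; apply: h; [exact: e1|exact: e2|exact: e3].
Qed.

Variables (y : nat -> V) (nu : nat -> R).
Hypothesis Ly : forall n, L2 (y n).
Hypothesis nu_gt0 : forall n, 0 < nu n.
Hypothesis y_orth : forall n m, L2dot (y n) (y m) = ((n == m)%:R * nu n)%:C.
Hypothesis y_total : total_system L2 L2dot y.

Let LP : prehilbert L2 L2dot. Proof. exact: L2_prehilbert. Qed.
Let LC : prehilbert_complete L2 L2dot. Proof. exact: L2_complete. Qed.

Lemma L2_coefficients_inj (f g : V) : L2 f -> L2 g ->
  (forall n, L2dot f (y n) = L2dot g (y n)) -> ae_eq mu D f g.
Proof.
move=> Lf Lg fg; have Lfg := prehilbertB LP Lf Lg.
have /(L2_sqnorm_eq0 mD Lfg) h : sqnorm L2dot (f - g) = 0.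
  by apply: y_total => // n; rewrite (formBl LP) // fg subrr.
apply: (ae_eq_pointwise h h h) => x e _ _; apply/eqP; rewrite -subr_eq0; apply/eqP; exact: e.
Qed.

Variables (H : lmodType C) (dot : {dot H for @conjc R}) (x : nat -> H).
Hypothesis H_complete : complete_dot dot.
Hypothesis x_orth : forall n m, dot (x n) (x m) = ((n == m)%:R * nu n)%:C.
Hypothesis x_total : total_system setT dot x.

Let HP := dot_prehilbert dot.
Let HC := dot_prehilbert_complete H_complete.
Let Sx n : [set: H] (x n). Proof. by []. Qed.

(** Phi h is chosen by Riesz-Fischer in L^2 with the coefficients of h, so it is linear only almost
    everywhere. Riesz-Fischer in H gives surjectivity. *)
Lemma hilbert_iso_exists : exists Phi : H -> T -> C, hilbert_iso_L2 mu D dot Phi /\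
  forall h n, L2dot (Phi h) (y n) = dot h (x n).
Proof.
have ex h : exists2 f : V, L2 f & forall n, L2dot f (y n) = dot h (x n).
  have [f Lf [hf _]] := riesz_fischer LP Ly nu_gt0 y_orth LC
    (fun N => bessel HP Sx nu_gt0 x_orth N (I : setT h)).
  by exists f.
pose Phi h := projT1 (cid2 (ex h)).
have LPhi h : L2 (Phi h) by rewrite /Phi; case: cid2.
have PhiE h n : L2dot (Phi h) (y n) = dot h (x n) by rewrite /Phi; case: cid2.
exists Phi; split => //; split => //.
- move=> a h1 h2; apply: L2_coefficients_inj => // [|n].
    exact: (prehilbert_closed LP a (LPhi h1) (LPhi h2)).
  rewrite PhiE (prehilbert_linear HP) // -!PhiE.
  by rewrite -(prehilbert_linear LP _ (LPhi h1) (LPhi h2) (Ly n)).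
- move=> h1 h2.
  by apply: (isometry_of_coefficients LP HP LC HC Ly Sx nu_gt0 y_orth x_orth y_total x_total).
- move=> f Lf.
  have [h _ [hf _]] := riesz_fischer HP Sx nu_gt0 x_orth HC
    (fun N => bessel LP Ly nu_gt0 y_orth N Lf).
  by exists h; apply: L2_coefficients_inj => // n; rewrite PhiE hf.
Qed.

(** For uniqueness: the images of the x n determine all coefficients of Phi h. *)
Lemma hilbert_iso_coefficients (Phi : H -> T -> C) : hilbert_iso_L2 mu D dot Phi ->
  (forall n, ae_eq mu D (Phi (x n)) (y n)) ->
  forall h n, L2dot (Phi h) (y n) = dot h (x n).
Proof.
move=> PhiP Phix h n; have LPhi := iso_L2 PhiP.
rewrite -(iso_isometry PhiP) (prehilbert_hermitian LP (Ly n) (LPhi h)).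
rewrite -(ae_eq_L2_dot mD (LPhi (x n)) (Ly n) (LPhi h) (Phix n)).
by rewrite -(prehilbert_hermitian LP (LPhi (x n)) (LPhi h)).
Qed.

End Isomorphism.

Section MultiplicationOperator.
Variables (R : realType) (q : nat).
Local Notation C := R[i].
Local Notation mu := (@semicircle_measure R q).
Local Notation I := (@semicircle_itv R q).
Local Notation TR := (measurableTypeR R).

Let mI : measurable (I : set TR). Proof. exact: measurable_I. Qed.

(** On the interval |x| is at most 2 sqrt(q). *)
Lemma square_integrable_mul_id (g : R -> R) :
  square_integrable mu I g -> square_integrable mu I (fun x => x * g x).
Proof.
move=> gi; have [mg _] := gi.
have [mc ic] := square_integrableZ mI (2 * Num.sqrt q%:R) gi.
have mx : measurable_fun (I : set TR) (fun x => x * g x).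
  by apply: measurable_funM => //; exact: measurable_id.
split => //; apply: le_lt_trans ic; apply: ge0_le_integral => //.
- by move=> x _; rewrite lee_fin sqr_ge0.
- by apply/measurable_EFinP; exact: measurable_funX.
- by apply/measurable_EFinP; exact: measurable_funX.
- move=> x; rewrite /semicircle_itv /= in_itv /= -ler_norml => xI; rewrite lee_fin !exprMn.
  apply: ler_wpM2r; first exact: sqr_ge0.
  by rewrite -exprMn -[x ^+ 2]ger0_norm ?sqr_ge0 // normrX lerXn2r // ?nnegrE.
Qed.

Lemma L2_mul_id (f : R -> C) : L2 mu I f -> L2 mu I (fun x => x%:C * f x).
Proof.
move=> /(L2P _ mI)[f1 f2]; apply/L2P => //; split.
  by rewrite (_ : (fun x => _) = (fun x => x * complex.Re (f x)));
    [exact: square_integrable_mul_id|apply/funext => x; rewrite !ReImE /=; ring].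
by rewrite (_ : (fun x => _) = (fun x => x * complex.Im (f x)));
  [exact: square_integrable_mul_id|apply/funext => x; rewrite !ReImE /=; ring].
Qed.

Lemma L2_dot_mul_id (f g : R -> C) :
  L2_dot mu I (fun x => x%:C * f x) g = L2_dot mu I f (fun x => x%:C * g x).
Proof.
by rewrite /L2_dot; apply: complex_eqP => /=; apply: eq_Rintegral => x _; rewrite !ReImE /=; ring.
Qed.

End MultiplicationOperator.

Section Completion.
Variables (R : realType) (F : nonArchLocalFieldType).
Hypothesis F_char : 2%N \notin [pchar F].
Variable w : F.
Hypothesis w_gen : generates_max_ideal w.
Local Notation C := R[i].
Variable psi0 : F -> C.
Hypothesis psi0_char : additive_character psi0.
Hypothesis psi0_cond : conductor_integers psi0.
Local Notation Geps := (PGL2 (dual F)).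
Local Notation VK := (V_m1_Keps psi0).
Variable ip : (Geps -> C) -> (Geps -> C) -> C.
Hypothesis ipU : unitary_structure (V_m1 psi0) ip.
Hypothesis ip00 : ip (sph psi0 0) (sph psi0 0) = 1.
Variables (H : lmodType C) (dot : {dot H for @conjc R}) (iota : (Geps -> C) -> H).
Hypothesis HC : hilbert_completion VK ip dot iota.
Local Notation q := (residue_card F).
Local Notation mu := (@semicircle_measure R q).
Local Notation I := (@semicircle_itv R q).
Local Notation y := (@sph_polyC R q).
Local Notation L2dot := (L2_dot mu I : (R -> C^o) -> (R -> C^o) -> C).

Let V_sph' := V_sph w_gen psi0_char psi0_cond.
Let x n := iota (sph psi0 n).
Let nu n : R := q%:R^-1 ^+ n.
Let q_gt0 : (0 < q)%N := residue_card_gt0 F.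
Let nu_gt0 n : 0 < nu n. Proof. by rewrite exprn_gt0 // invr_gt0 ltr0n. Qed.
Let mI : measurable (I : set (measurableTypeR R)). Proof. exact: measurable_I. Qed.
Let HP := dot_prehilbert dot.

Lemma dot_iota_sph n m : dot (x n) (x m) = ((n == m)%:R * nu n)%:C.
Proof.
rewrite (completion_isometry HC) //.
have [->|nm] := eqVneq n m.
  rewrite (ip_sph_norm w_gen psi0_char psi0_cond F_char ipU m ip00) mul1r.
  by rewrite rmorphXn /= fmorphV /= rmorph_nat.
by rewrite (ip_sph_sym w_gen psi0_char psi0_cond F_char ipU nm) mul0r.
Qed.

Lemma V_zero : VK (fun=> 0).
Proof.
have -> : (fun=> 0) = radial psi0 (fun=> 0) :> (Geps -> C).
  by apply/funext => g; rewrite /radial mulr0.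
by apply: (V_radial w_gen psi0_char psi0_cond); exists 0%N => n; rewrite eqxx.
Qed.

Lemma iota_zero : iota (fun=> 0) = 0.
Proof.
have := completion_linear HC 1 V_zero V_zero.
rewrite scale1r (_ : (fun _ => _) = (fun=> 0)); last by apply/funext => g; rewrite mulr0 addr0.
by move=> /eqP; rewrite -subr_eq0 opprD addNKr oppr_eq0 => /eqP.
Qed.

(** A vector v orthogonal to the x n is orthogonal to the whole image of iota, which is dense. *)
Lemma iota_total : total_system setT dot x.
Proof.
move=> v _ vx.
(* Induction on the length of the support, since linearity of iota is available for two terms at a
   time. *)
have radial0 M (a : int -> C) : (forall n : int, a n != 0 -> 0 <= n < M%:Z) ->
    dot v (iota (radial psi0 a)) = 0.
  elim: M a => [|M IH] a aM.
    have -> : radial psi0 a = fun=> 0.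
      apply/funext => g; rewrite /radial.
      set n := (X in a X); have [->|/aM] := eqVneq (a n) 0; first by rewrite mulr0.
      by move=> /andP[n0 n1]; have := le_lt_trans n0 n1; rewrite ltxx.
    by rewrite iota_zero (form0r HP).
  pose b n := if n == M%:Z then 0 else a n.
  have bM n : b n != 0 -> 0 <= n < M%:Z.
    rewrite /b; case: ifPn => [|nM]; first by rewrite eqxx.
    by move=> /aM; move: nM; lia.
  have bf : fin_supp b by exists M => n /bM; lia.
  have aE : a = fun n => a M%:Z * delta R M n + b n.
    apply/funext => n; rewrite /b /delta; case: eqP => [->|_]; first by rewrite mulr1 addr0.
    by rewrite mulr0 add0r.
  have Vb := V_radial w_gen psi0_char psi0_cond bf.
  have e : iota (radial psi0 a) = a M%:Z *: x M + iota (radial psi0 b).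
    apply: etrans (completion_linear HC (a M%:Z) (V_sph' M) Vb).
    by apply: congr1; rewrite {1}aE; exact: radial_linear.
  by rewrite e (formDr HP) // (formZr HP) // IH // addr0 (vx M) mulr0.
have vf f : VK f -> dot v (iota f) = 0.
  move=> Vf; rewrite (V_eq_radial w_gen psi0_char psi0_cond F_char Vf).
  have [M hM] := fin_supp_profile w_gen psi0_cond Vf.
  by apply: (radial0 M.+1) => n /hM; lia.
(* Density would give |v - iota f|^2 < |v|^2, whereas orthogonality makes it |v|^2 + |iota f|^2. *)
apply/eqP; rewrite eq_le (sqnorm_ge0 HP) // andbT leNgt; apply/negP => v0.
have [f Vf] := completion_dense HC v v0.
rewrite (sqnormE HP) // ltcR => hf; have := hf.
rewrite (sqnormD HP) // (sqnormN HP) // -scaleN1r (formZr HP) // vf // mulr0 mulr0 addr0.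
by rewrite gtrDl ltNge (sqnorm_ge0 HP).
Qed.

Lemma VK_T0 f : VK f -> VK (T0 w f).
Proof.
move=> Vf; rewrite (V_eq_radial w_gen psi0_char psi0_cond F_char Vf).
have af := fin_supp_profile w_gen psi0_cond Vf.
rewrite (T0_radial w_gen psi0_char psi0_cond F_char af).
by apply: (V_radial w_gen psi0_char psi0_cond); exact: (fin_supp_hecke w_gen af).
Qed.

Lemma VK_sph_pred n : VK (sph_pred psi0 n).
Proof. by case: n => [|n]; [exact: V_zero|exact: V_sph']. Qed.

Lemma iota_T0_sph n : iota (T0 w (sph psi0 n)) = q%:R *: x n.+1 + iota (sph_pred psi0 n).
Proof.
rewrite (T0_sph w_gen psi0_char psi0_cond F_char).
exact: (completion_linear HC q%:R (V_sph' n.+1) (VK_sph_pred n)).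
Qed.

Lemma dot_iota_T0 f n : VK f ->
  dot (iota (T0 w f)) (x n) = dot (iota f) (q%:R *: x n.+1 + iota (sph_pred psi0 n)).
Proof.
move=> Vf; rewrite -iota_T0_sph.
rewrite (completion_isometry HC (VK_T0 Vf) (V_sph' n)) (completion_isometry HC Vf (VK_T0 (V_sph' n))).
exact: (T0_selfadjoint F_char w_gen psi0_char psi0_cond ipU Vf (V_sph' n)).
Qed.

Definition sph_polyC_pred n (t : R) : C^o := (@sph_poly_pred R q n t)%:C.

Lemma mul_id_sph_polyC n (t : R) : t%:C * y n t = q%:R * y n.+1 t + sph_polyC_pred n t.
Proof.
rewrite /sph_polyC /sph_polyC_pred -rmorphM (sph_poly_rec q_gt0) rmorphD rmorphM /=.
by rewrite rmorph_nat.
Qed.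

(** Compares coefficients: T0 and multiplication by x are both symmetric and obey the same recursion
    on the x n and on the polynomials. *)
Lemma iso_T0 (Phi : H -> R -> C) : hilbert_iso_L2 mu I dot Phi ->
  (forall h n, L2dot (Phi h) (y n) = dot h (x n)) ->
  forall f, VK f -> ae_eq mu I (Phi (iota (T0 w f))) (fun t => t%:C * Phi (iota f) t).
Proof.
move=> PhiP PhiE f Vf; have LPhi := iso_L2 PhiP; have LP := L2_prehilbert mu mI.
have Ly := L2_sph_polyC R q_gt0.
apply: (L2_coefficients_inj mI Ly (total_sph_polyC q_gt0)) => // [|n]; first exact: L2_mul_id.
rewrite PhiE dot_iota_T0 // [RHS]L2_dot_mul_id.
have -> : (fun t => t%:C * y n t) = q%:R *: y n.+1 + sph_polyC_pred n :> (R -> C^o).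
  by apply/funext => t; exact: mul_id_sph_polyC.
have Lp : L2 mu I (sph_polyC_pred n).
  by case: n => [|n]; [exact: L2_0|exact: Ly].
rewrite (formDr HP) // (formZr HP) // (formDr LP) //; last exact: (prehilbertZ LP).
rewrite (formZr LP) // PhiE; congr (_ + _).
case: n {Lp} => [|n].
  by rewrite /= iota_zero (form0r HP) // (form0r LP).
by rewrite -PhiE.
Qed.

(** The recursion has two terms, so the induction carries n and n - 1 together; solving for the next
    term divides by q. *)
Lemma iso_sph (Phi : H -> R -> C) : hilbert_iso_L2 mu I dot Phi ->
  (forall f, VK f -> ae_eq mu I (Phi (iota (T0 w f))) (fun t => t%:C * Phi (iota f) t)) ->
  ae_eq mu I (Phi (x 0)) (fun=> 1) ->
  forall n, ae_eq mu I (Phi (x n)) (y n).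
Proof.
move=> PhiP PhiT Phi0 n.
suff [] : ae_eq mu I (Phi (x n)) (y n) /\
  ae_eq mu I (Phi (iota (sph_pred psi0 n))) (sph_polyC_pred n) by [].
elim: n => [|n [IH1 IH2]].
  split; first exact: Phi0.
  rewrite /= iota_zero.
  (* Phi is linear only almost everywhere, so Phi 0 = 0 is obtained almost everywhere from Phi 0 =
     Phi 0 + Phi 0. *)
  have h := iso_linear PhiP 1 0 0; apply: (ae_eq_pointwise h h h) => t.
  rewrite scale1r addr0 mul1r => /eqP.
  by rewrite -subr_eq0 opprD addNKr oppr_eq0 => /eqP -> _ _.
split; last exact: IH1.
have h1 := PhiT _ (V_sph' n).
have h2 := iso_linear PhiP q%:R (x n.+1) (iota (sph_pred psi0 n)).
rewrite -iota_T0_sph in h2.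
have h12 : ae_eq mu I (fun t => q%:R * Phi (x n.+1) t + Phi (iota (sph_pred psi0 n)) t)
    (fun t => t%:C * Phi (x n) t).
  by apply: (ae_eq_pointwise h1 h2 h2) => t e1 e2 _; rewrite -e2.
apply: (ae_eq_pointwise h12 IH1 IH2) => t + e1 e2; rewrite e1 e2 mul_id_sph_polyC.
move=> /addIr; apply: mulfI; by rewrite pnatr_eq0 -lt0n.
Qed.

End Completion.

Theorem proposition5p3 (R : realType) (F : nonArchLocalFieldType)
  (F_char : 2%N \notin [pchar F])
  (w : F) (w_gen : generates_max_ideal w)
  (psi0 : F -> R[i]) (psi0_char : additive_character psi0)
  (psi0_cond : conductor_integers psi0) :
  (exists! f0, spherical_f0 psi0 w f0) /\
  forall f0 : PGL2 (dual F) -> R[i], spherical_f0 psi0 w f0 ->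
  forall ip : (PGL2 (dual F) -> R[i]) -> (PGL2 (dual F) -> R[i]) -> R[i],
    unitary_structure (V_m1 psi0) ip -> ip f0 f0 = 1 ->
  forall (H : lmodType R[i]) (dot : {dot H for @conjc R})
    (iota : (PGL2 (dual F) -> R[i]) -> H),
    hilbert_completion (V_m1_Keps psi0) ip dot iota ->
  let q := residue_card F in
  let mu := @semicircle_measure R q in
  let I := @semicircle_itv R q in
  let Phi_spec := fun Phi : H -> R -> R[i] =>
    [/\ hilbert_iso_L2 mu I dot Phi,
        (forall f, V_m1_Keps psi0 f ->
           ae_eq mu I (Phi (iota (T0 w f))) (fun x => x%:C * Phi (iota f) x)) &
        ae_eq mu I (Phi (iota f0)) (fun=> 1)] in
  exists Phi, Phi_spec Phi /\
    forall Phi', Phi_spec Phi' -> forall h, ae_eq mu I (Phi' h) (Phi h).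
Proof.
have f0P := spherical_f0P w_gen psi0_char psi0_cond F_char.
split.
  by exists (sph psi0 0); split; [exact/f0P|move=> f /f0P].
move=> f0 /f0P -> ip ipU ip00 H dot iota HC q mu I Phi_spec.
have q_gt0 : (0 < q)%N := residue_card_gt0 F.
have mI : measurable (I : set (measurableTypeR R)) by exact: measurable_I.
have nu_gt0 n : 0 < (q%:R : R)^-1 ^+ n by rewrite exprn_gt0 // invr_gt0 ltr0n.
have x_orth := dot_iota_sph F_char w_gen psi0_char psi0_cond ipU ip00 HC.
have x_total := iota_total F_char w_gen psi0_char psi0_cond HC.
have y_total := @total_sph_polyC R q q_gt0.
have Ly := @L2_sph_polyC R q q_gt0.
have [Phi [PhiP PhiE]] := hilbert_iso_exists mI Ly nu_gt0 (@L2_dot_sph_polyC R q q_gt0) y_total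
  (completion_complete HC) x_orth x_total.
have LPhi := iso_L2 PhiP.
exists Phi; split.
  split => //.
  - exact: (iso_T0 F_char w_gen psi0_char psi0_cond ipU HC PhiP PhiE).
  (* The constant function 1 is Q_0. *)
  - apply: (L2_coefficients_inj mI Ly y_total (LPhi _) (Ly 0%N)) => n.
    by rewrite PhiE (L2_dot_sph_polyC _ q_gt0); exact: x_orth.
move=> Phi' [Phi'P Phi'T Phi'0] h.
have Phi'x := iso_sph F_char w_gen psi0_char psi0_cond HC Phi'P Phi'T Phi'0.
apply: (L2_coefficients_inj mI Ly y_total (iso_L2 Phi'P h) (LPhi h)) => n.
by rewrite PhiE (hilbert_iso_coefficients mI Ly Phi'P Phi'x).
Qed.
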